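(* Any contingent claim $\xi$ in the fractional $(B,S)$-market is weakly hedgeable, and its weak hedging cost can be any real number. That is, for every non-negative $\mathcal F_1$-measurable random variable $\xi$ and every $V_0\in\mathbb R$ there exists a portfolio $\Pi$, self-financing on each interval $[0,t]$ with $t<1$, such that $V^\Pi_0=V_0$ and $\lim_{t\to1-}V^\Pi_t=\xi$ almost surely.
   Context: Let $B^H=\{B^H_t,t\in[0,1]\}$ be a fractional Brownian motion with Hurst parameter $H\in(1/2,1)$ on a complete probability space $(\Omega,\mathcal F,\mathsf P)$, i.e. a centered Gaussian process with continuous paths and $\mathsf E[B^H_tB^H_s]=\frac12(s^{2H}+t^{2H}-|s-t|^{2H})$. The fractional $(B,S)$-market on $[0,1]$ consists of a bond $B_t=\exp\{\int_0^t r_s\,ds\}$ and a stock $S_t=S_0\exp\{\mu t+\sigma B^H_t\}$, where $S_0>0$, $\mu\in\mathbb R$, $\sigma\ne0$ are constants and the interest rate $r$ is a (possibly random) process bounded in absolute value by a non-random constant. In differential form, $dB_t=r_tB_t\,dt$, $dS_t=\mu S_t\,dt+\sigma S_t\,dB^H_t$. The filtration $\mathbb F=\{\mathcal F_t\}$ is the ($\mathsf P$-completed) one generated by $B$ and $S$: $\mathcal F_t=\sigma\{B_u,S_u,u\le t\}=\sigma\{B_u,B^H_u,u\le t\}$; it is left-continuous. For $\alpha>0$, $t\in(0,1]$ put $\|f\|_{\alpha,t}=\int_0^t\left(\frac{|f(s)|}{s^\alpha}+\int_0^s\frac{|f(s)-f(z)|}{(s-z)^{1+\alpha}}dz\right)ds$.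 Integrals with respect to $B^H$ are pathwise generalized Lebesgue--Stieltjes integrals: $\int_0^tf_s\,dB^H_s$ is well defined if $\|f\|_{\alpha,t}<\infty$ a.s. for some $\alpha\in(1-H,1/2)$, and then $$\int_0^t f_s\,dB^H_s=\frac{1}{\Gamma(1-\alpha)\Gamma(\alpha)}\int_0^t\left(\frac{f(x)}{x^\alpha}+\alpha\int_0^x\frac{f(x)-f(u)}{(x-u)^{1+\alpha}}du\right)\left(\frac{B^H_t-B^H_x}{(t-x)^{1-\alpha}}+(1-\alpha)\int_x^t\frac{B^H_u-B^H_x}{(u-x)^{2-\alpha}}du\right)dx$$ (a value not depending on the choice of such $\alpha$). A portfolio is an $\mathbb F$-predictable process $\Pi=(\pi^0_t,\pi^1_t)_{t\in[0,1]}$ ($\pi^0$: number of bonds, $\pi^1$: number of shares), with value $V^\Pi_t=\pi^0_tB_t+\pi^1_tS_t$. It is self-financing on $[0,T]$ if for all $t\in[0,T]$ $$V^\Pi_t=V^\Pi_0+\int_0^t\big(\pi^0_ur_uB_u+\pi^1_u\mu S_u\big)du+\int_0^t\sigma\pi^1_uS_u\,dB^H_u,$$ where the integrals are required to be well defined as Lebesgue and generalized Lebesgue--Stieltjes integrals respectively. A contingent claim is a non-negative $\mathcal F_1$-measurable random variable. *)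

(* Defs.v *)
From HB Require Import structures.
From mathcomp Require Import all_boot all_order all_algebra.
From mathcomp Require Import all_classical all_reals all_analysis.

Set Implicit Arguments.
Unset Strict Implicit.
Unset Printing Implicit Defensive.

Import Order.TTheory GRing.Theory Num.Theory.
Import numFieldNormedType.Exports.

Local Open Scope classical_set_scope.
Local Open Scope ring_scope.

(* A process indexed by [0,1] is a function R -> Omega -> R; every condition
   below constrains it only at times in [0,1]. *)

Section fractional_brownian_motion.
Context {d : measure_display} {Omega : measurableType d} {R : realType}.
Variable P : probability Omega R.

(* The library's [normal_prob m 0] is not the point mass at m, so the
   degenerate law is spelled out. *)
Definition gaussian_law (m s : R) (A : set R) : \bar R :=
  if s == 0 then \d_m A else normal_prob m s A.

Definition gaussian_rv (X : Omega -> R) : Prop :=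
  exists m s : R, 0 <= s /\
    forall A : set R, measurable A -> P (X @^-1` A) = gaussian_law m s A.

(* Every finite linear combination of the values of X is Gaussian. *)
Definition gaussian_process (X : R -> Omega -> R) : Prop :=
  forall (n : nat) (t c : 'I_n -> R), (forall i, 0 <= t i <= 1) ->
    gaussian_rv (fun w => \sum_(i < n) c i * X (t i) w).

Record is_fBm (H : R) (X : R -> Omega -> R) : Prop := IsFBm {
  fBm_measurable : forall t, 0 <= t <= 1 -> measurable_fun setT (X t) ;
  fBm_gaussian : gaussian_process X ;
  fBm_centered : forall t, 0 <= t <= 1 -> 'E_P[X t]%E = 0%E ;
  fBm_covariance : forall s t, 0 <= s <= 1 -> 0 <= t <= 1 ->
    'E_P[fun w => (X t w * X s w)%R]%E =
      (2^-1 * (s `^ (2 * H) + t `^ (2 * H) - `|s - t| `^ (2 * H)))%:E ;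
  fBm_continuous : forall w : Omega,
    {within `[0, 1], continuous (fun t : R => X t w)}
}.

End fractional_brownian_motion.

Section pathwise_integral.
Context {R : realType}.
Local Notation leb := (@lebesgue_measure R).

Definition Gamma (a : R) : R :=
  \int[leb]_(x in `]0, +oo[) (x `^ (a - 1) * expR (- x)).

Definition normW (alpha t : R) (f : R -> R) : \bar R :=
  (\int[leb]_(s in `[0%R, t])
     ((`|f s| / s `^ alpha)%:E +
      \int[leb]_(z in `[0%R, s]) (`|f s - f z| / (s - z) `^ (1 + alpha))%:E))%E.

(* The generalized Lebesgue-Stieltjes integral of f with respect to g over
   [0,t], computed with parameter alpha; meaningful when normW alpha t f is
   finite. *)
Definition gLS_integral (alpha : R) (f g : R -> R) (t : R) : R :=
  (Gamma (1 - alpha) * Gamma alpha)^-1 *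
  \int[leb]_(x in `[0, t])
    ((f x / x `^ alpha +
      alpha * \int[leb]_(u in `[0, x]) ((f x - f u) / (x - u) `^ (1 + alpha))) *
     ((g t - g x) / (t - x) `^ (1 - alpha) +
      (1 - alpha) *
      \int[leb]_(u in `[x, t]) ((g u - g x) / (u - x) `^ (2 - alpha)))).

End pathwise_integral.

Section filtration.
Context {d : measure_display} {Omega : measurableType d} {R : realType}.

Definition market_filtration (P : probability Omega R)
    (bd st : R -> Omega -> R) (t : R) : set (set Omega) :=
  <<s [set E | P.-negligible E \/
        exists (u : R) (A : set R), [/\ 0 <= u <= t, measurable A &
          E = bd u @^-1` A \/ E = st u @^-1` A]] >>.

(* A sigma-algebra on the set [0,1] x Omega. *)
Definition predictable_sets (F : R -> set (set Omega)) :
    set (set (R * Omega)) :=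
  <<s `[0, 1] `*` setT,
      [set E | (exists A, F 0 A /\ E = [set 0] `*` A) \/
        exists (s t : R) (A : set Omega),
          [/\ 0 <= s, s < t, t <= 1, F s A & E = `]s, t] `*` A]] >>.

Definition predictable (F : R -> set (set Omega)) (X : R -> Omega -> R) : Prop :=
  forall A : set R, measurable A ->
    predictable_sets F
      ((`[0, 1] `*` setT) `&` [set p : R * Omega | A (X p.1 p.2)]).

End filtration.

Section market.
Context {d : measure_display} {Omega : measurableType d} {R : realType}.
Variable P : probability Omega R.
Local Notation leb := (@lebesgue_measure R).

Definition bounded_rate (r : R -> Omega -> R) : Prop :=
  measurable_fun ((`[0, 1] `*` setT) : set (measurableTypeR R * Omega)%type)
    (fun p => r p.1 p.2) /\
  exists C : R, forall t w, 0 <= t <= 1 -> `|r t w| <= C.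

Definition bond (r : R -> Omega -> R) (t : R) (w : Omega) : R :=
  expR (\int[leb]_(s in `[0, t]) r s w).

Definition stock (S0 mu sigma : R) (BH : R -> Omega -> R) (t : R) (w : Omega) : R :=
  S0 * expR (mu * t + sigma * BH t w).

Definition contingent_claim (F : R -> set (set Omega)) (xi : Omega -> R) : Prop :=
  (forall w, 0 <= xi w) /\
  (forall A : set R, measurable A -> F 1 (xi @^-1` A)).

Definition portfolio_value (bd st pi0 pi1 : R -> Omega -> R) (t : R) (w : Omega) : R :=
  pi0 t w * bd t w + pi1 t w * st t w.

(* Since normW alpha is nondecreasing in time, its finiteness at T makes all
   the stochastic integrals over [0,t], t <= T, well defined.  The value of the
   integral does not depend on the admissible alpha, which is deterministic. *)
Definition self_financing (H S0 mu sigma : R) (BH r pi0 pi1 : R -> Omega -> R)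
    (T : R) : Prop :=
  let bd := bond r in
  let st := stock S0 mu sigma BH in
  let V := portfolio_value bd st pi0 pi1 in
  let drift w u := pi0 u w * r u w * bd u w + pi1 u w * mu * st u w in
  let vol w u := sigma * pi1 u w * st u w in
  {ae P, forall w, leb.-integrable `[0, T] (EFin \o drift w)} /\
  exists alpha : R,
    [/\ 1 - H < alpha, alpha < 1 / 2,
        {ae P, forall w, (normW alpha T (vol w) < +oo)%E} &
        {ae P, forall w, forall t, 0 <= t <= T ->
           V t w = V 0 w + \int[leb]_(u in `[0, t]) drift w u
                   + gLS_integral alpha (vol w) (BH ^~ w) t}].

End market.

(* Main.v *)
Require Import Defs.
From HB Require Import structures.
From mathcomp Require Import all_boot all_order all_algebra.
From mathcomp Require Import all_classical all_reals all_analysis.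
From mathcomp Require Import measurable_realfun zify ring lra.
Import Order.TTheory GRing.Theory Num.Theory.
Import numFieldNormedType.Exports.
Set Implicit Arguments.
Unset Strict Implicit.
Unset Printing Implicit Defensive.
Local Open Scope classical_set_scope.
Local Open Scope ring_scope.

(** For [H > 1/2] the paths of fractional Brownian motion have zero quadratic variation, so pathwise
    integrals obey the ordinary chain rule: with [X] ([asset], on the market [price]) the logarithm
    of the discounted stock divided by [sigma], up to a constant, trading can produce discounted
    gains close to [f(X_t) - f(X_a)] for a smooth [f]. Take [f(x) = bump(K (x - X_a))] with
    [bump x = x^2 / (1 + x^2)]. This gain starts at 0, stays in [[0, 1]], and is at least 4/5 once
    [|X - X_a| >= 2 / K], whatever the sign of the move. Within a short period, and with probability
    close to 1, wealth can thus be moved from its present level most of the way to any prescribed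
    one.

    The discounted claim is an almost sure limit of variables [z n] known at deterministic times
    [tm n] increasing to 1, because the filtration is generated by continuous processes
    ([adapted_approximation]). In period [n] the strategy plays the bump gain with stake
    [z n - wealth n]. When the gain is within 1/2 of 1 the gap to the target is at least halved, so
    discounted wealth converges to the limit of the [z n] from any initial value ([dwealth_cvg]).
    Lengths [l n] and scales [K n] are deterministic and make a failure in period [n] have
    probability at most [2^-n], by a Gaussian small-ball bound ([fBm_small_ball]); Borel-Cantelli
    concludes ([market_hedging]).

    Positions are piecewise constant in [X]: the gain of a period is a Riemann sum over [N + 1]
    cells and differs from the bump by at most a multiple of [K^2 (N + 1)^(1 - 2 b)]
    ([period_gain_bump]), the paths being Holder of some order [b] between [1/2] and [H]
    ([fBm_holder], by dyadic chaining). Self-financing then only requires the integral of the bond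
    price over one interval against [B^H]. The integral of an indicator is computed exactly
    ([gLS_box1]) by inverting a fractional derivative ([fderiv_inversion], with the constant
    supplied by [Gamma_reflection]); a Lipschitz integrand costs an error of order [2 - al > 1] on a
    short interval ([gLS_box_local]); and a function with increments of order larger than 1 is
    constant ([sewing_const]). This yields the product rule [path_piece], and by linearity
    [strategy_gain] and [strategy_self_financing]. Predictability follows from adaptedness and left
    continuity ([left_continuous_predictable]). *)

(** * Improper integrals of powers and affine substitution *)

Section improper.
Context {R : realType}.
Notation leb := (@lebesgue_measure R).

Lemma is_derive_continuous (F : R -> R) (x d : R) : is_derive x 1 F d -> {for x, continuous F}.
Proof. by move=> [dF _]; apply/differentiable_continuous/derivable1_diffP. Qed.

(** Monotone convergence over compact intervals exhausting []a, b[], on which the usual theorem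
    applies. One-sided limits of [F] replace differentiability at the ends, so integrands singular
    there are covered. *)
Lemma ge0_improper_FTC2 (F f : R -> R) (a b : R) : a < b ->
  (forall x, a < x < b -> is_derive x 1 F (f x)) ->
  (forall x, a < x < b -> {for x, continuous f}) ->
  (forall x, a < x < b -> 0 <= f x) ->
  F x @[x --> a^'+] --> F a -> F x @[x --> b^'-] --> F b ->
  (\int[leb]_(x in `[a, b]) (f x)%:E = (F b - F a)%:E)%E.
Proof.
move=> ab dF cf f0 Fa Fb.
have mf : measurable_fun `]a, b[ f.
  apply: open_continuous_measurable_fun => //.
  by move=> x; rewrite inE/= in_itv/= => /cf.
have mfE : measurable_fun `]a, b[ (EFin \o f) by exact/measurable_EFinP.
rewrite (integral_itv_bndoo _ _ mfE).
(* The denominators start at 3, so that [a + dl n < b - dl n] already for [n = 0]. *)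
pose dl (n : nat) : R := (b - a) / n.+3%:R.
have ba0 : 0 < b - a by rewrite subr_gt0.
have dl0 n : 0 < dl n by rewrite divr_gt0// ltr0n.
have dlE n : dl n * n.+3%:R = b - a by rewrite /dl divfK// pnatr_eq0.
have dlm n : dl n * 3 <= b - a.
  by rewrite -(dlE n) ler_wpM2l ?(ltW (dl0 n))// ler_nat.
pose I (n : nat) : set R := `[a + dl n, b - dl n]%classic.
have dlnd : {homo dl : n m / (n <= m)%N >-> m <= n}.
  move=> n m nm; rewrite /dl ler_pM2l// lef_pV2 ?posrE ?ltr0n// ler_nat.
  by rewrite !ltnS.
have dlcvg : dl n @[n --> \oo] --> 0.
  rewrite -(mulr0 (b - a)); apply: cvgM; first exact: cvg_cst.
  have := @cvg_harmonic R; rewrite -(cvg_shiftn 2); apply: cvg_trans.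
  by apply: near_eq_cvg; near=> n; rewrite /harmonic/= addn2.
have UI : \bigcup_n I n = `]a, b[%classic.
  apply/seteqP; split => x.
    move=> [n _]; rewrite /I/= !in_itv/= => /andP[h1 h2]; apply/andP; split.
      by rewrite (lt_le_trans _ h1)// ltrDl.
    by rewrite (le_lt_trans h2)// gtrDl oppr_lt0.
  rewrite /= in_itv/= => /andP[h1 h2].
  have m0 : 0 < Num.min (x - a) (b - x) by rewrite lt_min !subr_gt0 h1 h2.
  have /cvgrPdist_lt/(_ _ m0)[N _ /(_ N (leqnn N))] := dlcvg.
  rewrite /= sub0r normrN gtr0_norm// lt_min => /andP[k1 k2].
  by exists N => //; rewrite /I/= in_itv/=; apply/andP; split; lra.
have cI : (\int[leb]_(x in I n) (f x)%:E @[n --> \oo] --> \int[leb]_(x in `]a, b[) (f x)%:E)%E.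
  rewrite -UI; apply: ge0_nondecreasing_set_cvg_integral.
  - move=> n m nm; apply/subsetPset => x; rewrite /I/= !in_itv/=.
    by have := dlnd _ _ nm; move=> h /andP[h1 h2]; apply/andP; split; lra.
  - by move=> n; exact: measurable_itv.
  - by move=> n; apply: measurable_funS mfE => //; rewrite -UI; exact: bigcup_sup.
  - move=> n x In; rewrite lee_fin f0//.
    have : (\bigcup_n I n) x by exists n.
    by rewrite UI/= in_itv.
have EI n : (\int[leb]_(x in I n) (f x)%:E = (F (b - dl n) - F (a + dl n))%:E)%E.
  have lt1 : a + dl n < b - dl n by have := dlm n; have := dl0 n; lra.
  have sub x : a + dl n <= x <= b - dl n -> a < x < b.
    by move=> /andP[h1 h2]; have := dl0 n; move=> h; apply/andP; split; lra.
  rewrite (@continuous_FTC2 _ f F)//.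
  - apply: continuous_in_subspaceT => x; rewrite inE/= in_itv/= => /sub; exact: cf.
  - split.
    + by move=> x; rewrite in_itv/= => /andP[/ltW h1 /ltW h2]; have [] := dF x (sub _ (introT andP (conj h1 h2))).
    + apply: cvg_at_right_filter; apply: is_derive_continuous; apply: dF; apply: sub.
      by rewrite lexx ltW.
    + apply: cvg_at_left_filter; apply: is_derive_continuous; apply: dF; apply: sub.
      by rewrite lexx ltW.
  - move=> x; rewrite in_itv/= => /andP[/ltW h1 /ltW h2].
    have [d1 d2] := dF x (sub _ (introT andP (conj h1 h2))).
    by rewrite derive1E.
have c2 : (F (b - dl n) - F (a + dl n))%:E @[n --> \oo] --> (F b - F a)%:E.
  apply: cvg_EFin; first by near=> n.
  apply: cvgB.
    move/cvg_at_leftP : Fb => /(_ (fun n => b - dl n)); apply; split.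
      by move=> n; rewrite gtrDl oppr_lt0.
    by rewrite -[X in _ --> X]subr0; apply: cvgB => //; exact: cvg_cst.
  move/cvg_at_rightP : Fa => /(_ (fun n => a + dl n)); apply; split.
    by move=> n; rewrite ltrDl.
  by rewrite -[X in _ --> X]addr0; apply: cvgD => //; exact: cvg_cst.
move: cI; rewrite (funext EI) => cI.
exact: (cvg_unique _ cI c2).
Unshelve. all: by end_near.
Qed.

End improper.

Section powers.
Context {R : realType}.
Notation leb := (@lebesgue_measure R).
Implicit Types a b c p x : R.

Lemma is_derive_powl a p x : a < x ->
  is_derive x 1 (fun y => (y - a) `^ p / p) (p^-1 * (p * (x - a) `^ (p - 1))).
Proof.
move=> ax; have xa0 : 0 < x - a by rewrite subr_gt0.
have D : is_derive (x - a) 1 (@powR R ^~ p) (p * (x - a) `^ (p - 1)).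
  exact: is_derive1_powR.
have D1 : is_derive x 1 (fun y => y - a) (1 : R).
  by have := is_deriveB (is_derive_id x 1) (is_derive_cst a x 1); rewrite subr0.
have D2 := @is_derive1_comp R (@powR R ^~ p) (fun y => y - a) x _ _ D D1.
have D3 := is_deriveZ p^-1 D2.
rewrite (_ : (fun y => (y - a) `^ p / p) = p^-1 \*: (@powR R ^~ p \o (fun y => y - a))); last first.
  by apply/funext => y /=; rewrite /GRing.scale/=; ring.
by apply: is_derive_eq D3 _; rewrite mulr1.
Qed.

Lemma is_derive_powr b p x : x < b ->
  is_derive x 1 (fun y => - ((b - y) `^ p / p)) (p^-1 * (p * (b - x) `^ (p - 1))).
Proof.
move=> ax; have xa0 : 0 < b - x by rewrite subr_gt0.
have D : is_derive (b - x) 1 (@powR R ^~ p) (p * (b - x) `^ (p - 1)).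
  exact: is_derive1_powR.
have D1 : is_derive x 1 (fun y => b - y) (- 1 : R).
  by have := is_deriveB (is_derive_cst b x 1) (is_derive_id x 1); rewrite sub0r.
have D2 := @is_derive1_comp R (@powR R ^~ p) (fun y => b - y) x _ _ D D1.
have D3 := is_deriveZ (- p^-1) D2.
rewrite (_ : (fun y => - ((b - y) `^ p / p)) = (- p^-1) \*: (@powR R ^~ p \o (fun y => b - y))); last first.
  by apply/funext => y /=; rewrite /GRing.scale/=; ring.
apply: is_derive_eq D3 _; rewrite /GRing.scale/=; ring.
Qed.

Lemma continuous_powl a p x : a < x -> {for x, continuous (fun y : R => (y - a) `^ p)}.
Proof.
move=> ax; have xa0 : 0 < x - a by rewrite subr_gt0.
have H : {for x - a, continuous (@powR R ^~ p)}.
  by apply/is_derive_continuous/is_derive1_powR.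
have E : (y - a) @[y --> x] --> x - a by apply: cvgB; [exact: cvg_id|exact: cvg_cst].
exact: (cvg_comp _ _ E H).
Qed.

Lemma continuous_powr b p x : x < b -> {for x, continuous (fun y : R => (b - y) `^ p)}.
Proof.
move=> ax; have xa0 : 0 < b - x by rewrite subr_gt0.
have H : {for b - x, continuous (@powR R ^~ p)}.
  by apply/is_derive_continuous/is_derive1_powR.
have E : (b - y) @[y --> x] --> b - x by apply: cvgB; [exact: cvg_cst|exact: cvg_id].
exact: (cvg_comp _ _ E H).
Qed.

Lemma cvg_powl_right c p : 0 <= c -> (0 < c \/ 0 < p) ->
  forall a, (x - a + c) `^ p @[x --> a^'+] --> c `^ p.
Proof.
move=> c0 cp a.
have [cgt|cle] := ltP 0 c.
  apply: cvg_at_right_filter.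
  have H : {for c, continuous (@powR R ^~ p)}.
    by apply/is_derive_continuous/is_derive1_powR.
  have E : (x - a + c) @[x --> a] --> c.
    have : (x - a + c) @[x --> a] --> a - a + c.
      apply: cvgD; last exact: cvg_cst.
      by apply: cvgB; [exact: cvg_id|exact: cvg_cst].
    by rewrite subrr add0r.
  exact: (cvg_comp _ _ E H).
have c00 : c = 0 by apply/eqP; rewrite eq_le cle c0.
have p0 : 0 < p by case: cp => //; rewrite c00 ltxx.
rewrite c00 powR0 ?gt_eqF//.
apply/cvgrPdist_lt => e e0.
have /cvgrPdist_lt/(_ _ e0) := powR_cvg0 p0.
move=> [d /= d0 H]; exists d => // x /=.
rewrite /ball/= => xad ax.
rewrite addr0.
apply: H; rewrite ?subr_gt0//=.
by rewrite sub0r normrN distrC.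
Qed.

(** The antiderivative is [(x - a)^p / p]. For [p > 0] the singular point [a] may be an end of the
    interval; negative [p] is allowed when the interval stays to the right of [a]. *)
Lemma integral_powl a c b p : a <= c -> c <= b -> 0 < p \/ (p != 0 /\ a < c) ->
  (\int[leb]_(x in `[c, b]) ((x - a) `^ (p - 1))%:E =
   (((b - a) `^ p - (c - a) `^ p) / p)%:E)%E.
Proof.
move=> ac; rewrite le_eqVlt => /predU1P[->|cb] p0.
  by rewrite set_itv1 integral_set1 subrr mul0r.
have pn0 : p != 0 by case: p0 => [/gt_eqF ->|[]].
rewrite mulrBl; apply: (@ge0_improper_FTC2 R (fun y => (y - a) `^ p / p)) => //.
- move=> x /andP[cx xb]; apply: is_derive_eq; first exact: is_derive_powl (le_lt_trans ac cx).
  by rewrite mulrA mulVf// mul1r.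
- move=> x /andP[cx xb].
  exact/continuous_powl/(le_lt_trans ac cx).
- by move=> x _; exact: powR_ge0.
- apply: cvgMr_tmp.
  have := @cvg_powl_right (c - a) p _ _ c; rewrite subr_ge0 subr_gt0 => /(_ ac).
  have H : a < c \/ 0 < p by case: p0 => [|[]]; auto.
  move=> /(_ H).
  by under eq_fun do rewrite addrA subrK.
- apply: cvg_at_left_filter; exact: (is_derive_continuous (is_derive_powl p (le_lt_trans ac cb))).
Qed.

Lemma cvg_powr_left b c p : 0 <= c -> (0 < c \/ 0 < p) ->
  (b - x + c) `^ p @[x --> b^'-] --> c `^ p.
Proof.
move=> c0 cp.
have [cgt|cle] := ltP 0 c.
  have /(@cvg_at_left_filter _ _ _) : {for b, continuous (fun y : R => (b + c - y) `^ p)}.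
    by apply: continuous_powr; rewrite ltrDl.
  rewrite (_ : b + c - b = c); last by ring.
  by under eq_fun do rewrite addrAC.
have c00 : c = 0 by apply/eqP; rewrite eq_le cle c0.
have p0 : 0 < p by case: cp => //; rewrite c00 ltxx.
rewrite c00 powR0 ?gt_eqF//.
apply/cvgrPdist_lt => e e0.
have /cvgrPdist_lt/(_ _ e0) := powR_cvg0 p0.
move=> [d /= d0 H]; exists d => // x /=.
rewrite /ball/= => xad ax.
rewrite addr0.
apply: H; rewrite ?subr_gt0//=.
by rewrite sub0r normrN.
Qed.

Lemma integral_powr a c b p : a <= c -> c <= b -> 0 < p \/ (p != 0 /\ c < b) ->
  (\int[leb]_(x in `[a, c]) ((b - x) `^ (p - 1))%:E =
   (((b - a) `^ p - (b - c) `^ p) / p)%:E)%E.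
Proof.
rewrite le_eqVlt => /predU1P[->|ac] cb p0.
  by rewrite set_itv1 integral_set1 subrr mul0r.
have pn0 : p != 0 by case: p0 => [/gt_eqF ->|[]].
have -> : ((b - a) `^ p - (b - c) `^ p) / p = - ((b - c) `^ p / p) - (- ((b - a) `^ p / p)).
  by ring.
apply: (@ge0_improper_FTC2 R (fun y => - ((b - y) `^ p / p))) => //.
- move=> x /andP[cx xb]; apply: is_derive_eq; first exact: is_derive_powr (lt_le_trans xb cb).
  by rewrite mulrA mulVf// mul1r.
- move=> x /andP[cx xb].
  exact/continuous_powr/(lt_le_trans xb cb).
- by move=> x _; exact: powR_ge0.
- apply: cvg_at_right_filter; exact: (is_derive_continuous (is_derive_powr p (lt_le_trans ac cb))).
- apply: (@cvgN _ R^o); apply: cvgMr_tmp.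
  have : (c - x + (b - c)) `^ p @[x --> c^'-] --> (b - c) `^ p.
    apply: cvg_powr_left; first by rewrite subr_ge0.
    by case: p0 => [p0|[_ cb']]; [right|left; rewrite subr_gt0].
  by under eq_fun do rewrite addrC addrA subrK.
Qed.

End powers.

Section affine.
Context {R : realType}.
Notation leb := (@lebesgue_measure R).

(** By uniqueness of Lebesgue measure, it equals [c] times its image under [x |-> c x + d]. *)
Lemma ge0_integral_affine (c d : R) (f : R -> \bar R) (D : set R) : 0 < c ->
  measurable D -> measurable_fun setT f -> (forall x, (0 <= f x)%E) ->
  (\int[leb]_(y in D) f y =
   c%:E * \int[leb]_(x in (fun x => c * x + d)%R @^-1` D) f (c * x + d)%R)%E.
Proof.
move=> c0 mD mf f0.
pose phi : R -> measurableTypeR R := fun x => c * x + d.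
have mphi : measurable_fun [set: measurableTypeR R] phi.
  apply: measurable_funD => //; apply: measurable_funM => //.
pose c' : {nonneg R} := NngNum (ltW c0).
have E A : measurable A -> leb A = mscale c' (pushforward leb phi) A.
  apply: lebesgue_measure_unique => //= _ [[a b]] _ <-.
  rewrite /mscale/= /pushforward/=.
  have -> : phi @^-1` `]a, b] = `](a - d) / c, (b - d) / c]%classic.
    apply/seteqP; split=> x /=; rewrite !in_itv/= /phi => /andP[h1 h2]; apply/andP; split.
    - by rewrite ltr_pdivrMr// ltrBlDr mulrC.
    - by rewrite ler_pdivlMr// lerBrDr mulrC.
    - by move: h1; rewrite ltr_pdivrMr// ltrBlDr mulrC.
    - by move: h2; rewrite ler_pdivlMr// lerBrDr mulrC.
  rewrite !lebesgue_measure_itv/= !lte_fin ltr_pM2r ?invr_gt0// ltrD2r.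
  case: ifPn => ab; last by rewrite mule0.
  by rewrite -EFinD -EFinM; congr EFin; field; rewrite gt_eqF.
have -> : (\int[leb]_(x in phi @^-1` D) f (c * x + d)%R = \int[leb]_(x in phi @^-1` D) (f \o phi) x)%E by [].
rewrite -(ge0_integral_pushforward mphi)//; last exact: measurable_funS mf.
rewrite -[c%:E]/(c'%:num%:E) -ge0_integral_mscale//=; last exact: measurable_funS mf.
by apply: eq_measure_integral => A mA _; exact: E.
Qed.

End affine.

(** * Beta and Gamma integrals: the normalising constant *)

Section beta_gamma.
Context {R : realType}.
Notation leb := (@lebesgue_measure R).

Lemma tonelli_triangle (D : set R) (f : R * R -> \bar R) :
  measurable D -> measurable_fun setT f -> (forall z, (0 <= f z)%E) ->
  (\int[leb]_(x in D) \int[leb]_(u in D `&` `[x, +oo[) f (x, u) =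
   \int[leb]_(u in D) \int[leb]_(x in D `&` `]-oo, u]) f (x, u))%E.
Proof.
move=> mD mf f0.
pose E : set (R * R) := (D `*` D) `&` [set z | z.1 <= z.2].
have mE : measurable E.
  apply: (@measurable_fun_le _ _ R _ fst snd); first exact: measurableX.
    exact: measurable_funTS measurable_fst.
  exact: measurable_funTS measurable_snd.
have mg : measurable_fun setT (f \_ E).
  by apply/(measurable_restrictT _ mE); exact: measurable_funTS.
have g0 z : (0 <= (f \_ E) z)%E by rewrite patchE; case: ifP.
transitivity (\int[leb]_x \int[leb]_y (f \_ E) (x, y))%E.
  rewrite integral_mkcond; apply: eq_integral => x _.
  rewrite patchE; case: ifPn => xD; last first.
    rewrite integral0_eq// => y _; rewrite patchE ifF//.
    apply/negbTE; apply: contra xD; rewrite !inE => -[[]//].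
  rewrite integral_mkcond; apply: eq_integral => y _.
  rewrite !patchE; congr (if _ then _ else _).
  by move: xD; rewrite inE => xD; apply/idP/idP; rewrite !inE /E/= in_itv/= andbT; tauto.
apply: (etrans (@fubini_tonelli _ _ _ _ _ leb leb _ mg g0)).
rewrite [RHS]integral_mkcond; apply: eq_integral => x _.
rewrite patchE; case: ifPn => xD; last first.
  rewrite integral0_eq// => y _; rewrite patchE ifF//.
  apply/negbTE; apply: contra xD; rewrite !inE => -[[]//].
rewrite [RHS]integral_mkcond; apply: eq_integral => y _.
rewrite !patchE; congr (if _ then _ else _).
by move: xD; rewrite inE => xD; apply/idP/idP; rewrite !inE /E/= in_itv/=; tauto.
Qed.

(** Euler's Beta integral at [(1 - al, al)], kept extended real so that Tonelli applies before
    finiteness is known. *)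
Definition beta_kernel (al : R) : \bar R :=
  (\int[leb]_(y in `[0%R, 1%R]) (y `^ (- al) * (1 - y) `^ (al - 1))%:E)%E.

Variable al : R.
Hypothesis al01 : 0 < al < 1.
Let al0 : 0 < al. Proof. by case/andP: al01. Qed.
Let al1 : al < 1. Proof. by case/andP: al01. Qed.

Let measurable_kernel a u :
  measurable_fun setT (fun x : R => (x - a) `^ (- al) * (u - x) `^ (al - 1)).
Proof.
by apply: measurable_funM; apply: (measurableT_comp (measurable_powR _)); exact: measurable_funB.
Qed.

(** Under [x = a + (u - a) y] the exponents of [u - a] add up to -1 and cancel the Jacobian, so the
    value depends on neither endpoint. *)
Lemma beta_kernel_scale a u : a < u ->
  (\int[leb]_(x in `[a, u]) ((x - a) `^ (- al) * (u - x) `^ (al - 1))%:E = beta_kernel al)%E.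
Proof.
move=> au; have ua : 0 < u - a by rewrite subr_gt0.
rewrite (ge0_integral_affine a ua)//; last 2 first.
- by apply/measurable_EFinP; exact: measurable_kernel.
- by move=> x; rewrite lee_fin mulr_ge0 ?powR_ge0.
have -> : (fun x => (u - a) * x + a) @^-1` `[a, u] = `[0, 1]%classic.
  apply/seteqP; split=> x /=; rewrite !in_itv/= => /andP[h1 h2]; apply/andP; split.
  - by move: h1; rewrite lerDr pmulr_rge0.
  - by rewrite -(ler_pM2l ua) mulr1; lra.
  - by rewrite lerDr pmulr_rge0.
  - by have := h2; rewrite -(ler_pM2l ua) mulr1; lra.
rewrite -ge0_integralZl_EFin//; last 3 first.
- by move=> x _; rewrite lee_fin mulr_ge0 ?powR_ge0.
- apply/measurable_EFinP; apply: (measurableT_comp (measurable_kernel a u)).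
  by apply: measurable_funD => //; exact: measurable_funM.
- exact: ltW.
apply: eq_integral => x; rewrite inE/= in_itv/= => /andP[x0 x1].
rewrite -EFinM; congr EFin.
have -> : (u - a) * x + a - a = (u - a) * x by ring.
have -> : u - ((u - a) * x + a) = (u - a) * (1 - x) by ring.
rewrite powRM ?(ltW ua)// powRM ?(ltW ua) ?subr_ge0//.
transitivity (((u - a) * ((u - a) `^ (- al) * (u - a) `^ (al - 1))) * (x `^ (- al) * (1 - x) `^ (al - 1))); first by ring.
rewrite -powRD; last by rewrite (gt_eqF ua) implybT.
have -> : - al + (al - 1) = -1 by ring.
by rewrite powR_inv1 ?(ltW ua)// divff ?mul1r// gt_eqF.
Qed.

Lemma powR_ge1 (x p : R) : 0 < x <= 1 -> p <= 0 -> 1 <= x `^ p.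
Proof. by move=> x01 p0; rewrite -[leLHS](powRr0 x); exact: (ger_powR x01). Qed.

Lemma powR_le1 (x p : R) : 0 <= x <= 1 -> 0 <= p -> x `^ p <= 1.
Proof.
move=> /andP[]; rewrite le_eqVlt => /predU1P[<- _|x0 x1] p0.
  by have [->|/powR0 ->//] := eqVneq p 0; rewrite powRr0.
by rewrite -[leRHS](powRr0 x); apply: ger_powR => //; rewrite x0.
Qed.

Lemma beta_kernel_ge1 : (1 <= beta_kernel al)%E.
Proof.
have -> : (1 = \int[leb]_(y in `[0%R, 1%R]) 1%:E)%E.
  by rewrite integral_cst//= lebesgue_measure_itv/= lte_fin ltr01 oppr0 adde0 mule1.
have mk := measurable_kernel 0 1.
rewrite /beta_kernel; under [X in (_ <= X)%E]eq_integral do rewrite -[X in X `^ (- al)]subr0.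
rewrite [X in (X <= _)%E]integral_itv_bndoo; [rewrite [X in (_ <= X)%E]integral_itv_bndoo|]; last 2 first.
- by apply/measurable_EFinP/measurable_funTS.
- exact: measurable_cst.
apply: ge0_le_integral => //=.
- by apply/measurable_EFinP/measurable_funTS.
- move=> x; rewrite in_itv/= => /andP[x0 x1]; rewrite lee_fin.
  rewrite -[leLHS]mulr1; apply: ler_pM => //.
    by rewrite subr0 powR_ge1 ?oppr_le0 ?(ltW al0)// x0 ltW.
  by rewrite powR_ge1 ?subr_gt0 ?x1 ?gerBl ?(ltW x0) ?subr_le0 ?(ltW al1).
Qed.

(** On each half of [[0, 1]] one of the two factors is at most 2, hence the integrable majorant
    [2 y^(-al) + 2 (1 - y)^(al - 1)]. *)
Lemma beta_kernel_lty : (beta_kernel al < +oo)%E.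
Proof.
have mk := measurable_kernel 0 1.
have mP (q : R) : measurable_fun setT (fun x : R => (x - 0) `^ q).
  by apply: (measurableT_comp (measurable_powR _)); exact: measurable_funB.
have mQ (q : R) : measurable_fun setT (fun x : R => (1 - x) `^ q).
  by apply: (measurableT_comp (measurable_powR _)); exact: measurable_funB.
have mP2 q := measurable_funM (@measurable_cst _ _ _ _ setT (2 : R)) (mP q).
have mQ2 q := measurable_funM (@measurable_cst _ _ _ _ setT (2 : R)) (mQ q).
rewrite /beta_kernel.
under eq_integral do rewrite -[X in X `^ (- al)]subr0.
have h2 : (1 <= 2 :> R) by rewrite ler1n.
apply: (@le_lt_trans _ _ (\int[leb]_(y in `[0%R, 1%R]) ((2 * (y - 0) `^ (1 - al - 1))%:E + (2 * (1 - y) `^ (al - 1))%:E))%E).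
  rewrite [X in (X <= _)%E]integral_itv_bndoo; [rewrite [X in (_ <= X)%E]integral_itv_bndoo|]; last 2 first.
  - by apply: emeasurable_funD; apply/measurable_EFinP/measurable_funTS; [exact: mP2|exact: mQ2].
  - by apply/measurable_EFinP/measurable_funTS.
  apply: ge0_le_integral => //=.
  - by move=> x _; rewrite lee_fin mulr_ge0 ?powR_ge0.
  - by apply/measurable_EFinP/measurable_funTS.
  - by apply: emeasurable_funD; apply/measurable_EFinP/measurable_funTS; [exact: mP2|exact: mQ2].
  - move=> x; rewrite in_itv/= => /andP[x0 x1]; rewrite -EFinD lee_fin subr0.
    have -> : 1 - al - 1 = - al by ring.
    have P0 := powR_ge0 x (- al); have Q0 := powR_ge0 (1 - x) (al - 1).
    have B (y q : R) : 2^-1 <= y -> y <= 1 -> -1 <= q -> y `^ q <= 2.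
      move=> y0 y1 q1; have yp : 0 < y by rewrite (lt_le_trans _ y0)// invr_gt0.
      apply: (@le_trans _ _ (y `^ (-1))); first by apply: ger_powR => //; rewrite yp.
      by rewrite powR_inv1 ?(ltW yp)// -[leRHS]invrK lef_pV2// posrE invr_gt0.
    have [xh|xh] := lerP 2^-1 x.
      have := B x (- al) xh (ltW x1); rewrite lerN2 (ltW al1) => /(_ isT) b.
      apply: (@le_trans _ _ (2 * (1 - x) `^ (al - 1))); first exact: ler_wpM2r.
      by rewrite lerDr mulr_ge0.
    have := B (1 - x) (al - 1); have -> : 2^-1 <= 1 - x by lra.
    have -> : 1 - x <= 1 by lra.
    have -> : - 1 <= al - 1 by move: al0; lra.
    move=> /(_ isT isT isT) b.
    apply: (@le_trans _ _ (2 * x `^ (- al))); first by rewrite mulrC ler_wpM2r.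
    by rewrite lerDl mulr_ge0.
have p1 : 0 < 1 - al by rewrite subr_gt0.
rewrite ge0_integralD//; last 4 first.
- by move=> x _; rewrite lee_fin mulr_ge0 ?powR_ge0.
- by apply/measurable_EFinP/measurable_funTS; exact: mP2.
- by move=> x _; rewrite lee_fin mulr_ge0 ?powR_ge0.
- by apply/measurable_EFinP/measurable_funTS; exact: mQ2.
under eq_integral do rewrite EFinM.
under [X in (_ + X)%E]eq_integral do rewrite EFinM.
rewrite !ge0_integralZl_EFin//; last 4 first.
- by move=> x _; rewrite lee_fin powR_ge0.
- by apply/measurable_EFinP/measurable_funTS; exact: mQ.
- by move=> x _; rewrite lee_fin powR_ge0.
- by apply/measurable_EFinP/measurable_funTS; exact: mP.
rewrite integral_powl ?lexx ?ler01//; last by left.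
rewrite integral_powr ?lexx ?ler01//; last by left.
by rewrite -!EFinM -EFinD ltry.
Qed.

Lemma beta_kernelE : (beta_kernel al = (fine (beta_kernel al))%:E)%E.
Proof.
rewrite fineK// ge0_fin_numE ?beta_kernel_lty//.
by rewrite (le_trans _ beta_kernel_ge1).
Qed.

(** Abel's inversion: [(x - a)^(-al) (u - x)^(al - 1)] is integrated over the triangle
    [a <= x <= u <= q] in both orders. The inner [u]-integral produces the left side, the inner
    [x]-integral the constant of [beta_kernel_scale]. *)
Lemma integral_powl_powr a q : a <= q ->
  (\int[leb]_(x in `[a, q]) ((x - a) `^ (- al) * ((q - x) `^ al / al))%:E =
   (fine (beta_kernel al) * (q - a))%:E)%E.
Proof.
rewrite le_eqVlt => /predU1P[->|aq].
  by rewrite set_itv1 integral_set1 subrr mulr0.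
pose f (z : R * R) : \bar R := ((z.1 - a) `^ (- al) * (z.2 - z.1) `^ (al - 1))%:E.
have mf : measurable_fun setT f.
  apply/measurable_EFinP; apply: measurable_funM.
    by apply: (measurableT_comp (measurable_powR _)); exact: measurable_funB.
  by apply: (measurableT_comp (measurable_powR _)); exact: measurable_funB.
have f0 z : (0 <= f z)%E by rewrite lee_fin mulr_ge0 ?powR_ge0.
have := @tonelli_triangle `[a, q] f (measurable_itv _) mf f0.
have -> : (\int[leb]_(u in `[a, q]) \int[leb]_(x in `[a, q] `&` `]-oo, u]) f (x, u) =
   (fine (beta_kernel al) * (q - a))%:E)%E.
  transitivity (\int[leb]_(u in `[a, q]) (cst (fine (beta_kernel al))%:E u))%E; last first.
    by rewrite integral_cst//= lebesgue_measure_itv/= lte_fin aq -EFinD -EFinM.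
  (* At [u = a] the inner integral runs over a single point; that endpoint is dropped, being
     negligible. *)
  have E u : u \in `]a, q]%classic -> cst (fine (beta_kernel al))%:E u =
      (\int[leb]_(x in `[a, q] `&` `]-oo, u]) f (x, u))%E.
    rewrite inE/= in_itv/= => /andP[au uq].
    rewrite /cst -beta_kernelE -(beta_kernel_scale au) /f/=.
    congr (integral _ _ _); apply/seteqP; split => x /=; rewrite !in_itv/=.
      by move=> /andP[ax xu]; rewrite ax xu (le_trans xu uq).
    by move=> [/andP[-> _] ->].
  have mc := @measurable_cst _ _ R (\bar R) `]a, q] (fine (beta_kernel al))%:E.
  rewrite -!(integral_itv_obnd_cbnd)//; last exact: eq_measurable_fun E mc.
  by apply: eq_integral => u ?; rewrite -E.
move=> <-; apply: eq_integral => x; rewrite inE/= in_itv/= => /andP[ax xq].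
have -> : `[a, q] `&` `[x, +oo[ = `[x, q]%classic.
  apply/seteqP; split => y /=; rewrite !in_itv/= andbT.
    by move=> [/andP[_ ->] ->].
  by move=> /andP[xy yq]; rewrite xy yq (le_trans ax xy).
rewrite /f/=; under [RHS]eq_integral do rewrite EFinM.
rewrite ge0_integralZl_EFin ?powR_ge0//; last 2 first.
- by move=> y _; rewrite lee_fin powR_ge0.
- apply/measurable_EFinP/measurable_funTS.
  by apply: (measurableT_comp (measurable_powR _)); exact: measurable_funB.
rewrite integral_powl ?lexx//; last by left.
by rewrite subrr powR0 ?gt_eqF// subr0 -EFinM.
Qed.
End beta_gamma.

(** A finite product of value at least 1 has finite factors, which settles the convergence of both
    Gamma integrals at once. *)
Lemma fine_mul_lty (R : realType) (x y : \bar R) : (0 <= x)%E -> (0 <= y)%E ->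
  (1 <= x * y < +oo)%E -> fine (x * y) = fine x * fine y.
Proof.
case: x => [x||]; case: y => [y||]//= x0 y0.
- move: x0; rewrite lee_fin le_eqVlt => /predU1P[<-|xp].
    by rewrite mul0e lee_fin ler10.
  by rewrite gt0_muley ?lte_fin// ltxx andbF.
- move: y0; rewrite lee_fin le_eqVlt => /predU1P[<-|xp].
    by rewrite mule0 lee_fin ler10.
  by rewrite gt0_mulye ?lte_fin// ltxx andbF.
- by rewrite mulyy ltxx andbF.
Qed.

Section gamma_reflection.
Context {R : realType}.
Notation leb := (@lebesgue_measure R).
Variable al : R.
Hypothesis al01 : 0 < al < 1.
Let al0 : 0 < al. Proof. by case/andP: al01. Qed.
Let al1 : al < 1. Proof. by case/andP: al01. Qed.

Let GE (a : R) : \bar R := (\int[leb]_(x in `[0%R, +oo[) (x `^ (a - 1) * expR (- x))%:E)%E.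

Let mexp : measurable_fun setT (fun x : R => expR (- x)).
Proof.
apply: continuous_measurable_fun => x; apply: continuous_comp; last exact: continuous_expR.
exact: opp_continuous.
Qed.

Let mG (a : R) : measurable_fun setT (fun x : R => x `^ (a - 1) * expR (- x)).
Proof.
apply: measurable_funM; first exact: measurable_powR.
exact: mexp.
Qed.

Let GE_ge0 a : (0 <= GE a)%E.
Proof. by apply: integral_ge0 => x _; rewrite lee_fin mulr_ge0 ?powR_ge0 ?expR_ge0. Qed.

Let integral_expN : (\int[leb]_(x in `[0%R, +oo[) (expR (- x))%:E = 1)%E.
Proof.
have D (x : R) : is_derive x 1 (fun y : R => - expR (- y)) (expR (- x)).
  have D1 : is_derive x 1 (fun y : R => - y) (-1 : R) by apply: is_deriveN.
  have D2 := @is_derive1_comp R expR (fun y => - y) x _ _ (is_derive_expR (- x)) D1.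
  by apply: is_derive_eq (is_deriveN D2) _; ring.
rewrite (@ge0_continuous_FTC2y _ _ (fun x => - expR (- x)) _ 0).
- by rewrite oppr0 expR0 EFinN oppeK add0e.
- by move=> x _; exact: expR_ge0.
- apply: continuous_subspaceT => x.
  have D1 : is_derive x 1 (fun y : R => - y) (-1 : R) by apply: is_deriveN.
  exact: is_derive_continuous (@is_derive1_comp R expR (fun y => - y) x _ _ (is_derive_expR (- x)) D1).
- rewrite -oppr0; apply: (@cvgN _ R^o); exact: cvgr_expR.
- by move=> x _; case: (D x).
- by apply: cvg_at_right_filter; exact: is_derive_continuous (D 0).
- by move=> x _; case: (D x) => _ H; rewrite derive1E.
Qed.

(** The function [x^(-al) (u - x)^(al - 1) exp(-u)] is integrated over [0 <= x <= u]. Integrating in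
    [u] first, shifted by [x], splits it into two Gamma integrals; integrating in [x] first leaves
    the Beta constant times the integral of [exp(-u)]. *)
Lemma beta_gamma_ereal : (GE (1 - al) * GE al = beta_kernel al)%E.
Proof.
pose f (z : R * R) : \bar R := (z.1 `^ (- al) * (z.2 - z.1) `^ (al - 1) * expR (- z.2))%:E.
have mf : measurable_fun setT f.
  apply/measurable_EFinP; apply: measurable_funM.
    apply: measurable_funM; first by apply: (measurableT_comp (measurable_powR _)).
    by apply: (measurableT_comp (measurable_powR _)); exact: measurable_funB.
  exact: (measurableT_comp mexp measurable_snd).
have f0 z : (0 <= f z)%E by rewrite lee_fin !mulr_ge0 ?powR_ge0 ?expR_ge0.
have := @tonelli_triangle R `[0, +oo[ f (measurable_itv _) mf f0.
have -> : (\int[leb]_(u in `[0%R, +oo[) \int[leb]_(x in `[0%R, +oo[ `&` `]-oo, u]) f (x, u) =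
  beta_kernel al)%E.
  have E u : u \in `]0, +oo[%classic -> ((fine (beta_kernel al) * expR (- u))%:E =
      \int[leb]_(x in `[0%R, +oo[ `&` `]-oo, u]) f (x, u))%E.
    rewrite inE/= in_itv/= andbT => u0.
    rewrite mulrC EFinM -(beta_kernelE al01) -(beta_kernel_scale al u0)//.
    rewrite -ge0_integralZl_EFin ?expR_ge0//; last 2 first.
    - by move=> x _; rewrite lee_fin mulr_ge0 ?powR_ge0.
    - apply/measurable_EFinP/measurable_funTS/measurable_funM.
        by apply: (measurableT_comp (measurable_powR _)); exact: measurable_funB.
      by apply: (measurableT_comp (measurable_powR _)); exact: measurable_funB.
    have -> : `[0, +oo[ `&` `]-oo, u] = `[0, u]%classic.
      by apply/seteqP; split => x /=; rewrite !in_itv/= andbT; [move=> [-> ->]|move=> /andP[-> ->]].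
    by apply: eq_integral => x _; rewrite /f/= subr0 -EFinM mulrC.
  have mc : measurable_fun (`]0, +oo[%classic : set R) (fun u : R => (fine (beta_kernel al) * expR (- u))%:E).
    by apply/measurable_EFinP/measurable_funTS/measurable_funM.
  rewrite -integral_itv_obnd_cbnd; last exact: eq_measurable_fun E mc.
  under eq_integral do rewrite -E//.
  rewrite integral_itv_obnd_cbnd//.
  under eq_integral do rewrite EFinM.
  rewrite ge0_integralZl_EFin//; last 2 first.
  - by apply/measurable_EFinP/measurable_funTS.
  - by apply: fine_ge0; apply: (le_trans _ (beta_kernel_ge1 al01)).
  by rewrite integral_expN mule1 -beta_kernelE.
move=> <-.
transitivity (\int[leb]_(y in `[0%R, +oo[) ((y `^ (1 - al - 1) * expR (- y))%:E * GE al))%E.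
  rewrite ge0_integralZr//.
  - by apply/measurable_EFinP/measurable_funTS; exact: mG.
  - by move=> x _; rewrite lee_fin mulr_ge0 ?powR_ge0 ?expR_ge0.
apply: eq_integral => y; rewrite inE/= in_itv/= andbT => y0.
have -> : `[0, +oo[ `&` `[y, +oo[ = `[y, +oo[%classic.
  by apply/seteqP; split => x /=; rewrite !in_itv/= !andbT; [move=> [_ ->]|move=> yx; rewrite yx (le_trans y0)].
have -> : 1 - al - 1 = - al by ring.
rewrite (ge0_integral_affine y ltr01)//; last first.
  by apply: (measurableT_comp mf); exact: measurable_pair1.
rewrite mul1e.
have -> : (fun x => 1 * x + y) @^-1` `[y, +oo[ = `[0, +oo[%classic.
  by apply/seteqP; split => x /=; rewrite !in_itv/= !andbT mul1r lerDr.
rewrite /GE -ge0_integralZl_EFin; last 4 first.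
- exact: measurable_itv.
- by move=> x _; rewrite lee_fin mulr_ge0 ?powR_ge0 ?expR_ge0.
- by apply/measurable_EFinP/measurable_funTS; exact: mG.
- by rewrite mulr_ge0 ?powR_ge0 ?expR_ge0.
apply: eq_integral => x _; rewrite -EFinM /f/=; congr EFin.
have -> : 1 * x + y - y = x by ring.
by rewrite mul1r opprD expRD; ring.
Qed.

(** Turns the normalising factor of [gLS_integral] into the constant that Abel's inversion
    produces. *)
Lemma Gamma_reflection : Gamma (1 - al) * Gamma al = fine (beta_kernel al).
Proof.
have GEE a : Gamma a = fine (GE a).
  rewrite /Gamma /Rintegral /GE integral_itv_obnd_cbnd//.
  by apply/measurable_EFinP/measurable_funTS; exact: mG.
have b1 := beta_kernel_ge1 al01; have bl := beta_kernel_lty al01.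
rewrite !GEE -(fine_mul_lty (GE_ge0 _) (GE_ge0 _)) beta_gamma_ereal//.
by rewrite b1 bl.
Qed.
End gamma_reflection.

(** * Real-valued integrals: bounds and parametric measurability *)

Section Rintegral_helpers.
Context {R : realType}.
Local Open Scope ereal_scope.
Context d (T : measurableType d) (mu : {measure set T -> \bar R}).
Implicit Types (D : set T) (f g : T -> R).

Lemma integral_EFin_Rintegral D f (r : R) : \int[mu]_(x in D) (f x)%:E = r%:E ->
  (\int[mu]_(x in D) f x)%R = r.
Proof. by rewrite /Rintegral => ->. Qed.

Lemma ge0_integrable_EFin D f (r : R) : measurable D -> measurable_fun D f ->
  (forall x, D x -> (0 <= f x)%R) -> \int[mu]_(x in D) (f x)%:E = r%:E ->
  mu.-integrable D (EFin \o f).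
Proof.
move=> mD mf f0 E; apply/integrableP; split; first exact/measurable_EFinP.
rewrite (eq_integral (fun x => (f x)%:E)) ?E ?ltry// => x; rewrite inE => /f0 h.
by rewrite /= ger0_norm.
Qed.

Lemma integrable_EFin_le D f g : measurable D -> measurable_fun D f ->
  (forall x, D x -> (`|f x| <= g x)%R) -> mu.-integrable D (EFin \o g) ->
  mu.-integrable D (EFin \o f).
Proof.
move=> mD mf fg; apply: le_integrable => //; first exact/measurable_EFinP.
by move=> x Dx /=; rewrite lee_fin (le_trans (fg _ Dx))// ler_norm.
Qed.

Lemma normr_Rintegral_le D f g : measurable D -> measurable_fun D f ->
  (forall x, D x -> (`|f x| <= g x)%R) -> mu.-integrable D (EFin \o g) ->
  (`| \int[mu]_(x in D) f x | <= \int[mu]_(x in D) g x)%R.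
Proof.
move=> mD mf fg ig; have jf := integrable_EFin_le mD mf fg ig.
apply: le_trans (le_normr_Rintegral mD jf) _.
apply: le_Rintegral => //; exact: integrable_norm.
Qed.

End Rintegral_helpers.

(** No integrability is assumed: positive and negative parts are measurable by Tonelli, and [fine]
    preserves measurability. *)
Lemma measurable_section_integral d1 d2 (T1 : measurableType d1) (T2 : measurableType d2)
    (R : realType) (m2 : {sigma_finite_measure set T2 -> \bar R}) (f : T1 * T2 -> R) :
  measurable_fun setT f -> measurable_fun setT (fun x => \int[m2]_y f (x, y)).
Proof.
move=> mf; apply: (measurableT_comp (fine_measurable measurableT)).
have mfE : measurable_fun setT (EFin \o f) by exact/measurable_EFinP.
have E x : (\int[m2]_y (f (x, y))%:E = fubini_F m2 ((EFin \o f)^\+) x - fubini_F m2 ((EFin \o f)^\-) x)%E.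
  by rewrite integralE /fubini_F; congr (_ - _)%E; apply: eq_integral => y _; rewrite ?funeposE ?funenegE.
under eq_fun do rewrite E.
apply: emeasurable_funB.
  by apply: measurable_fun_fubini_tonelli_F => //; exact: measurable_funepos.
by apply: measurable_fun_fubini_tonelli_F => //; exact: measurable_funeneg.
Qed.

(** * The right-sided fractional derivative of a Holder function *)

Section marchaud.
Context {R : realType}.
Notation leb := (@lebesgue_measure R).
Variables al b : R.

(** Up to sign and a Gamma factor, the right-sided Weyl-Marchaud derivative of order [1 - al] of
    [g - g t]: the factor of [gLS_integral] that carries the integrator. *)
Definition fderiv (g : R -> R) (t x : R) : R :=
  (g t - g x) / (t - x) `^ (1 - al) +
  (1 - al) * \int[leb]_(u in `[x, t]) ((g u - g x) / (u - x) `^ (2 - al)).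

(** Measurability is asked on the whole line because parametric integrals are treated on [setT]; the
    Holder bound concerns [[0, 1]] only. *)
Definition holder01 (C : R) (g : R -> R) : Prop :=
  measurable_fun setT g /\
  forall x y, 0 <= x <= 1 -> 0 <= y <= 1 -> `|g x - g y| <= C * `|x - y| `^ b.

Hypothesis al01 : 0 < al < 1.
Hypothesis alb : 1 - al < b.
Let al0 : 0 < al. Proof. by case/andP: al01. Qed.
Let al1 : al < 1. Proof. by case/andP: al01. Qed.
Let e := b - (1 - al).
Let e0 : 0 < e. Proof. by rewrite subr_gt0. Qed.

Lemma holder01_ge0 C g : holder01 C g -> 0 <= C.
Proof.
move=> [_ /(_ 0 1)]; rewrite sub0r normrN normr1 powR1 mulr1 !lexx !ler01 => H.
by apply: le_trans (H isT isT).
Qed.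

Lemma measurable_kernelD (g : R -> R) : measurable_fun setT g ->
  measurable_fun setT (fun z : R * R => (g z.2 - g z.1) / (z.2 - z.1) `^ (2 - al)).
Proof.
move=> mg; apply: measurable_funM.
  by apply: measurable_funB; exact: measurableT_comp.
under eq_fun do rewrite -powRN.
by apply: (measurableT_comp (measurable_powR _)); exact: measurable_funB.
Qed.

Lemma measurable_kernelD_section (g : R -> R) x : measurable_fun setT g ->
  measurable_fun setT (fun u => (g u - g x) / (u - x) `^ (2 - al)).
Proof.
move=> mg; apply: measurable_funM; first exact: measurable_funB.
under eq_fun do rewrite -powRN.
by apply: (measurableT_comp (measurable_powR _)); exact: measurable_funB.
Qed.

(** With [e = b - (1 - al) > 0], the Holder bound turns the singularity of order [2 - al] into the
    integrable power [e - 1]. *)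
Lemma kernelD_le C g x t u : holder01 C g -> 0 <= x -> t <= 1 -> x <= u <= t ->
  `|(g u - g x) / (u - x) `^ (2 - al)| <= C * (u - x) `^ (e - 1).
Proof.
move=> [mg hg] x0 t1 /andP[xu ut].
have := xu; rewrite le_eqVlt => /predU1P[->|xu'].
  by rewrite subrr mul0r normr0 mulr_ge0 ?powR_ge0// (@holder01_ge0 C g).
have p0 : 0 < u - x by rewrite subr_gt0.
rewrite normrM [X in _ * X]ger0_norm ?invr_ge0 ?powR_ge0//.
rewrite ler_pdivrMr ?powR_gt0// -mulrA -powRD ?(gt_eqF p0) ?implybT//.
have -> : e - 1 + (2 - al) = b by rewrite /e; ring.
have := hg u x; rewrite (ger0_norm (ltW p0)); apply.
  by rewrite (le_trans x0 xu) (le_trans ut t1).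
by rewrite x0 (le_trans xu (le_trans ut t1)).
Qed.

Lemma integral_pow_e x t : x <= t ->
  (\int[leb]_(u in `[x, t]) ((u - x) `^ (e - 1))%:E = ((t - x) `^ e / e)%:E)%E.
Proof.
by move=> xt; rewrite integral_powl ?lexx ?subrr ?powR0 ?gt_eqF ?subr0//; left.
Qed.

Let mpow (p x : R) : measurable_fun setT (fun u : R => (u - x) `^ p).
Proof. by apply: (measurableT_comp (measurable_powR _)); exact: measurable_funB. Qed.

Lemma integrable_pow_e1 x t : x <= t ->
  leb.-integrable `[x, t] (EFin \o (fun u => (u - x) `^ (e - 1))).
Proof.
move=> xt; have := ge0_integrable_EFin _ _ _ (integral_pow_e xt).
by move=> /(_ (measurable_itv _) (measurable_funTS (mpow _ _)) (fun u _ => powR_ge0 _ _)).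
Qed.

Lemma integrable_pow_e x t C : x <= t ->
  leb.-integrable `[x, t] (EFin \o (fun u => C * (u - x) `^ (e - 1))).
Proof.
by move=> xt; exact: (@integrableZl _ _ R leb _ (measurable_itv _) C _ (integrable_pow_e1 xt)).
Qed.

Lemma integrable_kernelD C g x t : holder01 C g -> 0 <= x -> x <= t -> t <= 1 ->
  leb.-integrable `[x, t] (EFin \o (fun u => (g u - g x) / (u - x) `^ (2 - al))).
Proof.
move=> hg x0 xt t1; apply: integrable_EFin_le (integrable_pow_e C xt) => //.
  by apply: measurable_funTS; exact: measurable_kernelD_section hg.1.
by move=> u; rewrite /= in_itv/=; exact: (kernelD_le hg x0 t1).
Qed.

(** Bound of [|fderiv|] for Holder constant 1: the boundary quotient contributes 1 and the integral
    [(1 - al) / e]. *)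
Definition fderiv_bound : R := 1 + (1 - al) / e.

Lemma fderiv_le C g x t : holder01 C g -> 0 <= x -> x <= t -> t <= 1 ->
  `|fderiv g t x| <= C * fderiv_bound.
Proof.
move=> hg x0 xt t1; have C0 := holder01_ge0 hg.
have tx : 0 <= t - x <= 1 by rewrite subr_ge0 xt/=; lra.
rewrite /fderiv /fderiv_bound mulrDr mulr1.
apply: le_trans (ler_normD _ _) _; apply: lerD.
  have := xt; rewrite le_eqVlt => /predU1P[->|xt'].
    by rewrite subrr mul0r normr0.
  have p0 : 0 < t - x by rewrite subr_gt0.
  rewrite normrM [X in _ * X]ger0_norm ?invr_ge0 ?powR_ge0//.
  rewrite ler_pdivrMr ?powR_gt0//.
  apply: le_trans (hg.2 t x _ _) _; [lra|lra|].
  rewrite ger0_norm ?(ltW p0)// ler_wpM2l//.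
  by apply: ger_powR; [rewrite p0/=; case/andP: tx|exact: ltW].
rewrite normrM ger0_norm ?subr_ge0 ?(ltW al1)// mulrCA ler_wpM2l ?subr_ge0 ?(ltW al1)//.
apply: (@le_trans _ _ (\int[leb]_(u in `[x, t]) (C * (u - x) `^ (e - 1)))).
  apply: normr_Rintegral_le (integrable_pow_e C xt) => //.
    by apply: measurable_funTS; exact: measurable_kernelD_section hg.1.
  by move=> u; rewrite /= in_itv/=; exact: (kernelD_le hg x0 t1).
rewrite RintegralZl//; last exact: integrable_pow_e1.
rewrite (integral_EFin_Rintegral (integral_pow_e xt)) ler_wpM2l//.
rewrite ler_piMl ?invr_ge0 ?(ltW e0)//.
by apply: powR_le1 => //; exact: ltW.
Qed.

Lemma measurable_fderiv g t : measurable_fun setT g -> measurable_fun setT (fderiv g t).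
Proof.
move=> mg; apply: measurable_funD.
  apply: measurable_funM; first exact: measurable_funB.
  under eq_fun do rewrite -powRN.
  by apply: (measurableT_comp (measurable_powR _)); exact: measurable_funB.
apply: measurable_funM => //.
pose k (z : R * R) : R := (g z.2 - g z.1) / (z.2 - z.1) `^ (2 - al).
pose E : set (R * R) := [set z | z.1 <= z.2 <= t].
have mE : measurable E.
  rewrite (_ : E = (setT `&` [set z | z.1 <= z.2]) `&` (setT `&` [set z | z.2 <= t])).
    by apply: measurableI; apply: measurable_fun_le => //.
  apply/seteqP; split=> z; rewrite /E/=; [by move=> /andP[-> ->]|].
  by move=> [[_ ->] [_ ->]].
have mk : measurable_fun setT (k \_ E).
  by apply/(measurable_restrictT _ mE); apply: measurable_funTS; exact: measurable_kernelD.
have := @measurable_section_integral _ _ _ _ R leb _ mk.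
congr (measurable_fun _ _); apply/funext => x.
rewrite [RHS]Rintegral_mkcond; apply: eq_Rintegral => u _.
by rewrite !patchE /E/k/=; congr (if _ then _ else _); apply/idP/idP; rewrite !inE/= in_itv.
Qed.

Lemma fderivD C1 C2 g1 g2 x t : holder01 C1 g1 -> holder01 C2 g2 -> 0 <= x -> x <= t -> t <= 1 ->
  fderiv (fun u => g1 u + g2 u) t x = fderiv g1 t x + fderiv g2 t x.
Proof.
move=> h1 h2 x0 xt t1; rewrite /fderiv.
have -> : \int[leb]_(u in `[x, t]) ((g1 u + g2 u - (g1 x + g2 x)) / (u - x) `^ (2 - al)) =
  \int[leb]_(u in `[x, t]) ((g1 u - g1 x) / (u - x) `^ (2 - al)) +
  \int[leb]_(u in `[x, t]) ((g2 u - g2 x) / (u - x) `^ (2 - al)).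
  rewrite -RintegralD//; [|exact: integrable_kernelD h1 _ _ _|exact: integrable_kernelD h2 _ _ _].
  by apply: eq_Rintegral => u _; ring.
by ring.
Qed.

Lemma fderivZ C g c x t : holder01 C g -> 0 <= x -> x <= t -> t <= 1 ->
  fderiv (fun u => c * g u) t x = c * fderiv g t x.
Proof.
move=> h1 x0 xt t1; rewrite /fderiv.
have -> : \int[leb]_(u in `[x, t]) ((c * g u - c * g x) / (u - x) `^ (2 - al)) =
  c * \int[leb]_(u in `[x, t]) ((g u - g x) / (u - x) `^ (2 - al)).
  rewrite -RintegralZl//; last exact: integrable_kernelD h1 _ _ _.
  by apply: eq_Rintegral => u _; ring.
by ring.
Qed.

Lemma holder01D C1 C2 g1 g2 : holder01 C1 g1 -> holder01 C2 g2 ->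
  holder01 (C1 + C2) (fun u => g1 u + g2 u).
Proof.
move=> [m1 h1] [m2 h2]; split; first exact: measurable_funD.
move=> x y hx hy; have -> : g1 x + g2 x - (g1 y + g2 y) = (g1 x - g1 y) + (g2 x - g2 y) by ring.
by rewrite mulrDl (le_trans (ler_normD _ _))// lerD ?h1 ?h2.
Qed.

Lemma holder01Z C c g : holder01 C g -> holder01 (`|c| * C) (fun u => c * g u).
Proof.
move=> [m1 h1]; split; first exact: measurable_funM.
by move=> x y hx hy; rewrite -mulrBr normrM -mulrA ler_wpM2l ?h1.
Qed.

End marchaud.

Lemma div_powR (R : realType) (x p : R) : 0 < x -> x / x `^ p = x `^ (1 - p).
Proof. by move=> x0; rewrite powRB ?(gt_eqF x0) ?implybT// powRr1// ltW. Qed.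

Lemma Rintegral_dominated_cvg d (T : measurableType d) (R : realType)
    (mu : {measure set T -> \bar R}) (D : set T) (f_ : (T -> R)^nat) (f G : T -> R) :
  measurable D -> (forall n, measurable_fun D (f_ n)) ->
  (forall x, D x -> f_ n x @[n --> \oo] --> f x) ->
  mu.-integrable D (EFin \o G) -> mu.-integrable D (EFin \o f) ->
  (forall n x, D x -> `|f_ n x| <= G x) ->
  (\int[mu]_(x in D) f_ n x) @[n --> \oo] --> \int[mu]_(x in D) f x.
Proof.
move=> mD mf cf iG jf fG; rewrite /Rintegral; apply: fine_cvg.
rewrite fineK//; last exact: integrable_fin_num.
apply: (@dominated_cvg _ _ _ mu D mD _ _ (EFin \o G)) => //.
- by move=> n; exact/measurable_EFinP.
- move=> x Dx; apply: cvg_EFin; last exact: cf.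
  exact: nearW.
Qed.

(** * Inversion of the fractional derivative, from ramps to Holder functions *)

Section marchaud_inversion.
Context {R : realType}.
Notation leb := (@lebesgue_measure R).
Variables al b : R.
Hypothesis al01 : 0 < al < 1.
Hypothesis alb : 1 - al < b.
Hypothesis b1 : b <= 1.
Let al0 : 0 < al. Proof. by case/andP: al01. Qed.
Let al1 : al < 1. Proof. by case/andP: al01. Qed.
Let aln0 : al != 0. Proof. exact: lt0r_neq0. Qed.
Let al1n0 : al - 1 != 0. Proof. by rewrite subr_eq0 lt_eqF. Qed.
Local Notation fder := (fderiv al).
Local Notation holder01 := (holder01 b).
Local Notation be := (fine (beta_kernel al)).

Let mpow (p x : R) : measurable_fun setT (fun u : R => (u - x) `^ p).
Proof. by apply: (measurableT_comp (measurable_powR _)); exact: measurable_funB. Qed.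
Let mpowr (p x : R) : measurable_fun setT (fun u : R => (x - u) `^ p).
Proof. by apply: (measurableT_comp (measurable_powR _)); exact: measurable_funB. Qed.

Lemma integrable_powl a c d p : a <= c -> c <= d -> 0 < p \/ (p != 0 /\ a < c) ->
  leb.-integrable `[c, d] (EFin \o (fun x => (x - a) `^ (p - 1))).
Proof.
move=> ac cd hp; have := ge0_integrable_EFin _ _ _ (integral_powl ac cd hp).
by move=> /(_ (measurable_itv _) (measurable_funTS (mpow _ _)) (fun u _ => powR_ge0 _ _)).
Qed.

Lemma integrable_weight p t : p <= t ->
  leb.-integrable `[p, t] (EFin \o (fun x => (x - p) `^ (- al))).
Proof.
move=> pt.
have -> : - al = 1 - al - 1 by ring.
by apply: integrable_powl => //; left; rewrite subr_gt0.
Qed.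

Lemma integrable_weight_fderiv C g p t : holder01 C g -> 0 <= p -> p <= t -> t <= 1 ->
  leb.-integrable `[p, t] (EFin \o (fun x => (x - p) `^ (- al) * fder g t x)).
Proof.
move=> hg p0 pt t1.
have ig : leb.-integrable `[p, t] (EFin \o (fun x => (C * fderiv_bound al b) * (x - p) `^ (- al))).
  exact: (@integrableZl _ _ R leb _ (measurable_itv _) _ _ (integrable_weight pt)).
apply: integrable_EFin_le ig => //.
  apply: measurable_funTS; apply: measurable_funM; first exact: mpow.
  by apply: measurable_fderiv; exact: hg.1.
move=> x; rewrite /= in_itv/= => /andP[px xt].
rewrite normrM [X in X * _]ger0_norm ?powR_ge0// mulrC ler_wpM2r ?powR_ge0//.
exact: fderiv_le (le_trans p0 px) xt t1.
Qed.

(** A fractional integral of order [1 - al] recovers increments. In terms of stochastic integrals,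
    it says that the indicator of []p, t]] integrates to [g t - g p], because [(x - p)^(-al)] is the
    left fractional derivative of that indicator ([afrac_box1]). *)
Definition fderiv_inv (g : R -> R) : Prop := forall p t, 0 <= p -> p <= t -> t <= 1 ->
  \int[leb]_(x in `[p, t]) ((x - p) `^ (- al) * fder g t x) = be * (g t - g p).

Definition invertible g := (exists C, holder01 C g) /\ fderiv_inv g.

Lemma invertibleD g1 g2 : invertible g1 -> invertible g2 ->
  invertible (fun u => g1 u + g2 u).
Proof.
move=> [[C1 h1] J1] [[C2 h2] J2]; split; first by exists (C1 + C2); exact: holder01D.
move=> p t p0 pt t1.
have -> : be * (g1 t + g2 t - (g1 p + g2 p)) = be * (g1 t - g1 p) + be * (g2 t - g2 p) by ring.
rewrite -J1// -J2// -RintegralD//; [|exact: integrable_weight_fderiv h1 _ _ _|exact: integrable_weight_fderiv h2 _ _ _].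
apply: eq_Rintegral => x; rewrite inE/= in_itv/= => /andP[px xt].
by rewrite (fderivD alb h1 h2 (le_trans p0 px) xt t1) mulrDr.
Qed.

Lemma invertibleZ c g : invertible g -> invertible (fun u => c * g u).
Proof.
move=> [[C h] J]; split; first by exists (`|c| * C); exact: holder01Z.
move=> p t p0 pt t1.
have -> : be * (c * g t - c * g p) = c * (be * (g t - g p)) by ring.
rewrite -J// -RintegralZl//; last exact: integrable_weight_fderiv h _ _ _.
apply: eq_Rintegral => x; rewrite inE/= in_itv/= => /andP[px xt].
by rewrite (fderivZ alb c h (le_trans p0 px) xt t1) mulrCA.
Qed.

Lemma invertible_cst c : invertible (cst c).
Proof.
have h : holder01 0 (cst c).
  by split; [exact: measurable_cst|move=> x y _ _; rewrite /cst subrr normr0 mul0r].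
split; first by exists 0.
move=> p t p0 pt t1; rewrite /cst subrr mulr0.
under eq_Rintegral => x.
  rewrite inE/= in_itv/= => /andP[px xt].
  have := fderiv_le al01 alb h (le_trans p0 px) xt t1; rewrite mul0r normr_le0 => /eqP ->.
  rewrite mulr0; over.
by rewrite Rintegral_cst// mul0r.
Qed.

(** Together with constants, ramps generate the piecewise linear functions, for which the inversion
    can be computed explicitly. *)
Definition ramp (q u : R) : R := Num.max (u - q) 0.

Lemma ramp_le q u : u <= q -> ramp q u = 0.
Proof. by move=> h; rewrite /ramp max_r// subr_le0. Qed.

Lemma ramp_ge q u : q <= u -> ramp q u = u - q.
Proof. by move=> h; rewrite /ramp max_l// subr_ge0. Qed.

(** In [ramp x q] the arguments are exchanged: it is the positive part of [q - x]. For [x < q] only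
    [u] in [[q, t]] contributes, and [u - q = (u - x) - (q - x)] splits the kernel into two pure
    powers. *)
Lemma fderiv_ramp q t x : x <= t -> q < t ->
  fder (ramp q) t x = ((t - x) `^ al - (ramp x q) `^ al) / al.
Proof.
move=> + qt; rewrite le_eqVlt => /predU1P[->|xt].
  by rewrite /fderiv subrr mul0r set_itv1 Rintegral_set1 mulr0 addr0 (ramp_le (ltW qt)) (subrr t) powR0// subrr mul0r.
have tx : 0 < t - x by rewrite subr_gt0.
have [qx|xq] := leP q x.
  rewrite /fderiv (ramp_le qx) powR0// subr0 (ramp_ge qx) (ramp_ge (ltW qt)).
  have -> : \int[leb]_(u in `[x, t]) ((ramp q u - (x - q)) / (u - x) `^ (2 - al)) = (t - x) `^ al / al.
    rewrite (_ : (t - x) `^ al / al = ((t - x) `^ al - (x - x) `^ al) / al); last by rewrite subrr powR0// subr0.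
    apply: integral_EFin_Rintegral; rewrite -integral_powl ?lexx ?(ltW xt)//; last by left.
    apply: eq_integral => u; rewrite inE/= in_itv/= => /andP[xu ut].
    rewrite ramp_ge ?(le_trans qx)//; have -> : u - q - (x - q) = u - x by ring.
    have := xu; rewrite le_eqVlt => /predU1P[->|xu'].
      by rewrite subrr mul0r powR0.
    by rewrite div_powR ?subr_gt0//; congr (_ `^ _)%:E; ring.
  have -> : t - q - (x - q) = t - x by ring.
  rewrite div_powR//; have -> : 1 - (1 - al) = al by ring.
  by move: (_ `^ _) => A; field; exact: aln0.
have qx : 0 < q - x by rewrite subr_gt0.
rewrite /fderiv (ramp_le (ltW xq)) subr0 (ramp_ge (ltW qt)) (ramp_ge (ltW xq)).
have I1 : (\int[leb]_(u in `[q, t]) ((u - x) `^ (al - 1))%:E = (((t - x) `^ al - (q - x) `^ al) / al)%:E)%E.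
  by rewrite integral_powl// ?ltW//; left.
have I2 : (\int[leb]_(u in `[q, t]) ((u - x) `^ (al - 1 - 1))%:E = (((t - x) `^ (al - 1) - (q - x) `^ (al - 1)) / (al - 1))%:E)%E.
  by rewrite integral_powl// ?ltW//; right.
have J1 : leb.-integrable `[q, t] (EFin \o (fun u => (u - x) `^ (al - 1))).
  by apply: integrable_powl; rewrite ?ltW//; left.
have J2 : leb.-integrable `[q, t] (EFin \o (fun u => (u - x) `^ (al - 1 - 1))).
  by apply: integrable_powl; rewrite ?ltW//; right.
have -> : \int[leb]_(u in `[x, t]) ((ramp q u - 0) / (u - x) `^ (2 - al)) =
   \int[leb]_(u in `[q, t]) ((u - x) `^ (al - 1) - (q - x) * (u - x) `^ (al - 1 - 1)).
  have -> : `[q, t]%classic = `[x, t] `&` `[q, t].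
    by apply/seteqP; split => u /=; rewrite !in_itv/=; [move=> /andP[h1 ->]; rewrite h1 (le_trans (ltW xq) h1)|move=> []].
  rewrite Rintegral_mkcondr; apply: eq_Rintegral => u; rewrite inE/= in_itv/= => /andP[xu ut].
  rewrite patchE; case: ifPn; rewrite ?notin_setE ?inE/= in_itv/= ut andbT.
    move=> qu; have xu' : 0 < u - x by rewrite subr_gt0 (lt_le_trans xq).
    rewrite subr0 ramp_ge//.
    have -> : u - q = (u - x) - (q - x) by ring.
    rewrite mulrBl div_powR// -powRN; congr (_ `^ _ - _ * _ `^ _); ring.
  by move=> /negP; rewrite -ltNge => uq; rewrite ramp_le ?(ltW uq)// subrr mul0r.
rewrite RintegralB//; last exact: (@integrableZl _ _ R leb _ (measurable_itv _) _ _ J2).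
rewrite RintegralZl// (integral_EFin_Rintegral I1) (integral_EFin_Rintegral I2).
have -> : (t - q) / (t - x) `^ (1 - al) = (t - q) * (t - x) `^ (al - 1).
  by rewrite -powRN; congr (_ * _ `^ _); ring.
have E y : 0 < y -> y `^ al = y * y `^ (al - 1).
  by move=> y0; rewrite mulr_powRB1// ltW.
rewrite (E _ tx) (E _ qx); field.
by rewrite aln0 al1n0.
Qed.

End marchaud_inversion.

Section marchaud_inversion_holder.
Context {R : realType}.
Notation leb := (@lebesgue_measure R).
Variables al b : R.
Hypothesis al01 : 0 < al < 1.
Hypothesis alb : 1 - al < b.
Hypothesis b1 : b <= 1.
Let al0 : 0 < al. Proof. by case/andP: al01. Qed.
Let al1 : al < 1. Proof. by case/andP: al01. Qed.
Let aln0 : al != 0. Proof. exact: lt0r_neq0. Qed.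
Let b0 : 0 < b. Proof. by apply: le_lt_trans alb; rewrite subr_ge0 ltW. Qed.
Local Notation fder := (fderiv al).
Local Notation holder01 := (holder01 b).
Local Notation be := (fine (beta_kernel al)).

Let mpow (p x : R) : measurable_fun setT (fun u : R => (u - x) `^ p).
Proof. by apply: (measurableT_comp (measurable_powR _)); exact: measurable_funB. Qed.
Let mpowr (p x : R) : measurable_fun setT (fun u : R => (x - u) `^ p).
Proof. by apply: (measurableT_comp (measurable_powR _)); exact: measurable_funB. Qed.

(** Only [[p, q]] contributes, where this is Abel's integral [integral_powl_powr]. *)
Lemma integral_weight_ramp q p t : p <= t -> q <= t ->
  (\int[leb]_(x in `[p, t]) ((x - p) `^ (- al) * (ramp x q `^ al / al))%:E =
   (be * ramp p q)%:E)%E.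
Proof.
move=> pt qt.
have [qp|pq] := leP q p.
  rewrite ramp_le// mulr0; apply: integral0_eq => x; rewrite /= in_itv/= => /andP[px xt].
  by rewrite ramp_le ?(le_trans qp)// powR0// mul0r mulr0.
rewrite (ramp_ge (ltW pq)) -(integral_powl_powr al01 (ltW pq)).
have -> : `[p, q]%classic = `[p, t] `&` `[p, q].
  by apply/seteqP; split => u /=; rewrite !in_itv/=; [move=> /andP[h1 h2]; rewrite h1 h2 (le_trans h2)|move=> []].
rewrite integral_mkcondr; apply: eq_integral => x; rewrite inE/= in_itv/= => /andP[px xt].
rewrite patchE; case: ifPn; rewrite ?notin_setE ?inE/= in_itv/= px/=.
  by move=> xq; rewrite ramp_ge.
by move=> /negP; rewrite -ltNge => qx; rewrite ramp_le ?ltW// powR0// mul0r mulr0.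
Qed.

Let ramp_lip (q u v : R) : `|ramp q u - ramp q v| <= `|u - v|.
Proof.
rewrite /ramp; have [h1|h1] := leP (u - q) 0; have [h2|h2] := leP (v - q) 0.
- by rewrite subrr normr0.
- by rewrite sub0r normrN gtr0_norm// ler0_norm; lra.
- by rewrite subr0 gtr0_norm// ger0_norm; lra.
- by rewrite (_ : u - q - (v - q) = u - v)//; ring.
Qed.

Lemma measurable_ramp (q : R) : measurable_fun [set: R] (fun u : R => ramp q u).
Proof. by apply: measurable_maxr => //; exact: measurable_funB. Qed.

Lemma le_powR1 (x : R) : 0 <= x <= 1 -> x <= x `^ b.
Proof.
move=> /andP[]; rewrite le_eqVlt => /predU1P[<- _|x0 x1]; first exact: powR_ge0.
by rewrite -[leLHS]powRr1 ?(ltW x0)//; apply: ger_powR; rewrite ?x0.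
Qed.

Lemma holder01_ramp (q : R) : holder01 1 (ramp q).
Proof.
split; first exact: measurable_ramp.
move=> x y /andP[x0 x1] /andP[y0 y1]; rewrite mul1r (le_trans (ramp_lip _ _ _))//.
by apply: le_powR1; rewrite normr_ge0 ler_norml; apply/andP; split; lra.
Qed.

Lemma invertible_ramp (q : R) : invertible al b (ramp q).
Proof.
split; first by exists 1; exact: holder01_ramp.
move=> p t p0 pt t1.
have [tq|qt] := leP t q.
  rewrite !ramp_le ?(le_trans pt)// subrr mulr0.
  rewrite (_ : \int[leb]_(x in _) _ = \int[leb]_(x in `[p, t]) 0).
    by rewrite Rintegral_cst// mul0r.
  apply: eq_Rintegral => x; rewrite inE/= in_itv/= => /andP[px xt].
  rewrite /fderiv !ramp_le ?(le_trans xt)// subrr mul0r add0r.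
  rewrite (_ : \int[leb]_(x in _) _ = \int[leb]_(u in `[x, t]) 0).
    by rewrite Rintegral_cst// mul0r !mulr0.
  apply: eq_Rintegral => u; rewrite inE/= in_itv/= => /andP[xu ut].
  by rewrite ramp_le ?(le_trans ut)// subrr mul0r.
have I1 := integral_weight_ramp pt (lexx t).
have I2 := integral_weight_ramp pt (ltW qt).
have mw r : measurable_fun `[p, t] (fun x => (x - p) `^ (- al) * (ramp x r `^ al / al)).
  apply: measurable_funTS; apply: measurable_funM; first exact: mpow.
  apply: measurable_funM => //; apply: (measurableT_comp (measurable_powR _)).
  by apply: measurable_maxr => //; exact: measurable_funB.
have w0 r x : `[p, t]%classic x -> 0 <= (x - p) `^ (- al) * (ramp x r `^ al / al).
  by move=> _; rewrite mulr_ge0 ?powR_ge0// mulr_ge0 ?powR_ge0// invr_ge0 ltW.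
have J1 : leb.-integrable `[p, t] (EFin \o (fun x => (x - p) `^ (- al) * (ramp x t `^ al / al))).
  by apply: (ge0_integrable_EFin _ _ _ I1) => //; [exact: mw|exact: w0].
have J2 : leb.-integrable `[p, t] (EFin \o (fun x => (x - p) `^ (- al) * (ramp x q `^ al / al))).
  by apply: (ge0_integrable_EFin _ _ _ I2) => //; [exact: mw|exact: w0].
have -> : be * (ramp q t - ramp q p) = be * ramp p t - be * ramp p q.
  rewrite -mulrBr; congr (_ * _); rewrite (ramp_ge (ltW qt)) (ramp_ge pt).
  by have [h|h] := leP p q; [rewrite ramp_le// ramp_ge//|rewrite ramp_ge ?ltW// ramp_le ?ltW//]; ring.
rewrite -(integral_EFin_Rintegral I1) -(integral_EFin_Rintegral I2) -RintegralB//.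
apply: eq_Rintegral => x; rewrite inE/= in_itv/= => /andP[px xt].
by rewrite fderiv_ramp// (ramp_ge xt); ring.
Qed.

Lemma fderiv_cvg C (gm : (R -> R)^nat) g x t :
  (forall m, holder01 C (gm m)) -> holder01 C g ->
  (forall u, 0 <= u <= 1 -> gm m u @[m --> \oo] --> g u) ->
  0 <= x -> x <= t -> t <= 1 ->
  fder (gm m) t x @[m --> \oo] --> fder g t x.
Proof.
move=> hm hg cg x0 xt t1.
have cx : gm m x @[m --> \oo] --> g x by apply: cg; rewrite x0 (le_trans xt).
have ct : gm m t @[m --> \oo] --> g t by apply: cg; rewrite t1 (le_trans x0).
apply: cvgD; first by apply: cvgMr_tmp; exact: cvgB.
apply: cvgMl_tmp.
apply: (Rintegral_dominated_cvg _ _ _ (integrable_pow_e alb C xt)) => //.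
- by move=> m; apply: measurable_funTS; exact: measurable_kernelD_section (hm m).1.
- move=> u; rewrite /= in_itv/= => /andP[xu ut]; apply: cvgMr_tmp; apply: cvgB => //.
  by apply: cg; rewrite (le_trans x0 xu) (le_trans ut).
- exact: integrable_kernelD hg _ _ _.
- by move=> m u; rewrite /= in_itv/=; exact: kernelD_le (hm m) _ _.
Qed.

(** A common Holder constant bounds all the fractional derivatives, so dominated convergence carries
    the identity to pointwise limits. *)
Lemma fderiv_inv_cvg C (gm : (R -> R)^nat) g :
  (forall m, holder01 C (gm m)) -> holder01 C g ->
  (forall u, 0 <= u <= 1 -> gm m u @[m --> \oo] --> g u) ->
  (forall m, fderiv_inv al (gm m)) -> fderiv_inv al g.
Proof.
move=> hm hg cg J p t p0 pt t1.
have ig : leb.-integrable `[p, t] (EFin \o (fun x => (C * fderiv_bound al b) * (x - p) `^ (- al))).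
  exact: (@integrableZl _ _ R leb _ (measurable_itv _) _ _ (integrable_weight al01 pt)).
have c1 : (\int[leb]_(x in `[p, t]) ((x - p) `^ (- al) * fder (gm m) t x)) @[m --> \oo] -->
    \int[leb]_(x in `[p, t]) ((x - p) `^ (- al) * fder g t x).
  apply: (Rintegral_dominated_cvg _ _ _ ig) => //.
  - move=> m; apply: measurable_funTS; apply: measurable_funM; first exact: mpow.
    by apply: measurable_fderiv; exact: (hm m).1.
  - move=> x; rewrite /= in_itv/= => /andP[px xt]; apply: cvgMl_tmp.
    exact: (fderiv_cvg hm hg cg (le_trans p0 px) xt t1).
  - exact: integrable_weight_fderiv hg _ _ _.
  - move=> m x; rewrite /= in_itv/= => /andP[px xt].
    rewrite normrM [X in X * _]ger0_norm ?powR_ge0// mulrC ler_wpM2r ?powR_ge0//.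
    exact: fderiv_le (hm m) (le_trans p0 px) xt t1.
have c2 : (be * (gm m t - gm m p)) @[m --> \oo] --> be * (g t - g p).
  by apply: cvgMl_tmp; apply: cvgB; apply: cg; lra.
move: c1; rewrite (_ : (fun m => _) = (fun m => be * (gm m t - gm m p))).
  by move=> c1; exact: (cvg_unique _ c1 c2).
by apply/funext => m; rewrite J.
Qed.

(** The piecewise linear interpolant of [g] on the grid [k / m], written with ramps so that
    [invertible] reaches it by linearity. *)
Definition interp (g : R -> R) (m : nat) (u : R) : R :=
  g 0 + \sum_(k < m) (m%:R * (g (k.+1%:R / m%:R) - g (k%:R / m%:R))) *
    (ramp (k%:R / m%:R) u - ramp (k.+1%:R / m%:R) u).

Lemma invertible_interp g m : invertible al b (interp g m).
Proof.
apply: invertibleD => //; first exact: invertible_cst.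
have H (s : seq nat) : invertible al b (fun u => \sum_(k <- s)
    (m%:R * (g (k.+1%:R / m%:R) - g (k%:R / m%:R))) *
    (ramp (k%:R / m%:R) u - ramp (k.+1%:R / m%:R) u)).
  elim: s => [|k s IH].
    under eq_fun do rewrite big_nil; exact: invertible_cst.
  under eq_fun do rewrite big_cons.
  apply: invertibleD => //; apply: invertibleZ => //.
  apply: invertibleD => //; first exact: invertible_ramp.
  under eq_fun do rewrite -mulN1r.
  by apply: invertibleZ => //; exact: invertible_ramp.
by have := H (index_iota 0 m); under eq_fun do rewrite big_mkord.
Qed.

Lemma sum_hat m (u : R) : (0 < m)%N -> 0 <= u <= 1 ->
  \sum_(k < m) (ramp (k%:R / m%:R) u - ramp (k.+1%:R / m%:R) u) = u.
Proof.
move=> m0 /andP[u0 u1]; pose f k : R := ramp (k%:R / m%:R) u.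
transitivity (- (f m - f 0%N)).
  rewrite -telescope_sumr// big_mkord -sumrN.
  by apply: eq_bigr => k _; rewrite opprB.
rewrite /f divff ?pnatr_eq0 -?lt0n// (ramp_le u1) mul0r ramp_ge//; ring.
Qed.

Lemma hat_nd m k (u v : R) : (0 < m)%N -> u <= v ->
  ramp (k%:R / m%:R) u - ramp (k.+1%:R / m%:R) u <= ramp (k%:R / m%:R) v - ramp (k.+1%:R / m%:R) v.
Proof.
move=> m0 uv; have : k%:R / m%:R <= k.+1%:R / m%:R :> R.
  by rewrite ler_pM2r ?ler_nat// invr_gt0 ltr0n.
move: (_ / _) (_.+1%:R / _) => p q pq.
rewrite /ramp.
by have [h1|h1] := leP (u - p) 0; have [h2|h2] := leP (u - q) 0;
  have [h3|h3] := leP (v - p) 0; have [h4|h4] := leP (v - q) 0; lra.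
Qed.

(** Each slope is at most [C m^(1 - b)] in absolute value, while the cell functions have nonnegative
    increments that add up to [v - u]. *)
Lemma interp_lip C g m u v : holder01 C g -> (0 < m)%N -> 0 <= u -> u <= v -> v <= 1 ->
  `|interp g m v - interp g m u| <= C * m%:R `^ (1 - b) * (v - u).
Proof.
move=> [mg hg] m0 u0 uv v1; have mR : 0 < m%:R :> R by rewrite ltr0n.
rewrite /interp opprD addrACA subrr add0r -sumrB.
under eq_bigr do rewrite -mulrBr.
apply: le_trans (ler_norm_sum _ _ _) _.
have -> : v - u = \sum_(k < m) ((ramp (k%:R / m%:R) v - ramp (k.+1%:R / m%:R) v) -
   (ramp (k%:R / m%:R) u - ramp (k.+1%:R / m%:R) u)).
  by rewrite sumrB !sum_hat// ?u0 ?v1 ?(le_trans uv)// (le_trans u0).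
rewrite mulr_sumr; apply: ler_sum => k _.
rewrite normrM [X in _ * X]ger0_norm; last by rewrite subr_ge0; exact: hat_nd.
apply: ler_wpM2r; first by rewrite subr_ge0; exact: hat_nd.
have km : k.+1%:R / m%:R <= 1 :> R by rewrite ler_pdivrMr// mul1r ler_nat.
have k0 : 0 <= k%:R / m%:R :> R by rewrite divr_ge0.
have kk : k.+1%:R / m%:R - k%:R / m%:R = m%:R^-1 :> R.
  by rewrite -mulrBl -natrB// subSnn mul1r.
have mi : 0 < m%:R^-1 :> R by rewrite invr_gt0.
rewrite normrM ger0_norm ?ler0n//.
have H := hg (k.+1%:R / m%:R) (k%:R / m%:R).
have {}H := H ltac:(lra) ltac:(lra).
rewrite kk (gtr0_norm mi) in H.
apply: le_trans (ler_wpM2l (ler0n _ _) H) _.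
rewrite mulrCA; apply: ler_wpM2l; first exact: holder01_ge0 (conj mg hg).
by rewrite -powR_inv1 ?ler0n// -powRrM mulN1r powRN div_powR.
Qed.

Lemma interp_node g m j : (0 < m)%N -> (j <= m)%N -> interp g m (j%:R / m%:R) = g (j%:R / m%:R).
Proof.
move=> m0 jm; have mR : 0 < m%:R :> R by rewrite ltr0n.
rewrite /interp.
rewrite (_ : \sum_(k < m) _ = \sum_(k < m | (k < j)%N) (g (k.+1%:R / m%:R) - g (k%:R / m%:R))).
  rewrite -(big_ord_widen _ (fun k => g (k.+1%:R / m%:R) - g (k%:R / m%:R)) jm).
  rewrite -(big_mkord xpredT (fun k => g (k.+1%:R / m%:R) - g (k%:R / m%:R))) telescope_sumr//.
  by rewrite mul0r; ring.
rewrite [RHS]big_mkcond; apply: eq_bigr => k _; case: ltnP => kj.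
  rewrite !ramp_ge ?ler_pM2r ?ler_nat ?invr_gt0// 1?ltnW//.
  have -> : j%:R / m%:R - k%:R / m%:R - (j%:R / m%:R - k.+1%:R / m%:R) = m%:R^-1 :> R.
    by rewrite -natr1; field; rewrite gt_eqF.
  by field; rewrite gt_eqF.
by rewrite !ramp_le ?ler_pM2r ?ler_nat ?invr_gt0// 1?ltnW// subrr mulr0.
Qed.

Lemma interp_error C g m u : holder01 C g -> (0 < m)%N -> 0 <= u <= 1 ->
  `|interp g m u - g u| <= 2 * C * m%:R^-1 `^ b.
Proof.
move=> hg m0 /andP[u0 u1]; have mR : 0 < m%:R :> R by rewrite ltr0n.
have C0 := holder01_ge0 hg.
pose j := Num.truncn (u * m%:R).
have um0 : 0 <= u * m%:R by rewrite mulr_ge0// ltW.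
have /andP[j1 j2] : j%:R <= u * m%:R < j.+1%:R by rewrite -truncn_eq//; exact: eqxx.
have jm : (j <= m)%N.
  by rewrite -(ler_nat R) (le_trans j1)// ler_piMl// ltW.
have p1 : j%:R / m%:R <= u by rewrite ler_pdivrMr.
have p0 : 0 <= j%:R / m%:R :> R by rewrite divr_ge0.
have p2 : u - j%:R / m%:R <= m%:R^-1.
  rewrite lerBlDr -[X in X + _]mul1r -mulrDl ler_pdivlMr// addrC natr1 ltW//.
have mi : 0 < m%:R^-1 :> R by rewrite invr_gt0.
(* Both functions are compared with their common value at the grid point just left of [u]. *)
rewrite (_ : interp g m u - g u = (interp g m u - interp g m (j%:R / m%:R)) - (g u - g (j%:R / m%:R))); last first.
  by rewrite interp_node//; ring.
apply: le_trans (ler_normB _ _) _.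
have -> : 2 * C * m%:R^-1 `^ b = C * m%:R^-1 `^ b + C * m%:R^-1 `^ b by ring.
apply: lerD.
  apply: le_trans (interp_lip hg m0 p0 p1 u1) _.
  rewrite -mulrA ler_wpM2l//.
  apply: le_trans (ler_wpM2l (powR_ge0 _ _) p2) _.
  by rewrite -powR_inv1 ?ler0n// -powRrM mulN1r -powRD ?(gt_eqF mR) ?implybT// (_ : 1 - b + -1 = - b)//; ring.
apply: le_trans (hg.2 _ _ _ _) _; [lra|lra|].
rewrite ger0_norm ?subr_ge0// ler_wpM2l//.
by apply: ge0_ler_powR; rewrite ?nnegrE ?subr_ge0// ltW.
Qed.

(** The point is a constant independent of [m]. Increments up to [1 / m] are covered by
    [interp_lip]; longer ones by the interpolation error at both ends, [2 C + 2 C], plus the bound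
    of [g] itself: hence 5. *)
Lemma holder01_interp C g m : holder01 C g -> (0 < m)%N -> holder01 (5 * C) (interp g m).
Proof.
move=> hg m0; have mR : 0 < m%:R :> R by rewrite ltr0n.
have C0 := holder01_ge0 hg; have mi : 0 < m%:R^-1 :> R by rewrite invr_gt0.
split; first by have [[C' []]] := invertible_interp g m.
suff H u v : 0 <= u -> u <= v -> v <= 1 -> `|interp g m v - interp g m u| <= 5 * C * (v - u) `^ b.
  move=> x y /andP[x0 x1] /andP[y0 y1]; have [xy|/ltW yx] := leP x y.
    by rewrite distrC (distrC x) (ger0_norm (_ : 0 <= y - x)) ?subr_ge0// H.
  by rewrite (ger0_norm (_ : 0 <= x - y)) ?subr_ge0// H.
move=> u0; rewrite le_eqVlt => /predU1P[<-|uv] v1.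
  by rewrite (subrr (interp g m u)) normr0 mulr_ge0 ?powR_ge0// mulr_ge0.
have d0 : 0 < v - u by rewrite subr_gt0.
have Cb : 0 <= C * (v - u) `^ b by rewrite mulr_ge0 ?powR_ge0.
have [dm|dm] := leP (v - u) m%:R^-1.
  apply: le_trans (interp_lip hg m0 u0 (ltW uv) v1) _.
  apply: (@le_trans _ _ (C * (v - u) `^ b)); last by lra.
  rewrite -mulrA ler_wpM2l//.
  have -> : (v - u) `^ b = (v - u) `^ (b - 1) * (v - u).
    by rewrite -[X in _ = _ * X]powRr1 ?(ltW d0)// -powRD ?(gt_eqF d0) ?implybT// subrK.
  rewrite ler_wpM2r ?(ltW d0)//.
  have -> : m%:R `^ (1 - b) = m%:R^-1 `^ (b - 1) :> R.
    by rewrite -powR_inv1 ?ler0n// -powRrM; congr (_ `^ _); ring.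
  rewrite -(opprB 1 b) !powRN lef_pV2 ?posrE ?powR_gt0//.
  by apply: ge0_ler_powR; rewrite ?nnegrE ?subr_ge0// ltW.
have -> : interp g m v - interp g m u = (interp g m v - g v) - (interp g m u - g u) + (g v - g u) by ring.
apply: le_trans (ler_normD _ _) _.
apply: (@le_trans _ _ (2 * C * m%:R^-1 `^ b + 2 * C * m%:R^-1 `^ b + C * (v - u) `^ b)).
  apply: lerD.
    apply: le_trans (ler_normB _ _) _.
    by apply: lerD; apply: interp_error => //; lra.
  by apply: le_trans (hg.2 _ _ _ _) _; [lra|lra|rewrite gtr0_norm].
have : m%:R^-1 `^ b <= (v - u) `^ b.
  by apply: ge0_ler_powR; rewrite ?nnegrE ?(ltW mi) ?(ltW d0) ?(ltW b0)// ltW.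
move=> /(ler_wpM2l C0); lra.
Qed.

(** True for ramps, hence for interpolants, and these converge to [g] with a common Holder
    constant. *)
Lemma fderiv_inversion C g : holder01 C g -> fderiv_inv al g.
Proof.
move=> hg; have C0 := holder01_ge0 hg.
apply: (@fderiv_inv_cvg (5 * C) (fun m => interp g m.+1)).
- by move=> m; exact: holder01_interp.
- split; first exact: hg.1.
  move=> x y hx hy; apply: le_trans (hg.2 x y hx hy) _.
  by have := mulr_ge0 C0 (powR_ge0 `|x - y| b); lra.
- move=> u u01; apply/cvgrPdist_le => eps eps0.
  have c1 : 2 * C * (m.+1%:R^-1) `^ b @[m --> \oo] --> (0 : R).
    rewrite -(mulr0 (2 * C)); apply: cvgMl_tmp.
    have := powR_cvg0 b0; move/cvg_at_rightP; apply; split => [n|]; first by rewrite invr_gt0 ltr0n.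
    exact: cvg_harmonic.
  move/cvgrPdist_le : c1 => /(_ _ eps0); apply: filterS => m.
  rewrite sub0r normrN => h; rewrite distrC (le_trans _ h)//.
  by rewrite (le_trans _ (ler_norm _))//; exact: interp_error.
- by move=> m; have [] := invertible_interp g m.+1.
Qed.

End marchaud_inversion_holder.

(** * The generalized Lebesgue-Stieltjes integral and its norm *)

Section generalized_LS.
Context {R : realType}.
Notation leb := (@lebesgue_measure R).
Variables al b : R.
Hypothesis al01 : 0 < al < 1.
Hypothesis alb : 1 - al < b.
Hypothesis b1 : b <= 1.
Let al0 : 0 < al. Proof. by case/andP: al01. Qed.
Let al1 : al < 1. Proof. by case/andP: al01. Qed.
Let aln0 : al != 0. Proof. exact: lt0r_neq0. Qed.
Local Notation fder := (fderiv al).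
Local Notation holder01 := (holder01 b).
Local Notation be := (fine (beta_kernel al)).
Local Notation normW := (normW al).
Local Notation gLS := (gLS_integral al).

Implicit Types (f g : R -> R) (s t c C : R).

Let be_gt0 : 0 < be.
Proof.
by rewrite (@lt_le_trans _ _ 1)// -lee_fin -beta_kernelE// beta_kernel_ge1.
Qed.

(** The left-sided counterpart of [fderiv]: the factor of [gLS_integral] that carries the
    integrand. *)
Definition afrac (f : R -> R) (x : R) : R :=
  f x / x `^ al + al * \int[leb]_(u in `[0, x]) ((f x - f u) / (x - u) `^ (1 + al)).

Definition mfrac (f : R -> R) (s : R) : \bar R :=
  (\int[leb]_(z in `[0%R, s]) (`|f s - f z| / (s - z) `^ (1 + al))%:E)%E.

(** Finiteness of [normW] alone makes [mfrac f s] finite only for almost every [s]. Asking it for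
    every [s] makes the real-valued inner integrals additive at each point, so that [afrac] is
    linear pointwise. *)
Definition admissible (f : R -> R) (t : R) : Prop :=
  [/\ measurable_fun setT f, forall s, 0 <= s <= t -> (mfrac f s < +oo)%E &
      (normW t f < +oo)%E].

Lemma gLSE f g t : gLS f g t = be^-1 * \int[leb]_(x in `[0, t]) (afrac f x * fder g t x).
Proof. by rewrite /gLS_integral Gamma_reflection. Qed.

Let measurable_kernel2 (f : R -> R) : measurable_fun setT f ->
  measurable_fun setT (fun z : R * R => (f z.1 - f z.2) / (z.1 - z.2) `^ (1 + al)).
Proof.
move=> mf; apply: measurable_funM.
  by apply: measurable_funB; exact: measurableT_comp.
under eq_fun do rewrite -powRN.
by apply: (measurableT_comp (measurable_powR _)); exact: measurable_funB.
Qed.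

Let measurable_kernel1 (f : R -> R) s : measurable_fun setT f ->
  measurable_fun setT (fun z : R => (f s - f z) / (s - z) `^ (1 + al)).
Proof.
move=> mf; apply: measurable_funM; first exact: measurable_funB.
under eq_fun do rewrite -powRN.
by apply: (measurableT_comp (measurable_powR _)); exact: measurable_funB.
Qed.

Let kernel_norm (f : R -> R) s z :
  `|f s - f z| / (s - z) `^ (1 + al) = `|(f s - f z) / (s - z) `^ (1 + al)|.
Proof. by rewrite normrM [X in _ = _ * X]ger0_norm// invr_ge0 powR_ge0. Qed.

Let E : set (R * R) := [set z | 0 <= z.2 <= z.1].
Let mE : measurable E.
Proof.
rewrite (_ : E = (setT `&` [set z | 0 <= z.2]) `&` (setT `&` [set z | z.2 <= z.1])).
  by apply: measurableI; apply: measurable_fun_le => //.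
apply/seteqP; split=> z; rewrite /E/=; [by move=> /andP[-> ->]|].
by move=> [[_ ->] [_ ->]].
Qed.

Lemma measurable_mfrac f : measurable_fun setT f -> measurable_fun setT (mfrac f).
Proof.
move=> mf.
pose k (z : R * R) : R := `|f z.1 - f z.2| / (z.1 - z.2) `^ (1 + al).
have mk : measurable_fun setT ((EFin \o k) \_ E).
  apply/(measurable_restrictT _ mE); apply: measurable_funTS; apply/measurable_EFinP.
  rewrite /k; under eq_fun do rewrite kernel_norm.
  by apply: measurableT_comp => //; exact: measurable_kernel2.
have k0 z : (0 <= ((EFin \o k) \_ E) z)%E.
  by rewrite patchE; case: ifP => // _; rewrite lee_fin /k kernel_norm.
have := @measurable_fun_fubini_tonelli_F _ _ _ _ R leb _ mk k0.
congr (measurable_fun _ _); apply/funext => x.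
rewrite /fubini_F /mfrac [RHS]integral_mkcond; apply: eq_integral => u _.
by rewrite !patchE /E/k/=; congr (if _ then _ else _); apply/idP/idP; rewrite !inE/= in_itv.
Qed.

Lemma measurable_afrac f : measurable_fun setT f -> measurable_fun setT (afrac f).
Proof.
move=> mf; apply: measurable_funD.
  apply: measurable_funM => //; under eq_fun do rewrite -powRN.
  exact: measurable_powR.
apply: measurable_funM => //.
pose k (z : R * R) : R := (f z.1 - f z.2) / (z.1 - z.2) `^ (1 + al).
have mk : measurable_fun setT (k \_ E).
  by apply/(measurable_restrictT _ mE); apply: measurable_funTS; exact: measurable_kernel2.
have := @measurable_section_integral _ _ _ _ R leb _ mk.
congr (measurable_fun _ _); apply/funext => x.
rewrite [RHS]Rintegral_mkcond; apply: eq_Rintegral => u _.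
by rewrite !patchE /E/k/=; congr (if _ then _ else _); apply/idP/idP; rewrite !inE/= in_itv.
Qed.

Lemma integrable_kernel f t s : admissible f t -> 0 <= s <= t ->
  leb.-integrable `[0, s] (EFin \o (fun u => (f s - f u) / (s - u) `^ (1 + al))).
Proof.
move=> [mf hs _] /hs h; apply/integrableP; split.
  by apply/measurable_EFinP/measurable_funTS; exact: measurable_kernel1.
by under eq_integral do rewrite /= -kernel_norm.
Qed.

Lemma mfrac_ge0 f s : (0 <= mfrac f s)%E.
Proof. by apply: integral_ge0 => z _; rewrite lee_fin kernel_norm. Qed.

Lemma normr_afrac_le f t s : admissible f t -> 0 <= s <= t ->
  ((`|afrac f s|)%:E <= (`|f s| / s `^ al)%:E + mfrac f s)%E.
Proof.
move=> af hs; have ik := integrable_kernel af hs.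
have h : (mfrac f s < +oo)%E by case: af => _ /(_ _ hs).
have fm : mfrac f s = (fine (mfrac f s))%:E by rewrite fineK// ge0_fin_numE// mfrac_ge0.
rewrite fm -EFinD lee_fin; apply: le_trans (ler_normD _ _) _; apply: lerD.
  by rewrite normrM [X in _ * X]ger0_norm// invr_ge0 powR_ge0.
rewrite normrM gtr0_norm//.
apply: (@le_trans _ _ (`|\int[leb]_(u in `[0, s]) ((f s - f u) / (s - u) `^ (1 + al))|)).
  by rewrite ler_piMl// ltW.
apply: le_trans (le_normr_Rintegral _ ik) _ => //.
by rewrite /Rintegral /mfrac; under eq_integral do rewrite -kernel_norm.
Qed.

Lemma measurable_normW_integrand f : measurable_fun setT f ->
  measurable_fun setT (fun s => (`|f s| / s `^ al)%:E + mfrac f s)%E.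
Proof.
move=> mf; apply: emeasurable_funD; last exact: measurable_mfrac.
apply/measurable_EFinP; apply: measurable_funM; first exact: measurableT_comp.
under eq_fun do rewrite -powRN; exact: measurable_powR.
Qed.

Let integrand_ge0 f s : (0 <= (`|f s| / s `^ al)%:E + mfrac f s)%E.
Proof. by rewrite adde_ge0 ?mfrac_ge0// lee_fin divr_ge0 ?powR_ge0. Qed.

Lemma integrable_afrac f t : admissible f t -> leb.-integrable `[0, t] (EFin \o afrac f).
Proof.
move=> af; have [mf _ nf] := af; apply/integrableP; split.
  by apply/measurable_EFinP/measurable_funTS; exact: measurable_afrac.
apply: le_lt_trans nf; apply: ge0_le_integral => //=.
- by apply/measurable_EFinP/measurable_funTS/measurableT_comp => //; exact: measurable_afrac.
- by apply: measurable_funTS; exact: measurable_normW_integrand.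
- by move=> s; rewrite in_itv/=; exact: normr_afrac_le.
Qed.

Lemma Rintegral_normr_afrac f t : admissible f t ->
  \int[leb]_(x in `[0, t]) `|afrac f x| <= fine (normW t f).
Proof.
move=> af; have [mf _ nf] := af.
rewrite /Rintegral; apply: fine_le.
- exact: integrable_fin_num (integrable_norm (integrable_afrac af)).
- by rewrite ge0_fin_numE//; apply: integral_ge0 => s _.
apply: ge0_le_integral => //=.
- by apply/measurable_EFinP/measurable_funTS/measurableT_comp => //; exact: measurable_afrac.
- by apply: measurable_funTS; exact: measurable_normW_integrand.
- by move=> s; rewrite in_itv/=; exact: normr_afrac_le.
Qed.

Lemma integrable_afrac_fderiv C f g t : admissible f t -> holder01 C g -> 0 <= t <= 1 ->
  leb.-integrable `[0, t] (EFin \o (fun x => afrac f x * fder g t x)).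
Proof.
move=> af hg /andP[t0 t1]; have [mf _ _] := af.
have ig := @integrableZl _ _ R leb _ (measurable_itv _) (C * fderiv_bound al b) _ (integrable_norm (integrable_afrac af)).
apply: (integrable_EFin_le _ _ _ ig) => //.
  apply: measurable_funTS; apply: measurable_funM; first exact: measurable_afrac.
  by apply: measurable_fderiv; exact: hg.1.
move=> x; rewrite /= in_itv/= => /andP[x0 xt].
by rewrite normrM mulrC ler_wpM2r//; exact: (fderiv_le al01 alb hg x0 xt t1).
Qed.

(** The fractional derivative of the integrator is bounded, and the integral of [|afrac f|] is at
    most the norm. *)
Lemma normr_gLS_le C f g t : admissible f t -> holder01 C g -> 0 <= t <= 1 ->
  `|gLS f g t| <= be^-1 * (C * fderiv_bound al b) * fine (normW t f).
Proof.
move=> af hg t01; have [mf _ _] := af; case/andP : (t01) => t0 t1.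
have C0 := holder01_ge0 hg.
have CB0 : 0 <= C * fderiv_bound al b.
  exact: (le_trans (normr_ge0 (fder g 0 0)) (fderiv_le al01 alb hg (lexx 0) (lexx 0) ler01)).
rewrite gLSE normrM gtr0_norm ?invr_gt0// -mulrA ler_wpM2l ?invr_ge0 ?(ltW be_gt0)//.
have ig := @integrableZl _ _ R leb _ (measurable_itv _) (C * fderiv_bound al b) _ (integrable_norm (integrable_afrac af)).
apply: (@le_trans _ _ (\int[leb]_(x in `[0, t]) ((C * fderiv_bound al b) * `|afrac f x|))).
  apply: (normr_Rintegral_le _ _ _ ig) => //.
    apply: measurable_funTS; apply: measurable_funM; first exact: measurable_afrac.
    by apply: measurable_fderiv; exact: hg.1.
  move=> x; rewrite /= in_itv/= => /andP[x0 xt].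
  by rewrite normrM mulrC ler_wpM2r//; exact: (fderiv_le al01 alb hg x0 xt t1).
rewrite RintegralZl//; last exact: integrable_norm (integrable_afrac af).
by rewrite ler_wpM2l// Rintegral_normr_afrac.
Qed.

Lemma mfracD f1 f2 s : measurable_fun setT f1 -> measurable_fun setT f2 ->
  (mfrac (fun x => f1 x + f2 x)%R s <= mfrac f1 s + mfrac f2 s)%E.
Proof.
move=> m1 m2; rewrite /mfrac -ge0_integralD//; last 4 first.
- by move=> z _; rewrite lee_fin kernel_norm.
- apply/measurable_EFinP/measurable_funTS; under eq_fun do rewrite kernel_norm.
  by apply: measurableT_comp => //; exact: measurable_kernel1.
- by move=> z _; rewrite lee_fin kernel_norm.
- apply/measurable_EFinP/measurable_funTS; under eq_fun do rewrite kernel_norm.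
  by apply: measurableT_comp => //; exact: measurable_kernel1.
have m12 : measurable_fun setT (fun x => f1 x + f2 x) by exact: measurable_funD.
apply: ge0_le_integral => //=.
- by move=> z _; rewrite lee_fin (kernel_norm (fun x => f1 x + f2 x)).
- apply/measurable_EFinP/measurable_funTS; under eq_fun do rewrite (kernel_norm (fun x => f1 x + f2 x)).
  by apply: measurableT_comp => //; exact: (@measurable_kernel1 (fun x => f1 x + f2 x) s m12).
- apply: emeasurable_funD; apply/measurable_EFinP/measurable_funTS; under eq_fun do rewrite kernel_norm.
    by apply: measurableT_comp => //; exact: measurable_kernel1.
  by apply: measurableT_comp => //; exact: measurable_kernel1.
move=> z _; rewrite -EFinD lee_fin -mulrDl ler_wpM2r ?invr_ge0 ?powR_ge0//.
by rewrite opprD addrACA ler_normD.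
Qed.

Lemma normWD f1 f2 t : measurable_fun setT f1 -> measurable_fun setT f2 ->
  (normW t (fun x => f1 x + f2 x)%R <= normW t f1 + normW t f2)%E.
Proof.
move=> m1 m2; have m12 : measurable_fun setT (fun x => f1 x + f2 x) by exact: measurable_funD.
pose k f s := ((`|f s| / s `^ al)%:E + mfrac f s)%E.
have mk f : measurable_fun setT f -> measurable_fun `[0, t] (k f).
  by move=> mf; apply: measurable_funTS; exact: measurable_normW_integrand.
have E1 f : normW t f = (\int[leb]_(s in `[0%R, t]) k f s)%E by [].
rewrite !E1 -(ge0_integralD leb (measurable_itv _) _ (mk _ m1) _ (mk _ m2)).
- apply: (ge0_le_integral leb (measurable_itv _)).
  + by move=> s _; exact: integrand_ge0.
  + exact: mk m12.
  + by apply: emeasurable_funD; exact: mk.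
  + move=> s _; rewrite /k addeACA; apply: leeD; last exact: mfracD.
    by rewrite -EFinD lee_fin -mulrDl ler_wpM2r ?invr_ge0 ?powR_ge0// ler_normD.
- by move=> s _; exact: integrand_ge0.
- by move=> s _; exact: integrand_ge0.
Qed.

Lemma admissibleD f1 f2 t : admissible f1 t -> admissible f2 t ->
  admissible (fun x => f1 x + f2 x) t.
Proof.
move=> [m1 a1 n1] [m2 a2 n2]; split; first exact: measurable_funD.
  by move=> s hs; apply: le_lt_trans (mfracD _ m1 m2) _; exact: lte_add_pinfty (a1 _ hs) (a2 _ hs).
exact: le_lt_trans (normWD t m1 m2) (lte_add_pinfty n1 n2).
Qed.

Lemma mfracZ c f s : measurable_fun setT f ->
  (mfrac (fun x => c * f x)%R s = (`|c|)%:E * mfrac f s)%E.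
Proof.
move=> m; rewrite /mfrac -ge0_integralZl_EFin//; last 2 first.
- by move=> z _; rewrite lee_fin kernel_norm.
- apply/measurable_EFinP/measurable_funTS; under eq_fun do rewrite kernel_norm.
  by apply: measurableT_comp => //; exact: measurable_kernel1.
by apply: eq_integral => z _; rewrite -EFinM mulrA -normrM mulrBr.
Qed.

Lemma normWZ c f t : measurable_fun setT f ->
  normW t (fun x => c * f x) = ((`|c|)%:E * normW t f)%E.
Proof.
move=> m; pose k f s := ((`|f s| / s `^ al)%:E + mfrac f s)%E.
have mk : measurable_fun `[0, t] (k f).
  by apply: measurable_funTS; exact: measurable_normW_integrand.
have E1 h : normW t h = (\int[leb]_(s in `[0%R, t]) k h s)%E by [].
rewrite !E1 -(ge0_integralZl_EFin leb (measurable_itv _) _ mk (normr_ge0 c)); last first.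
  by move=> s _; exact: integrand_ge0.
apply: eq_integral => s _; rewrite /k ge0_muleDr ?mfrac_ge0//; last first.
  by rewrite lee_fin divr_ge0 ?powR_ge0.
by rewrite -mfracZ// -EFinM normrM mulrA.
Qed.

Lemma admissibleZ c f t : admissible f t -> admissible (fun x => c * f x) t.
Proof.
move=> [m a n]; split; first exact: measurable_funM.
  by move=> s hs; rewrite mfracZ// lte_mul_pinfty ?a// lee_fin.
by rewrite normWZ// lte_mul_pinfty// lee_fin.
Qed.

Lemma afracD f1 f2 t s : admissible f1 t -> admissible f2 t -> 0 <= s <= t ->
  afrac (fun x => f1 x + f2 x) s = afrac f1 s + afrac f2 s.
Proof.
move=> a1 a2 hs; rewrite /afrac.
have -> : \int[leb]_(u in `[0, s]) ((f1 s + f2 s - (f1 u + f2 u)) / (s - u) `^ (1 + al)) =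
   \int[leb]_(u in `[0, s]) ((f1 s - f1 u) / (s - u) `^ (1 + al)) +
   \int[leb]_(u in `[0, s]) ((f2 s - f2 u) / (s - u) `^ (1 + al)).
  rewrite -RintegralD//; [|exact: integrable_kernel a1 hs|exact: integrable_kernel a2 hs].
  by apply: eq_Rintegral => u _; ring.
by ring.
Qed.

Lemma afracZ c f t s : admissible f t -> 0 <= s <= t ->
  afrac (fun x => c * f x) s = c * afrac f s.
Proof.
move=> a1 hs; rewrite /afrac.
have -> : \int[leb]_(u in `[0, s]) ((c * f s - c * f u) / (s - u) `^ (1 + al)) =
   c * \int[leb]_(u in `[0, s]) ((f s - f u) / (s - u) `^ (1 + al)).
  rewrite -RintegralZl//; last exact: integrable_kernel a1 hs.
  by apply: eq_Rintegral => u _; ring.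
by ring.
Qed.

Lemma gLSD C f1 f2 g t : admissible f1 t -> admissible f2 t -> holder01 C g -> 0 <= t <= 1 ->
  gLS (fun x => f1 x + f2 x) g t = gLS f1 g t + gLS f2 g t.
Proof.
move=> a1 a2 hg t01; rewrite !gLSE -mulrDr; congr (_ * _).
rewrite -RintegralD//; [|exact: integrable_afrac_fderiv a1 hg t01|exact: integrable_afrac_fderiv a2 hg t01].
by apply: eq_Rintegral => x; rewrite inE/= in_itv/= => hx; rewrite (afracD a1 a2 hx) mulrDl.
Qed.

Lemma gLSZ C c f g t : admissible f t -> holder01 C g -> 0 <= t <= 1 ->
  gLS (fun x => c * f x) g t = c * gLS f g t.
Proof.
move=> a1 hg t01; rewrite !gLSE mulrCA; congr (_ * _).
rewrite -RintegralZl//; last exact: integrable_afrac_fderiv a1 hg t01.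
by apply: eq_Rintegral => x; rewrite inE/= in_itv/= => hx; rewrite (afracZ c a1 hx) mulrA.
Qed.

(** Only values on [[0, t]] enter; this allows a path to be exchanged for its extension to the
    line. *)
Lemma eq_gLS f1 f2 g1 g2 t : (forall x, 0 <= x <= t -> f1 x = f2 x) ->
  (forall x, 0 <= x <= t -> g1 x = g2 x) -> gLS f1 g1 t = gLS f2 g2 t.
Proof.
move=> ef eg; rewrite !gLSE; congr (_ * _); apply: eq_Rintegral => x; rewrite inE/= in_itv/= => hx.
case/andP: (hx) => x0 xt; have h0t : 0 <= t <= t by rewrite lexx (le_trans x0).
congr (_ * _).
  rewrite /afrac ef//; congr (_ + _ * _); apply: eq_Rintegral => u; rewrite inE/= in_itv/= => /andP[u0 ux].
  by rewrite ef// u0 (le_trans ux).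
rewrite /fderiv !eg//; congr (_ + _ * _); apply: eq_Rintegral => u; rewrite inE/= in_itv/= => /andP[xu ut].
by rewrite eg// ut (le_trans x0).
Qed.

Lemma eq_normW f1 f2 t : (forall x, 0 <= x <= t -> f1 x = f2 x) -> normW t f1 = normW t f2.
Proof.
move=> ef; apply: eq_integral => x; rewrite inE/= in_itv/= => hx.
case/andP: (hx) => x0 xt.
rewrite ef//; congr (_ + _)%E; apply: eq_integral => u; rewrite inE/= in_itv/= => /andP[u0 ux].
by rewrite ef// u0 (le_trans ux).
Qed.

End generalized_LS.

(** * The norm of an integrand supported on one interval *)

Section box.
Context {R : realType}.
Notation leb := (@lebesgue_measure R).

(** Open at [a] and closed at [d], as befits a left-continuous position. *)
Definition box (a d : R) (h : R -> R) (x : R) : R :=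
  if (a < x) && (x <= d) then h x else 0.

Lemma measurable_box a d h : measurable_fun setT h -> measurable_fun setT (box a d h).
Proof.
move=> mh; apply: measurable_fun_ifT => //.
by apply: measurable_and; [exact: measurable_fun_ltr|exact: measurable_fun_ler].
Qed.

Variables al : R.
Hypothesis al01 : 0 < al < 1.
Let al0 : 0 < al. Proof. by case/andP: al01. Qed.
Let al1 : al < 1. Proof. by case/andP: al01. Qed.
Let aln0 : al != 0. Proof. exact: lt0r_neq0. Qed.
Let q0 : 0 < 1 - al. Proof. by rewrite subr_gt0. Qed.
Local Notation normW := (normW al).
Local Notation mfrac := (mfrac al).

Variables (a d M L : R) (h : R -> R).
Hypothesis a0 : 0 <= a.
Hypothesis ad : a <= d.
Hypothesis mh : measurable_fun setT h.
Hypothesis hM : forall x, a <= x <= d -> `|h x| <= M.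
Hypothesis hL : forall x y, a <= x <= d -> a <= y <= d -> `|h x - h y| <= L * `|x - y|.
Hypothesis L0 : 0 <= L.
Let M0 : 0 <= M. Proof. by apply: le_trans (hM (x := a) _) => //; rewrite lexx. Qed.
Local Notation f := (box a d h).

Let mpl (p x : R) : measurable_fun setT (fun u : R => (u - x) `^ p).
Proof. by apply: (measurableT_comp (measurable_powR _)); exact: measurable_funB. Qed.
Let mpr (p x : R) : measurable_fun setT (fun u : R => (x - u) `^ p).
Proof. by apply: (measurableT_comp (measurable_powR _)); exact: measurable_funB. Qed.

Let box_out x : x <= a \/ d < x -> f x = 0.
Proof.
rewrite /box => -[h1|h1]; first by rewrite ltNge h1.
by rewrite [x <= d]leNgt h1 andbF.
Qed.

Let box_in x : a < x <= d -> f x = h x.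
Proof. by rewrite /box => ->. Qed.

Let boxM x : `|f x| <= M.
Proof.
rewrite /box; case: ifP => [/andP[h1 h2]|_]; last by rewrite normr0.
by apply: hM; rewrite h2 ltW.
Qed.

Let mk s : measurable_fun setT (fun z => (`|f s - f z| / (s - z) `^ (1 + al))%:E).
Proof.
apply/measurable_EFinP; apply: measurable_funM.
  by apply: measurableT_comp => //; apply: measurable_funB => //; exact: measurable_box.
under eq_fun do rewrite -powRN; exact: mpr.
Qed.

Let k_ge0 s z : (0 <= (`|f s - f z| / (s - z) `^ (1 + al))%:E)%E.
Proof. by rewrite lee_fin divr_ge0 ?powR_ge0. Qed.

Lemma mfrac_box_before s : s <= a -> mfrac f s = 0%E.
Proof.
move=> sa; apply: integral0_eq => z; rewrite /= in_itv/= => /andP[z0 zs].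
by rewrite !box_out ?subrr ?normr0 ?mul0r//; left => //; exact: le_trans sa.
Qed.

Let sep_integral s c e : c <= e -> e < s ->
  (\int[leb]_(z in `[c, e]) (M * (s - z) `^ (- al - 1))%:E =
   (M * (((s - e) `^ (- al) - (s - c) `^ (- al)) / al))%:E)%E.
Proof.
move=> ce es; under eq_integral do rewrite EFinM.
rewrite ge0_integralZl_EFin//; last 2 first.
- by move=> z _; rewrite lee_fin powR_ge0.
- by apply/measurable_EFinP/measurable_funTS; exact: mpr.
rewrite integral_powr// ?(ltW es)//; last by right; rewrite oppr_eq0.
by rewrite -EFinM invrN; congr (_ * _)%:E; ring.
Qed.

(** For [z <= a] the difference is at most [M]; for [z > a] the Lipschitz bound lowers the
    singularity from [1 + al] to [al]. Each region gives one of the two terms. *)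
Lemma mfrac_box_in s : a < s -> s <= d ->
  (mfrac f s <= (M * ((s - a) `^ (- al) / al) + L * ((d - a) `^ (1 - al) / (1 - al)))%:E)%E.
Proof.
move=> as_ sd; have s0 : 0 <= s := le_trans a0 (ltW as_).
pose k1 z : \bar R := (M * (s - z) `^ (- al - 1))%:E.
pose k2 z : \bar R := (L * (s - z) `^ (1 - al - 1))%:E.
have mk1 : measurable_fun setT k1.
  by apply/measurable_EFinP; apply: measurable_funM => //; exact: mpr.
have mk2 : measurable_fun setT k2.
  by apply/measurable_EFinP; apply: measurable_funM => //; exact: mpr.
have k10 z : (0 <= k1 z)%E by rewrite lee_fin mulr_ge0 ?powR_ge0.
have k20 z : (0 <= k2 z)%E by rewrite lee_fin mulr_ge0 ?powR_ge0.
have mp1 : measurable_fun setT (k1 \_ `[0, a]).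
  by apply/(measurable_restrictT _ (measurable_itv _)); exact: measurable_funTS.
have mp2 : measurable_fun setT (k2 \_ `[a, s]).
  by apply/(measurable_restrictT _ (measurable_itv _)); exact: measurable_funTS.
have p10 z : (0 <= (k1 \_ `[0%R, a]) z)%E by rewrite patchE; case: ifP.
have p20 z : (0 <= (k2 \_ `[a, s]) z)%E by rewrite patchE; case: ifP.
apply: (@le_trans _ _ (\int[leb]_(z in `[0%R, s]) ((k1 \_ `[0%R, a]) z + (k2 \_ `[a, s]) z))%E).
  apply: (ge0_le_integral leb (measurable_itv _)).
  - by move=> z _; exact: k_ge0.
  - by apply: measurable_funTS; exact: mk.
  - by apply: emeasurable_funD; exact: measurable_funTS.
  move=> z; rewrite /= in_itv/= => /andP[z0 zs].
  have [za|az] := leP z a.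
    apply: (@le_trans _ _ (k1 z)); last first.
      have -> : (k1 \_ `[0%R, a]) z = k1 z by rewrite patchE mem_set//= in_itv/= z0.
      by rewrite leeDl.
    rewrite /k1 lee_fin (box_out (or_introl za)) subr0 -powRN.
    by rewrite (_ : - (1 + al) = - al - 1); [rewrite ler_wpM2r ?powR_ge0|ring].
  apply: (@le_trans _ _ (k2 z)); last first.
    have -> : (k2 \_ `[a, s]) z = k2 z by rewrite patchE mem_set//= in_itv/= (ltW az).
    by rewrite leeDr.
  rewrite /k2 lee_fin !box_in ?as_ ?az ?sd ?(le_trans zs)//.
  have [->|zns] := eqVneq z s.
    by rewrite !subrr normr0 mul0r mulr_ge0 ?powR_ge0.
  have sz : 0 < s - z by rewrite subr_gt0 lt_neqAle zns zs.
  apply: (@le_trans _ _ (L * (s - z) / (s - z) `^ (1 + al))).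
    rewrite ler_wpM2r ?invr_ge0 ?powR_ge0//.
    have := hL (x := s) (y := z); rewrite (gtr0_norm sz); apply; apply/andP; split=> //; lra.
  rewrite -mulrA div_powR//.
  by rewrite (_ : 1 - (1 + al) = 1 - al - 1)//; ring.
rewrite (ge0_integralD leb (measurable_itv _)); [|by []|exact: measurable_funTS|by []|exact: measurable_funTS].
rewrite -!integral_mkcondr.
have -> : `[0, s] `&` `[0, a] = `[0, a]%classic.
  by apply/seteqP; split => u /=; rewrite !in_itv/=; [move=> []|move=> /andP[h1 h2]; rewrite h1 h2 (le_trans h2)// ltW].
have -> : `[0, s] `&` `[a, s] = `[a, s]%classic.
  by apply/seteqP; split => u /=; rewrite !in_itv/=; [move=> []|move=> /andP[h1 h2]; rewrite h1 h2 (le_trans a0)].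
rewrite /k1 sep_integral// /k2.
under eq_integral do rewrite EFinM.
rewrite (ge0_integralZl_EFin leb (measurable_itv _) _ _ L0); last 2 first.
- by move=> z _; rewrite lee_fin powR_ge0.
- by apply/measurable_EFinP/measurable_funTS; exact: mpr.
rewrite integral_powr ?lexx ?(ltW as_)//; last by left.
rewrite -EFinM -EFinD lee_fin subrr powR0 ?gt_eqF// !subr0; apply: lerD.
  rewrite ler_wpM2l// ler_wpM2r ?invr_ge0 ?(ltW al0)//.
  by rewrite gerBl powR_ge0.
rewrite ler_wpM2l// ler_wpM2r ?invr_ge0 ?(ltW q0)//.
by apply: ge0_ler_powR; rewrite ?nnegrE ?subr_ge0 ?(ltW al1) ?(ltW as_)// ?lerD2r//.
Qed.

Lemma mfrac_box_after s : d < s ->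
  (mfrac f s <= (M * (((s - d) `^ (- al) - (s - a) `^ (- al)) / al))%:E)%E.
Proof.
move=> ds; have s0 : 0 <= s by apply: (le_trans a0); apply: (le_trans ad); exact: ltW.
pose k1 z : \bar R := (M * (s - z) `^ (- al - 1))%:E.
have mk1 : measurable_fun setT k1.
  by apply/measurable_EFinP; apply: measurable_funM => //; exact: mpr.
have k10 z : (0 <= k1 z)%E by rewrite lee_fin mulr_ge0 ?powR_ge0.
have mp1 : measurable_fun setT (k1 \_ `[a, d]).
  by apply/(measurable_restrictT _ (measurable_itv _)); exact: measurable_funTS.
apply: (@le_trans _ _ (\int[leb]_(z in `[0%R, s]) ((k1 \_ `[a, d]) z))%E).
  apply: (ge0_le_integral leb (measurable_itv _)).
  - by move=> z _; exact: k_ge0.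
  - by apply: measurable_funTS; exact: mk.
  - exact: measurable_funTS.
  move=> z; rewrite /= in_itv/= => /andP[z0 zs].
  rewrite (box_out (or_intror ds)) sub0r normrN.
  rewrite patchE; case: ifPn; rewrite ?notin_setE ?inE/= in_itv/=.
    move=> _; rewrite /k1 lee_fin -powRN.
    by rewrite (_ : - (1 + al) = - al - 1); [rewrite ler_wpM2r ?powR_ge0|ring].
  move=> /negP; rewrite negb_and -!ltNge => zad; rewrite box_out ?normr0 ?mul0r//.
  by case/orP: zad => [/ltW|]; [left|right].
rewrite -integral_mkcondr.
have -> : `[0, s] `&` `[a, d] = `[a, d]%classic.
  apply/seteqP; split => u /=; rewrite !in_itv/=; first by case.
  by move=> /andP[h1 h2]; rewrite h1 h2 (le_trans a0 h1) (le_trans h2 (ltW ds)).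
by rewrite /k1 sep_integral.
Qed.

(** With [h = d - a] the norm is of order [M h^(1 - al) + L h^(2 - al)], uniformly in [t]. For a
    Lipschitz function vanishing at [a] one can take [M = L h], and both terms have the order
    [2 - al > 1] that sewing requires. *)
Lemma normW_box t : d <= t ->
  (normW t f <= (3 / (al * (1 - al)) * (M * (d - a) `^ (1 - al) + L * (d - a) `^ (2 - al)))%:E)%E.
Proof.
move=> dt.
pose c1 := L * ((d - a) `^ (1 - al) / (1 - al)).
(* [p1] dominates the integrand of the norm on []a, d]], using [s^(-al) <= (s - a)^(-al)], and [p2]
   dominates it after [d]; up to [a] it is zero. *)
pose p1 s : \bar R := (M * (1 + al^-1) * (s - a) `^ (1 - al - 1) + c1)%:E.
pose p2 s : \bar R := (M / al * ((s - d) `^ (1 - al - 1) - (s - a) `^ (1 - al - 1)))%:E.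
have c10 : 0 <= c1 by rewrite mulr_ge0// divr_ge0 ?powR_ge0// ltW.
have q1 : 1 - al - 1 = - al by ring.
have mp1 : measurable_fun setT p1.
  apply/measurable_EFinP; apply: measurable_funD => //; apply: measurable_funM => //; exact: mpl.
have mp2 : measurable_fun setT p2.
  apply/measurable_EFinP; apply: measurable_funM => //.
  by apply: measurable_funB; exact: mpl.
have M1 : 0 <= M * (1 + al^-1) by rewrite mulr_ge0// addr_ge0// invr_ge0 ltW.
have p10 s : (0 <= p1 s)%E by rewrite lee_fin addr_ge0// mulr_ge0 ?powR_ge0.
have p20 s : d < s -> (0 <= p2 s)%E.
  move=> ds; rewrite lee_fin mulr_ge0 ?divr_ge0 ?(ltW al0)// subr_ge0 q1 !powRN.
  rewrite lef_pV2 ?posrE ?powR_gt0 ?subr_gt0//; last exact: le_lt_trans ds.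
  apply: ge0_ler_powR; rewrite ?nnegrE ?subr_ge0 ?(ltW al0) ?(ltW ds)//.
    by rewrite (le_trans ad)// ltW.
  by rewrite lerD2l lerN2.
have mr1 : measurable_fun setT (p1 \_ `[a, d]).
  by apply/(measurable_restrictT _ (measurable_itv _)); exact: measurable_funTS.
have mr2 : measurable_fun setT (p2 \_ `]d, t]).
  by apply/(measurable_restrictT _ (measurable_itv _)); exact: measurable_funTS.
have r10 z : (0 <= (p1 \_ `[a, d]) z)%E by rewrite patchE; case: ifP.
have r20 z : (0 <= (p2 \_ `]d, t]) z)%E.
  by rewrite patchE; case: ifPn => //; rewrite inE/= in_itv/= => /andP[/p20].
have mf := measurable_box a d mh.
apply: (@le_trans _ _ (\int[leb]_(z in `[0%R, t]) ((p1 \_ `[a, d]) z + (p2 \_ `]d, t]) z))%E).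
  apply: (ge0_le_integral leb (measurable_itv _)).
  - by move=> s _; rewrite adde_ge0 ?mfrac_ge0// lee_fin divr_ge0 ?powR_ge0.
  - by apply: measurable_funTS; exact: measurable_normW_integrand.
  - by apply: emeasurable_funD; exact: measurable_funTS.
  move=> s; rewrite /= in_itv/= => /andP[s0 st].
  change (((`|f s| / s `^ al)%:E + mfrac f s <= (p1 \_ `[a, d]) s + (p2 \_ `]d, t]) s)%E).
  have [sa|as_] := leP s a.
    by rewrite mfrac_box_before// (box_out (or_introl sa)) normr0 mul0r adde0 adde_ge0.
  have [sd|ds] := leP s d.
    apply: (@le_trans _ _ (p1 s)); last first.
      have -> : (p1 \_ `[a, d]) s = p1 s by rewrite patchE mem_set//= in_itv/= (ltW as_).
      by rewrite leeDl.
    apply: le_trans (leeD (lexx _) (mfrac_box_in as_ sd)) _.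
    rewrite -EFinD lee_fin addrA lerD2r q1 mulrDr mulrDl mulr1; apply: lerD; last by rewrite mulrAC mulrA.
    rewrite -powRN; apply: ler_pM; rewrite ?powR_ge0//.
    rewrite !powRN lef_pV2 ?posrE ?powR_gt0 ?subr_gt0//; last exact: le_lt_trans as_.
    apply: ge0_ler_powR; rewrite ?nnegrE ?subr_ge0 ?(ltW al0) ?(ltW as_)//.
    by rewrite gerBl.
  apply: (@le_trans _ _ (p2 s)); last first.
    have -> : (p2 \_ `]d, t]) s = p2 s by rewrite patchE mem_set//= in_itv/= ds.
    by rewrite leeDr.
  rewrite (box_out (or_intror ds)) normr0 mul0r add0e.
  apply: le_trans (mfrac_box_after ds) _.
  by rewrite /p2 q1 lee_fin le_eqVlt; apply/orP; left; apply/eqP; ring.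
rewrite (ge0_integralD leb (measurable_itv _)); [|by []|exact: measurable_funTS|by []|exact: measurable_funTS].
rewrite -!integral_mkcondr.
have -> : `[0, t] `&` `[a, d] = `[a, d]%classic.
  apply/seteqP; split => u /=; rewrite !in_itv/=; first by case.
  by move=> /andP[h1 h2]; rewrite h1 h2 (le_trans a0 h1) (le_trans h2 dt).
have -> : `[0, t] `&` `]d, t] = `]d, t]%classic.
  apply/seteqP; split => u /=; rewrite !in_itv/=; first by case.
  by move=> /andP[h1 h2]; rewrite h1 h2 (le_trans a0)// (le_trans ad)// ltW.
have ip (u v w : R) : u <= v -> v <= w -> leb.-integrable `[v, w] (EFin \o (fun x => (x - u) `^ (1 - al - 1))).
  by move=> uv vw; apply: integrable_powl => //; left.
have E1 : (\int[leb]_(s in `[a, d]) p1 s = (M * (1 + al^-1) * ((d - a) `^ (1 - al) / (1 - al)) + c1 * (d - a))%:E)%E.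
  rewrite /p1; under eq_integral do rewrite EFinD.
  rewrite (ge0_integralD leb (measurable_itv _)); last 4 first.
  - by move=> s _; rewrite lee_fin mulr_ge0 ?powR_ge0.
  - apply/measurable_EFinP/measurable_funTS.
    by apply: measurable_funM => //; exact: mpl.
  - by move=> s _; rewrite lee_fin.
  - exact: measurable_cst.
  under eq_integral do rewrite EFinM.
  rewrite (ge0_integralZl_EFin leb (measurable_itv _) _ _ M1); last 2 first.
  - by move=> s _; rewrite lee_fin powR_ge0.
  - by apply/measurable_EFinP/measurable_funTS; exact: mpl.
  rewrite integral_powl ?lexx//; last by left.
  rewrite subrr powR0 ?gt_eqF// subr0 integral_cst//= lebesgue_measure_itv/= lte_fin.
  have [adl|da] := ltP a d; first by rewrite -EFinB -!EFinM -EFinD.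
  have -> : d = a by apply/eqP; rewrite eq_le da ad.
  by rewrite subrr !mulr0 mule0 adde0 -EFinM addr0.
have E2 : (\int[leb]_(s in `]d, t]) p2 s <= (M / al * ((d - a) `^ (1 - al) / (1 - al)))%:E)%E.
  rewrite integral_itv_obnd_cbnd; last exact: measurable_funTS.
  have i1 := ip d d t (lexx _) dt; have i2 := ip a d t ad dt.
  have i3 : leb.-integrable `[d, t] (EFin \o (fun s => (s - d) `^ (1 - al - 1) - (s - a) `^ (1 - al - 1))).
    exact: (@integrableB _ _ R leb _ (measurable_itv _) _ _ i1 i2).
  have i4 : leb.-integrable `[d, t] p2 by exact: (@integrableZl _ _ R leb _ (measurable_itv _) _ _ i3).
  have i5 : (\int[leb]_(s in `[d, t]) p2 s)%E \is a fin_num by exact: integrable_fin_num.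
  rewrite -(fineK i5).
  rewrite (_ : fine _ = \int[leb]_(s in `[d, t]) (M / al * ((s - d) `^ (1 - al - 1) - (s - a) `^ (1 - al - 1))))//.
  rewrite RintegralZl// RintegralB//.
  rewrite !(integral_EFin_Rintegral (integral_powl _ _ _))//; [|by left|by left].
  rewrite subrr [0 `^ _]powR0 ?gt_eqF// subr0 lee_fin ler_wpM2l ?divr_ge0 ?(ltW al0)//.
  rewrite -mulrBl ler_wpM2r ?invr_ge0 ?(ltW q0)//.
  (* The two powers growing with [t] nearly cancel, which leaves a bound by [(d - a)^(1 - al)]
     alone. *)
  have : (t - d) `^ (1 - al) <= (t - a) `^ (1 - al).
    apply: ge0_ler_powR; rewrite ?nnegrE ?subr_ge0 ?(ltW al1) ?(le_trans ad dt)//.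
    by rewrite lerD2l lerN2.
  by lra.
rewrite E1; apply: le_trans (leeD (lexx _) E2) _.
rewrite -EFinD lee_fin.
have dd : (d - a) `^ (2 - al) = (d - a) `^ (1 - al) * (d - a).
  have h1 : 0 <= d - a by rewrite subr_ge0.
  have h2 : 0 < 2 - al by rewrite subr_gt0 (lt_trans al1)// ltr1n.
  by rewrite -(mulr_powRB1 h1 h2) mulrC (_ : 2 - al - 1 = 1 - al)//; ring.
rewrite /c1 dd.
have P0 := powR_ge0 (d - a) (1 - al); move: (_ `^ _) P0 => P P0.
have D0 : 0 <= d - a by rewrite subr_ge0.
have LP : 0 <= L * P * (d - a) by rewrite !mulr_ge0.
have MP : 0 <= M * P by rewrite mulr_ge0.
have i0 : 0 < (al * (1 - al))^-1 by rewrite invr_gt0 mulr_gt0.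
have -> : M * (1 + al^-1) * (P / (1 - al)) + L * (P / (1 - al)) * (d - a) + M / al * (P / (1 - al)) =
   (al * (1 - al))^-1 * (M * P * (al + 2) + L * P * (d - a) * al).
  by field; rewrite aln0 gt_eqF.
rewrite [X in _ <= X]mulrAC [X in _ <= X]mulrC ler_pM2l//.
have h1 : M * P * al <= M * P by rewrite ler_piMr// ltW.
have h2 : L * P * (d - a) * al <= L * P * (d - a) by rewrite ler_piMr// ltW.
lra.
Qed.

Lemma admissible_box t : d <= t -> admissible al f t.
Proof.
move=> dt; split; first exact: measurable_box.
  move=> s /andP[s0 st]; have [sa|as_] := leP s a; first by rewrite mfrac_box_before.
  have [sd|ds] := leP s d; first exact: le_lt_trans (mfrac_box_in as_ sd) (ltry _).
  exact: le_lt_trans (mfrac_box_after ds) (ltry _).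
exact: le_lt_trans (normW_box dt) (ltry _).
Qed.

End box.

(** * The integral over one interval: exact for indicators, local for Lipschitz integrands *)

Section gLS_box.
Context {R : realType}.
Notation leb := (@lebesgue_measure R).
Variables al b : R.
Hypothesis al01 : 0 < al < 1.
Hypothesis alb : 1 - al < b.
Hypothesis b1 : b <= 1.
Let al0 : 0 < al. Proof. by case/andP: al01. Qed.
Let al1 : al < 1. Proof. by case/andP: al01. Qed.
Let aln0 : al != 0. Proof. exact: lt0r_neq0. Qed.
Local Notation fder := (fderiv al).
Local Notation holder01 := (holder01 b).
Local Notation be := (fine (beta_kernel al)).
Local Notation gLS := (gLS_integral al).
Implicit Types (f g h : R -> R) (a d x t C L : R).

Let be_gt0 : 0 < be.
Proof. by rewrite (@lt_le_trans _ _ 1)// -lee_fin -beta_kernelE// beta_kernel_ge1. Qed.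

Let sep_integral x a d : a <= d -> d < x ->
  \int[leb]_(z in `[a, d]) ((x - z) `^ (- al - 1)) = ((x - d) `^ (- al) - (x - a) `^ (- al)) / al.
Proof.
move=> ad dx; apply: integral_EFin_Rintegral.
rewrite integral_powr// ?(ltW dx)//; last by right; rewrite oppr_eq0.
by rewrite invrN; congr EFin; ring.
Qed.

Let sep_integrable x a d : a <= d -> d < x ->
  leb.-integrable `[a, d] (EFin \o (fun z => (x - z) `^ (- al - 1))).
Proof.
move=> ad dx.
apply: (@ge0_integrable_EFin R _ _ leb _ _ (((x - a) `^ (- al) - (x - d) `^ (- al)) / - al)) => //.
- apply: measurable_funTS.
  by apply: (measurableT_comp (measurable_powR _)); exact: measurable_funB.
- by move=> z _; exact: powR_ge0.
- by rewrite integral_powr// ?(ltW dx)//; right; rewrite oppr_eq0.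
Qed.

(** Left fractional derivative of an indicator. As 0 to a nonzero exponent is 0 for [powR], each
    ramp power vanishes up to its threshold. *)
Lemma afrac_box1 a d x : 0 <= a -> a <= d -> 0 <= x ->
  afrac al (box a d (cst 1)) x = (ramp a x) `^ (- al) - (ramp d x) `^ (- al).
Proof.
move=> a0 ad x0; have na : - al != 0 by rewrite oppr_eq0.
have fin z : a < z -> z <= d -> box a d (cst 1) z = 1 by rewrite /box => -> ->.
have fb z : z <= a -> box a d (cst 1) z = 0 by rewrite /box ltNge => ->.
have fa z : d < z -> box a d (cst 1) z = 0 by rewrite /box leNgt => ->; rewrite andbF.
rewrite /afrac; have [xa|ax] := leP x a.
  rewrite !ramp_le ?(le_trans xa)// powR0// subrr fb// mul0r add0r.
  rewrite (_ : \int[leb]_(u in _) _ = \int[leb]_(u in `[0, x]) 0); last first.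
    apply: eq_Rintegral => u; rewrite inE/= in_itv/= => /andP[u0 ux].
    by rewrite fb ?(le_trans ux)// subrr mul0r.
  by rewrite Rintegral_cst// mul0r mulr0.
have e1 : - (1 + al) = - al - 1 by ring.
have [xd|dx] := leP x d.
  rewrite ramp_ge ?(ltW ax)// (ramp_le xd) powR0// subr0 fin// -powRN mul1r.
  rewrite (_ : \int[leb]_(u in _) _ = \int[leb]_(u in `[0, a]) ((x - u) `^ (- al - 1))).
    by rewrite sep_integral// subr0; field.
  rewrite (_ : `[0, a]%classic = `[0, x] `&` `[0, a]); last first.
    by apply/seteqP; split => u /=; rewrite !in_itv/=; [move=> /andP[h1 h2]; rewrite h1 h2 (le_trans h2)// ltW|move=> []].
  rewrite Rintegral_mkcondr; apply: eq_Rintegral => u; rewrite inE/= in_itv/= => /andP[u0 ux].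
  rewrite patchE; case: ifPn; rewrite ?notin_setE ?inE/= in_itv/= u0/=.
    by move=> ua; rewrite fb// subr0 mul1r -powRN e1.
  by move=> /negP; rewrite -ltNge => au; rewrite fin// ?(le_trans ux)// subrr mul0r.
rewrite !ramp_ge ?(ltW ax) ?(ltW dx)// fa// mul0r add0r.
rewrite (_ : \int[leb]_(u in _) _ = \int[leb]_(u in `[a, d]) (- 1 * (x - u) `^ (- al - 1))).
  by rewrite RintegralZl ?sep_integral//; [field|exact: sep_integrable].
transitivity (\int[leb]_(u in `[0, x] `&` `]a, d]) (- 1 * (x - u) `^ (- al - 1))).
  rewrite Rintegral_mkcondr; apply: eq_Rintegral => u; rewrite inE/= in_itv/= => /andP[u0 ux].
  rewrite patchE; case: ifPn; rewrite ?notin_setE ?inE/= in_itv/=.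
    by move=> /andP[au ud]; rewrite fin// sub0r -powRN e1.
  move=> /negP; rewrite negb_and -!leNgt => H.
  suff -> : box a d (cst 1) u = 0 by rewrite subrr mul0r.
  by rewrite /box; case: ifP => // /andP[h1 h2]; move: H; rewrite leNgt h1/= -ltNge ltNge h2.
rewrite (_ : `[0, x] `&` `]a, d] = `]a, d]%classic); last first.
  apply/seteqP; split => u /=; rewrite !in_itv/=; first by case.
  by move=> /andP[h1 h2]; rewrite h1 h2 (le_trans a0 (ltW h1)) (le_trans h2 (ltW dx)).
apply: Rintegral_itv_obnd_cbnd.
have i1 := @integrableZl _ _ R leb _ (measurable_itv _) (-1) _ (sep_integrable ad dx).
by apply: integrableS i1 => //; exact: subset_itv_oc_cc.
Qed.

(** The two ramp powers of [afrac_box1] integrate, by [fderiv_inversion] at [a] and at [d], to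
    [be (g t - g a) - be (g t - g d)]; the normalisation removes [be]. *)
Lemma gLS_box1 C g a d t : holder01 C g -> 0 <= a -> a <= d -> d <= t -> t <= 1 ->
  gLS (box a d (cst 1)) g t = g d - g a.
Proof.
move=> hg a0 ad dt t1; have at_ := le_trans ad dt.
have na : - al != 0 by rewrite oppr_eq0.
have key p : 0 <= p -> p <= t ->
  leb.-integrable `[0, t] (EFin \o (fun x => (ramp p x) `^ (- al) * fder g t x)) /\
  \int[leb]_(x in `[0, t]) ((ramp p x) `^ (- al) * fder g t x) = be * (g t - g p).
  move=> p0 pt.
  have E1 x : x \in `[0, t] -> ((fun x => (x - p) `^ (- al) * fder g t x) \_ `[p, t]) x =
      (ramp p x) `^ (- al) * fder g t x.
    rewrite in_itv/= => /andP[x0 xt].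
    rewrite patchE; case: ifPn; rewrite ?notin_setE ?inE/= in_itv/= xt andbT.
      by move=> px; rewrite ramp_ge.
    by move=> /negP; rewrite -ltNge => xp; rewrite ramp_le ?(ltW xp)// powR0// mul0r.
  have E2 : `[p, t]%classic = `[0, t] `&` `[p, t].
    by apply/seteqP; split => u /=; rewrite !in_itv/=; [move=> /andP[h1 h2]; rewrite h1 h2 (le_trans p0)|move=> []].
  split; last first.
    rewrite -(fderiv_inversion al01 alb b1 hg p0 pt t1) E2 Rintegral_mkcondr.
    by apply: eq_Rintegral => x; rewrite inE/= => /E1 ->.
  have := integrable_weight_fderiv al01 alb hg p0 pt t1; rewrite E2.
  move=> /(@integrable_restrict _ _ _ leb _ (measurable_itv _) _ (measurable_itv _) _).
  apply: eq_integrable => // x; rewrite inE => xt.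
  by rewrite [RHS]/= -(E1 _ xt) !patchE; case: ifP.
have [i1 I1] := key _ a0 at_; have [i2 I2] := key _ (le_trans a0 ad) dt.
rewrite (gLSE al01).
rewrite (_ : \int[leb]_(x in _) _ = be * (g t - g a) - be * (g t - g d)).
  by field; rewrite gt_eqF.
rewrite -I1 -I2 -RintegralB//.
apply: eq_Rintegral => x; rewrite inE/= in_itv/= => /andP[x0 xt].
by rewrite afrac_box1// mulrBl.
Qed.

(** The constants of [normr_gLS_le] and [normW_box] multiplied; [2 L] comes from [M = L (d - a)]. *)
Definition gLS_const C L : R :=
  be^-1 * (C * fderiv_bound al b) * (3 / (al * (1 - al)) * (2 * L)).

Section lipschitz.
Variables (f : R -> R) (L : R).
Hypothesis mf : measurable_fun setT f.
Hypothesis fL : forall x y, 0 <= x <= 1 -> 0 <= y <= 1 -> `|f x - f y| <= L * `|x - y|.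

Let L0 : 0 <= L.
Proof.
by have := fL (x := 0) (y := 1); rewrite sub0r normrN normr1 mulr1 !lexx ler01 => /(_ isT isT); apply: le_trans.
Qed.

Let box1_adm a d t : 0 <= a -> a <= d -> d <= t -> admissible al (box a d (cst 1)) t.
Proof.
move=> a0 ad dt; apply: (@admissible_box R al al01 a d 1 0 (cst 1)) => //.
- by move=> x _; rewrite /cst normr1.
- by move=> x y _ _; rewrite /cst subrr normr0 mul0r.
Qed.

Let boxf_eq a d : box a d f = (fun x => f a * box a d (cst 1) x + box a d (fun x => f x - f a) x).
Proof.
apply/funext => x; rewrite /box; case: ifP => _; last by rewrite mulr0 addr0.
by rewrite mulr1 addrC subrK.
Qed.

Let hM a d : 0 <= a -> a <= d -> d <= 1 -> forall x, a <= x <= d -> `|f x - f a| <= L * (d - a).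
Proof.
move=> a0 ad d1 x /andP[ax xd]; apply: le_trans (fL _ _) _.
- by rewrite (le_trans a0)// (le_trans xd).
- by rewrite a0 (le_trans ad).
- by rewrite ler_wpM2l// ger0_norm ?subr_ge0// lerD2r.
Qed.

Let hL a d : 0 <= a -> a <= d -> d <= 1 -> forall x y, a <= x <= d -> a <= y <= d ->
  `|(f x - f a) - (f y - f a)| <= L * `|x - y|.
Proof.
move=> a0 ad d1 x y /andP[ax xd] /andP[ay yd].
rewrite (_ : f x - f a - (f y - f a) = f x - f y); last by ring.
by apply: fL; rewrite ?(le_trans a0) ?(le_trans _ d1).
Qed.

Let boxd_adm a d t : 0 <= a -> a <= d -> d <= t -> d <= 1 -> admissible al (box a d (fun x => f x - f a)) t.
Proof.
move=> a0 ad dt d1; apply: (@admissible_box R al al01 a d (L * (d - a)) L) => //.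
- exact: measurable_funB.
- exact: hM.
- exact: hL.
Qed.

Lemma admissible_box_lip a d t : 0 <= a -> a <= d -> d <= t -> d <= 1 -> admissible al (box a d f) t.
Proof.
move=> a0 ad dt d1; rewrite boxf_eq; apply: admissibleD; last exact: boxd_adm.
by apply: admissibleZ; exact: box1_adm.
Qed.

(** On []a, d]] write [f = f a + (f - f a)]. The constant part integrates exactly to
    [f a (g d - g a)]; the rest is Lipschitz and at most [L (d - a)], so its norm is of order
    [2 - al]. *)
Lemma gLS_box_local C g a d t : holder01 C g -> 0 <= a -> a <= d -> d <= t -> t <= 1 ->
  `|gLS (box a d f) g t - f a * (g d - g a)| <= gLS_const C L * (d - a) `^ (2 - al).
Proof.
move=> hg a0 ad dt t1; have d1 := le_trans dt t1.
have t01 : 0 <= t <= 1 by rewrite t1 (le_trans a0)// (le_trans ad).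
have ba := box1_adm a0 ad dt; have bd := boxd_adm a0 ad dt d1.
have bz := admissibleZ (f a) ba.
rewrite boxf_eq (gLSD al01 alb bz bd hg t01) (gLSZ al01 alb (f a) ba hg t01).
rewrite (gLS_box1 hg a0 ad dt t1) addrAC subrr add0r.
apply: le_trans (normr_gLS_le al01 alb bd hg t01) _.
rewrite /gLS_const -[leRHS]mulrA; apply: ler_wpM2l.
  rewrite mulr_ge0 ?invr_ge0 ?(ltW be_gt0)//.
  exact: (le_trans (normr_ge0 (fder g 0 0)) (fderiv_le al01 alb hg (lexx 0) (lexx 0) ler01)).
rewrite -lee_fin fineK; last first.
  rewrite ge0_fin_numE; first by case: bd.
  by apply: integral_ge0 => s _; rewrite adde_ge0 ?mfrac_ge0// lee_fin divr_ge0 ?powR_ge0.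
apply: le_trans (@normW_box R al al01 a d (L * (d - a)) L _ a0 ad _ (hM a0 ad d1) (hL a0 ad d1) L0 t dt) _.
  exact: measurable_funB.
rewrite lee_fin -[leRHS]mulrA ler_wpM2l ?divr_ge0 ?mulr_ge0 ?(ltW al0) ?subr_ge0 ?(ltW al1)//.
have h1 : 0 <= d - a by rewrite subr_ge0.
have h2 : 0 < 2 - al by rewrite subr_gt0 (lt_trans al1)// ltr1n.
rewrite -mulrA (_ : 1 - al = 2 - al - 1); last by ring.
by rewrite (mulr_powRB1 h1 h2); lra.
Qed.

Lemma gLS_box_chasles C g a c d t : holder01 C g -> 0 <= a -> a <= c -> c <= d -> d <= t -> t <= 1 ->
  gLS (box a d f) g t = gLS (box a c f) g t + gLS (box c d f) g t.
Proof.
move=> hg a0 ac cd dt t1; have d1 := le_trans dt t1.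
have t01 : 0 <= t <= 1 by rewrite t1 (le_trans a0)// (le_trans ac)// (le_trans cd).
have c0 := le_trans a0 ac.
have -> : box a d f = (fun x => box a c f x + box c d f x).
  apply/funext => x; rewrite /box.
  have [xa|ax] := leP x a => /=.
    by rewrite [c < x]ltNge (le_trans xa)//= addr0.
  have [xc|cx] := leP x c => /=; last by rewrite add0r.
  by rewrite (le_trans xc cd) addr0.
apply: (gLSD al01 alb _ _ hg t01); last exact: admissible_box_lip.
by apply: admissible_box_lip => //; [exact: le_trans dt|exact: le_trans d1].
Qed.

End lipschitz.
End gLS_box.

(** * Sewing, estimates of the exponential, and the bond path *)

(** Cutting [[x, y]] into [n + 1] equal pieces bounds the whole increment by a multiple of
    [(n + 1)^(1 - p)], which tends to 0. *)
Lemma sewing_const (R : realType) (F : R -> R) (T K p : R) : 1 < p ->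
  (forall x y, 0 <= x -> x <= y -> y <= T -> `|F y - F x| <= K * (y - x) `^ p) ->
  forall x y, 0 <= x -> x <= y -> y <= T -> F y = F x.
Proof.
move=> p1 H x y x0 xy yT; apply/eqP; rewrite -subr_eq0 -normr_le0.
have yx0 : 0 <= y - x by rewrite subr_ge0.
pose B := K * (y - x) `^ p.
have Hn (n : nat) : `|F y - F x| <= B * (n.+1%:R^-1) `^ (p - 1).
  pose u k := x + (y - x) * (k%:R / n.+1%:R).
  have u0 : u 0%N = x by rewrite /u mul0r mulr0 addr0.
  have un : u n.+1 = y by rewrite /u divff ?pnatr_eq0// mulr1 addrC subrK.
  have nd i j : (i <= j)%N -> u i <= u j.
    by move=> ij; rewrite /u lerD2l ler_wpM2l// ler_pM2r ?ler_nat// invr_gt0 ltr0n.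
  rewrite -{1}un -{1}u0 -(telescope_sumr (fun k => F (u k)) (leq0n _)).
  apply: le_trans (ler_norm_sum _ _ _) _.
  have -> : B * n.+1%:R^-1 `^ (p - 1) = \sum_(0 <= k < n.+1) (K * ((y - x) * n.+1%:R^-1) `^ p).
    rewrite sumr_const_nat subn0 powRM// -[RHS]mulr_natr /B.
    have n0 : 0 < n.+1%:R^-1 :> R by rewrite invr_gt0 ltr0n.
    rewrite -(mulr_powRB1 (ltW n0) (lt_trans ltr01 p1)).
    by field; rewrite ?nat1r ?natr1 pnatr_eq0.
  rewrite big_nat_cond [leRHS]big_nat_cond; apply: ler_sum => k; rewrite andbT => /andP[_ kn].
  have -> : (y - x) * n.+1%:R^-1 = u k.+1 - u k.
    by rewrite /u -natr1; ring.
  apply: H; last by apply: le_trans yT; rewrite -[leRHS]un; exact: nd.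
    by rewrite (le_trans x0)// -[leLHS]u0 nd.
  exact: nd.
have c1 : B * (n.+1%:R^-1) `^ (p - 1) @[n --> \oo] --> (0 : R).
  rewrite -(mulr0 B); apply: cvgMl_tmp.
  have := powR_cvg0 (_ : 0 < p - 1); rewrite subr_gt0 => /(_ p1) /cvg_at_rightP; apply; split => [n|].
    by rewrite invr_gt0 ltr0n.
  exact: cvg_harmonic.
apply/ler_addgt0Pl => e e0; rewrite addr0.
have /cvgrPdist_lt/(_ _ e0)[N _ /(_ N (leqnn N))] := c1.
by rewrite /= sub0r normrN => h; exact: (le_trans (Hn N) (le_trans (ler_norm _) (ltW h))).
Qed.

Lemma expR_second_order (R : realType) (h : R) : `|expR h - 1 - h| <= h ^+ 2 * expR `|h|.
Proof.
have h1 : 0 <= expR h - 1 - h by have := expR_ge1Dx h; lra.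
have h2 : expR h - 1 <= h * expR h.
  have := expR_ge1Dx (- h) => /(ler_wpM2l (expR_ge0 h)).
  by rewrite -expRD subrr expR0; lra.
rewrite ger0_norm//; apply: (@le_trans _ _ (h * (expR h - 1))); first by lra.
have [h0|h0] := leP 0 h.
  by rewrite ger0_norm// expr2 -mulrA ler_wpM2l//; lra.
have e1 : 1 <= expR `|h| by rewrite -expR0 ler_expR.
have : h * (expR h - 1) <= h ^+ 2.
  by rewrite expr2 ler_nM2l// lerBrDl expR_ge1Dx.
by move=> /le_trans; apply; rewrite ler_peMr// sqr_ge0.
Qed.

Lemma expR_lip (R : realType) (c u v : R) : u <= c -> v <= c -> `|expR u - expR v| <= expR c * `|u - v|.
Proof.
wlog uv : u v / v <= u.
  move=> H uc vc; have [|/ltW] := leP v u => h; first exact: H.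
  by rewrite distrC (distrC u); exact: H.
move=> uc _; rewrite !ger0_norm ?subr_ge0 ?ler_expR//.
apply: (@le_trans _ _ (expR u * (u - v))); last first.
  by rewrite ler_wpM2r ?subr_ge0 ?ler_expR.
have E : expR u * expR (v - u) = expR v by rewrite -expRD addrC subrK.
have := expR_ge1Dx (v - u) => /(ler_wpM2l (expR_ge0 u)); rewrite E; lra.
Qed.

Lemma subr_swap (R : realType) (p q r s : R) : p - q = r - s -> p - r = q - s.
Proof. lra. Qed.

Lemma subrBB (R : realType) (p q r s : R) : (p - q) - (r - s) = (p - r) - (q - s).
Proof. lra. Qed.

Section clamp.
Context {R : realType}.
Notation leb := (@lebesgue_measure R).

(** Precomposition with this projection extends a path from [[0, 1]] to the line, keeping continuity
    and Lipschitz bounds. *)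
Definition clamp01 (t : R) : R := Num.max 0 (Num.min t 1).

Lemma clamp01_itv t : 0 <= clamp01 t <= 1.
Proof. by rewrite /clamp01 le_max lexx/= ge_max ler01/= ge_min lexx orbT. Qed.

Lemma clamp01_id t : 0 <= t <= 1 -> clamp01 t = t.
Proof. by move=> /andP[t0 t1]; rewrite /clamp01 min_l// max_r. Qed.

Lemma clamp01_lip s t : `|clamp01 s - clamp01 t| <= `|s - t|.
Proof.
wlog st : s t / s <= t.
  move=> H; have [|/ltW] := leP s t => h; first exact: H.
  by rewrite distrC (distrC s); exact: H.
have h1 : s - t <= 0 by rewrite subr_le0.
rewrite (ler0_norm h1) /clamp01.
have [h2|h2] := leP s 1; have [h3|h3] := leP t 1;
have [h4|h4] := leP 0 s; have [h5|h5] := leP 0 t;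
rewrite ?(max_r (@ler01 R)) ?subrr ?normr0 ?ler0_norm; lra.
Qed.

Lemma measurable_clamp01 : measurable_fun setT (clamp01).
Proof. by apply: measurable_maxr => //; exact: measurable_minr. Qed.

Lemma measurable_comp_clamp01 (g : R -> R) : measurable_fun (`[0, 1]%classic : set R) g ->
  measurable_fun setT (g \o clamp01).
Proof.
move=> mg; apply: (measurable_comp _ _ mg measurable_clamp01) => //.
by move=> _ [t _ <-]; rewrite /= in_itv/= clamp01_itv.
Qed.

Lemma integrable_bounded01 (f : R -> R) (K : R) : measurable_fun (`[0, 1]%classic : set R) f ->
  (forall s, 0 <= s <= 1 -> `|f s| <= K) -> leb.-integrable `[0, 1] (EFin \o f).
Proof.
move=> mf fK; apply: measurable_bounded_integrable => //.
  by rewrite /= lebesgue_measure_itv/= lte_fin ltr01 -EFinB ltry.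
exists K; split; first exact: num_real.
by move=> M KM s; rewrite /= in_itv/= => /fK h; rewrite (le_trans h)// ltW.
Qed.

Lemma integrable_sub01 (f : R -> R) x y : leb.-integrable `[0, 1] (EFin \o f) -> 0 <= x -> y <= 1 ->
  leb.-integrable `[x, y] (EFin \o f).
Proof.
move=> jf x0 y1; apply: integrableS jf => // u; rewrite /= !in_itv/= => /andP[h1 h2].
by rewrite (le_trans x0 h1) (le_trans h2 y1).
Qed.

Lemma Rintegral_chasles_oc (f : R -> R) x y : leb.-integrable `[0, 1] (EFin \o f) ->
  0 <= x -> x <= y -> y <= 1 ->
  \int[leb]_(u in `[0, y]) f u - \int[leb]_(u in `[0, x]) f u = \int[leb]_(u in `]x, y]) f u.
Proof.
move=> jf x0 xy y1; apply: Rintegral_itvB; rewrite ?bnd_simp//.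
exact: (integrable_sub01 jf (lexx 0) y1).
Qed.

Lemma Rintegral_chasles (f : R -> R) x y : leb.-integrable `[0, 1] (EFin \o f) ->
  0 <= x -> x <= y -> y <= 1 ->
  \int[leb]_(u in `[0, y]) f u - \int[leb]_(u in `[0, x]) f u = \int[leb]_(u in `[x, y]) f u.
Proof.
move=> jf x0 xy y1; rewrite Rintegral_chasles_oc//; apply: Rintegral_itv_obnd_cbnd.
by apply: integrableS (integrable_sub01 jf x0 y1) => //; exact: subset_itv_oc_cc.
Qed.

Lemma normr_Rintegral_bound (f : R -> R) x y K : leb.-integrable `[0, 1] (EFin \o f) ->
  0 <= x -> x <= y -> y <= 1 -> (forall u, x <= u <= y -> `|f u| <= K) ->
  `|\int[leb]_(u in `[x, y]) f u| <= K * (y - x).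
Proof.
move=> jf x0 xy y1 fK; have jxy := integrable_sub01 jf x0 y1.
apply: le_trans (le_normr_Rintegral _ jxy) _ => //.
have -> : K * (y - x) = \int[leb]_(u in `[x, y]) K.
  rewrite Rintegral_cst//= lebesgue_measure_itv/= lte_fin.
  by case: ltP => //= yx; rewrite (_ : y = x) ?subrr//; apply/eqP; rewrite eq_le yx xy.
apply: le_Rintegral => //; first exact: integrable_norm.
have : leb.-integrable `[0, 1] (EFin \o cst K).
  by apply: (@integrable_bounded01 _ `|K|).
by move=> /integrable_sub01; exact.
Qed.

End clamp.

Section bond_path.
Context {R : realType}.
Notation leb := (@lebesgue_measure R).
Variables (rr : R -> R) (Cr : R).
Hypothesis mrr : measurable_fun (`[0, 1]%classic : set R) rr.
Hypothesis hrr : forall s, 0 <= s <= 1 -> `|rr s| <= Cr.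

Definition logbond (t : R) : R := \int[leb]_(s in `[0, clamp01 t]) rr s.
Definition bondp (t : R) : R := expR (logbond t).

Lemma rate_bound_ge0 : 0 <= Cr.
Proof. by apply: le_trans (hrr (_ : 0 <= 0 <= 1)); rewrite ?lexx ?ler01. Qed.
Let Cr0 := rate_bound_ge0.

Lemma integrable_rate : leb.-integrable `[0, 1] (EFin \o rr).
Proof. exact: integrable_bounded01 mrr hrr. Qed.

Lemma logbondB x y : 0 <= x -> x <= y -> y <= 1 ->
  logbond y - logbond x = \int[leb]_(s in `[x, y]) rr s.
Proof.
move=> x0 xy y1; rewrite /logbond !clamp01_id; [exact: Rintegral_chasles integrable_rate _ _ _|..].
  by rewrite x0 (le_trans xy).
by rewrite y1 (le_trans x0).
Qed.

Lemma logbond_lip x y : 0 <= x -> x <= y -> y <= 1 -> `|logbond y - logbond x| <= Cr * (y - x).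
Proof.
move=> x0 xy y1; rewrite logbondB//; apply: normr_Rintegral_bound => //; first exact: integrable_rate.
by move=> u /andP[xu uy]; apply: hrr; rewrite (le_trans x0 xu) (le_trans uy y1).
Qed.

Lemma logbond_clamp t : logbond (clamp01 t) = logbond t.
Proof. by rewrite /logbond (clamp01_id (clamp01_itv t)). Qed.

Lemma logbond0 : logbond 0 = 0.
Proof. by rewrite /logbond clamp01_id ?lexx ?ler01// set_itv1 Rintegral_set1. Qed.

Lemma logbond_lipT x y : `|logbond y - logbond x| <= Cr * `|y - x|.
Proof.
apply: (@le_trans _ _ (Cr * `|clamp01 y - clamp01 x|)); last by rewrite ler_wpM2l// clamp01_lip.
rewrite -(logbond_clamp x) -(logbond_clamp y).
have /andP[x0 x1] := clamp01_itv x; have /andP[y0 y1] := clamp01_itv y.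
have [xy|/ltW yx] := leP (clamp01 x) (clamp01 y).
  by rewrite [X in _ * X]ger0_norm ?subr_ge0//; exact: logbond_lip.
by rewrite distrC [X in _ * X]distrC [X in _ * X]ger0_norm ?subr_ge0//; exact: logbond_lip.
Qed.

Lemma normr_logbond t : `|logbond t| <= Cr.
Proof.
rewrite -logbond_clamp; have /andP[t0 t1] := clamp01_itv t.
have := logbond_lip (lexx 0) t0 t1; rewrite logbond0 !subr0 => /le_trans; apply.
by rewrite ler_piMr.
Qed.

Lemma bondp_gt0 t : 0 < bondp t. Proof. exact: expR_gt0. Qed.

Lemma bondp_le t : bondp t <= expR Cr.
Proof. by rewrite ler_expR (le_trans (ler_norm _))// normr_logbond. Qed.

Lemma bondp0 : bondp 0 = 1.
Proof. by rewrite /bondp logbond0 expR0. Qed.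

Lemma bondp_lip x y : `|bondp x - bondp y| <= (expR Cr * Cr) * `|x - y|.
Proof.
apply: le_trans (expR_lip (c := Cr) _ _) _.
- by rewrite (le_trans (ler_norm _))// normr_logbond.
- by rewrite (le_trans (ler_norm _))// normr_logbond.
- by rewrite -mulrA ler_wpM2l ?expR_ge0// logbond_lipT.
Qed.

Lemma lipschitz_continuous_real (f : R -> R) K : (forall x y, `|f x - f y| <= K * `|x - y|) ->
  continuous f.
Proof.
move=> fK x; apply/cvgrPdist_lt => e e0.
have K0 : 0 <= K by have := fK 0 1; rewrite sub0r normrN normr1 mulr1; apply: le_trans.
have K1 : 0 < K + 1 by rewrite ltr_wpDl.
exists (e / (K + 1)); first by rewrite /= divr_gt0.
move=> y /=; rewrite ltr_pdivlMr// => h; apply: le_lt_trans (fK _ _) _; apply: le_lt_trans h.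
by rewrite mulrC ler_wpM2l// lerDl.
Qed.

Lemma continuous_logbond : continuous logbond.
Proof. by apply: (@lipschitz_continuous_real _ Cr) => x y; rewrite distrC (distrC x) logbond_lipT. Qed.

Lemma continuous_bondp : continuous bondp.
Proof. exact: (lipschitz_continuous_real bondp_lip). Qed.

Lemma measurable_bondp : measurable_fun setT bondp.
Proof. exact: continuous_measurable_fun continuous_bondp. Qed.

Lemma integrable_rate_mul (f : R -> R) K : measurable_fun (`[0, 1]%classic : set R) f ->
  (forall s, 0 <= s <= 1 -> `|f s| <= K) ->
  leb.-integrable `[0, 1] (EFin \o (fun u => rr u * f u)).
Proof.
move=> mf fK; apply: (@integrable_bounded01 _ _ (Cr * K)); first exact: measurable_funM.
by move=> s hs; rewrite normrM; apply: ler_pM => //; [exact: hrr|exact: fK].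
Qed.

Let bondp_norm t : `|bondp t| <= expR Cr.
Proof. by rewrite gtr0_norm ?bondp_gt0 ?bondp_le. Qed.

Let E0 : 0 <= expR Cr. Proof. exact: expR_ge0. Qed.

Lemma integrable_rate_bondp : leb.-integrable `[0, 1] (EFin \o (fun u => rr u * bondp u)).
Proof.
apply: (@integrable_rate_mul _ (expR Cr)) => //.
by apply: measurable_funTS; exact: measurable_bondp.
Qed.

(** The rate is only measurable, so [logbond] need not be differentiable everywhere. Instead, the
    difference of the two sides has increments of order 2 and is constant by sewing. *)
Lemma bondpB x y : 0 <= x -> x <= y -> y <= 1 ->
  bondp y - bondp x = \int[leb]_(u in `[x, y]) (rr u * bondp u).
Proof.
have jb := integrable_rate_bondp.
pose F x := bondp x - \int[leb]_(u in `[0, x]) (rr u * bondp u).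
suff H u v : 0 <= u -> u <= v -> v <= 1 -> `|F v - F u| <= (expR Cr * Cr ^+ 2 * expR Cr + Cr * (expR Cr * Cr)) * (v - u) `^ 2.
  move=> x0 xy y1; have := sewing_const (_ : 1 < 2) H x0 xy y1; rewrite ltr1n => /(_ isT).
  by move=> /subr_swap ->; exact: (Rintegral_chasles jb x0 xy y1).
move=> u0 uv v1; have vu0 : 0 <= v - u by rewrite subr_ge0.
have -> : F v - F u = (bondp v - bondp u) - \int[leb]_(s in `[u, v]) (rr s * bondp s).
  by rewrite -(Rintegral_chasles jb u0 uv v1); exact: subrBB.
have jr := integrable_sub01 integrable_rate u0 v1.
have jb' := integrable_sub01 jb u0 v1.
have jbu : leb.-integrable `[0, 1] (EFin \o (fun s => rr s * bondp u)).
  by apply: (@integrable_rate_mul (fun=> bondp u) (expR Cr)).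
have E1 : \int[leb]_(s in `[u, v]) (rr s * (bondp s - bondp u)) =
   \int[leb]_(s in `[u, v]) (rr s * bondp s) - bondp u * (logbond v - logbond u).
  have e3 : \int[leb]_(s in `[u, v]) (rr s * bondp u) = \int[leb]_(s in `[u, v]) rr s * bondp u.
    exact: (@RintegralZr _ _ _ leb _ _ _ (measurable_itv _) jr).
  have e4 : \int[leb]_(s in `[u, v]) (rr s * bondp s - rr s * bondp u) =
     \int[leb]_(s in `[u, v]) (rr s * bondp s) - \int[leb]_(s in `[u, v]) (rr s * bondp u).
    exact: (@RintegralB _ _ _ leb _ _ _ (measurable_itv _) jb' (integrable_sub01 jbu u0 v1)).
  rewrite (logbondB u0 uv v1) (mulrC (bondp u)) -e3 -e4.
  by apply: eq_Rintegral => s _; rewrite mulrBr.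
have E2 : bondp u * expR (logbond v - logbond u) = bondp v by rewrite -expRD addrC subrK.
(* The error is the second-order remainder of the exponential minus the integral of the rate against
   the variation of the bond; both are of order [(v - u)^2]. *)
have E3 : bondp v - bondp u - \int[leb]_(s in `[u, v]) (rr s * bondp s) =
  bondp u * (expR (logbond v - logbond u) - 1 - (logbond v - logbond u))
   - \int[leb]_(s in `[u, v]) (rr s * (bondp s - bondp u)).
  have aux (B0 X0 D0 I0 : R) : B0 * X0 - B0 - I0 = B0 * (X0 - 1 - D0) - (I0 - B0 * D0) by ring.
  by rewrite E1 -{1}E2; exact: aux.
rewrite E3.
rewrite powR_mulrn// mulrDl; apply: le_trans (ler_normB _ _) _; apply: lerD.
  rewrite normrM -!mulrA; apply: ler_pM => //.
  apply: le_trans (expR_second_order _) _.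
  have -> : Cr * (Cr * (expR Cr * (v - u) ^+ 2)) = (Cr * (v - u)) ^+ 2 * expR Cr by ring.
  have h := logbond_lip u0 uv v1.
  apply: ler_pM; rewrite ?expR_ge0 ?sqr_ge0//.
    by rewrite -real_normK ?num_real// ler_pXn2r ?nnegrE ?mulr_ge0.
  by rewrite ler_expR (le_trans h)// ler_piMr// lerBlDr (le_trans v1)// lerDl.
have -> : Cr * (expR Cr * Cr) * (v - u) ^+ 2 = Cr * (expR Cr * Cr * (v - u)) * (v - u) by ring.
apply: normr_Rintegral_bound => //.
  apply: (@integrable_rate_mul (fun s => bondp s - bondp u) (expR Cr + expR Cr)).
    by apply: measurable_funB => //; apply: measurable_funTS; exact: measurable_bondp.
  by move=> s _; rewrite (le_trans (ler_normB _ _))// lerD.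
move=> s /andP[us sv]; rewrite normrM; apply: ler_pM => //.
  by apply: hrr; rewrite (le_trans u0 us) (le_trans sv v1).
apply: le_trans (bondp_lip _ _) _; rewrite ler_wpM2l ?mulr_ge0// ger0_norm ?subr_ge0//.
by rewrite lerD2r.
Qed.

End bond_path.

(** * The product rule for the bond and the discounted log price *)

Section asset_path.
Context {R : realType}.
Notation leb := (@lebesgue_measure R).
Variables al b : R.
Hypothesis al01 : 0 < al < 1.
Hypothesis alb : 1 - al < b.
Hypothesis b1 : b <= 1.
Let al0 : 0 < al. Proof. by case/andP: al01. Qed.
Let al1 : al < 1. Proof. by case/andP: al01. Qed.
Let b0 : 0 < b. Proof. by apply: le_lt_trans alb; rewrite subr_ge0 ltW. Qed.
Variables (rr : R -> R) (Cr : R).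
Hypothesis mrr : measurable_fun (`[0, 1]%classic : set R) rr.
Hypothesis hrr : forall s, 0 <= s <= 1 -> `|rr s| <= Cr.
Variables (g : R -> R) (C : R).
Hypothesis hg : holder01 b C g.
Variables (mu sg : R).
Local Notation gLS := (gLS_integral al).
Local Notation bd := (bondp rr).
Let Cr0 : 0 <= Cr := rate_bound_ge0 hrr.
Let C0 : 0 <= C := holder01_ge0 hg.
Let Mb := expR Cr.
Let Mb0 : 0 <= Mb. Proof. exact: expR_ge0. Qed.

(** For [g] the path of [B^H] this is [(ln (S_t / B_t) - ln S0) / sigma], the discounted log price
    in units of [sigma]; [kappa] is the density of its drift. *)
Definition asset (t : R) : R := g t + (mu * t - logbond rr t) / sg.
Definition kappa (u : R) : R := (mu - rr u) / sg.
Definition kappa_bound : R := (`|mu| + Cr) / `|sg|.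
Let Kk := kappa_bound.
Let Kk0 : 0 <= Kk. Proof. by rewrite divr_ge0// addr_ge0. Qed.

Let le_powR1' (x : R) : 0 <= x <= 1 -> x <= x `^ b.
Proof. exact: le_powR1. Qed.

Lemma measurable_kappa : measurable_fun (`[0, 1]%classic : set R) kappa.
Proof. by apply: measurable_funM => //; exact: measurable_funB. Qed.

Lemma kappa_le s : 0 <= s <= 1 -> `|kappa s| <= Kk.
Proof.
move=> hs; rewrite /kappa normrM normfV ler_wpM2r// (le_trans (ler_normB _ _))//.
by rewrite lerD2l hrr.
Qed.

Lemma integrable_kappa : leb.-integrable `[0, 1] (EFin \o kappa).
Proof. exact: integrable_bounded01 measurable_kappa kappa_le. Qed.

Lemma kappa_integral x y : 0 <= x -> x <= y -> y <= 1 ->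
  (mu * y - logbond rr y) / sg - (mu * x - logbond rr x) / sg = \int[leb]_(s in `[x, y]) kappa s.
Proof.
move=> x0 xy y1.
have jr := integrable_sub01 (integrable_rate mrr hrr) x0 y1.
have jm : leb.-integrable `[x, y] (EFin \o (fun=> mu)).
  apply: integrable_sub01 x0 y1; exact: (@integrable_bounded01 _ _ `|mu|).
have e1 : \int[leb]_(s in `[x, y]) (mu - rr s) = mu * (y - x) - \int[leb]_(s in `[x, y]) rr s.
  rewrite (@RintegralB _ _ _ leb _ _ _ (measurable_itv _) jm jr); congr (_ - _).
  rewrite Rintegral_cst//= lebesgue_measure_itv/= lte_fin.
  by case: ltP => //= yx; rewrite (_ : y = x) ?subrr//; apply/eqP; rewrite eq_le yx xy.
have jmr : leb.-integrable `[x, y] (EFin \o (fun s => mu - rr s)).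
  exact: (@integrableB _ _ _ leb _ (measurable_itv _) _ _ jm jr).
have e2 : \int[leb]_(s in `[x, y]) kappa s = \int[leb]_(s in `[x, y]) (mu - rr s) / sg.
  exact: (@RintegralZr _ _ _ leb _ _ _ (measurable_itv _) jmr).
rewrite e2 e1 -(logbondB mrr hrr x0 xy y1).
have aux (p q r s t : R) : (p * q - r) / t - (p * s - r) / t = (p * (q - s) - (r - r)) / t by ring.
have aux2 (p q r r' s t : R) : (p * q - r) / t - (p * s - r') / t = (p * (q - s) - (r - r')) / t by ring.
exact: aux2.
Qed.

Definition asset_const : R := C + Kk.

Lemma asset_holder x y : 0 <= x <= 1 -> 0 <= y <= 1 ->
  `|asset x - asset y| <= asset_const * `|x - y| `^ b.
Proof.
wlog yx : x y / y <= x.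
  move=> H hx hy; have [|/ltW] := leP y x => h; first exact: H.
  by rewrite distrC (distrC x); exact: H.
move=> hx hy; have /andP[x0 x1] := hx; have /andP[y0 y1] := hy.
have -> : asset x - asset y = (g x - g y) + ((mu * x - logbond rr x) / sg - (mu * y - logbond rr y) / sg).
  by rewrite /asset opprD addrACA.
rewrite /asset_const [leRHS]mulrDl; apply: le_trans (ler_normD _ _) _; apply: lerD; first exact: hg.2.
rewrite kappa_integral//; apply: (@le_trans _ _ (Kk * (x - y))).
  apply: normr_Rintegral_bound => //; first exact: integrable_kappa.
  by move=> u /andP[yu ux]; apply: kappa_le; rewrite (le_trans y0 yu) (le_trans ux x1).
rewrite ler_wpM2l// ger0_norm ?subr_ge0//; apply: le_powR1'.
by rewrite subr_ge0 yx/= lerBlDr (le_trans x1)// lerDl.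
Qed.

Lemma measurable_asset : measurable_fun setT asset.
Proof.
apply: measurable_funD; first exact: hg.1.
apply: measurable_funM => //; apply: measurable_funB => //.
exact: continuous_measurable_fun (continuous_logbond mrr hrr).
Qed.

Definition asset_bound : R := `|asset 0| + asset_const.

Lemma asset_le s : 0 <= s <= 1 -> `|asset s| <= asset_bound.
Proof.
move=> hs; have h0 : 0 <= (0 : R) <= 1 by rewrite lexx ler01.
have -> : asset s = asset 0 + (asset s - asset 0) by rewrite addrC subrK.
rewrite (le_trans (ler_normD _ _))// lerD2l (le_trans (asset_holder hs h0))//.
rewrite ler_piMr ?addr_ge0// subr0; case/andP: hs => s0 s1.
by apply: powR_le1; [rewrite normr_ge0 ger0_norm|exact: ltW].
Qed.

Let mbd : measurable_fun (`[0, 1]%classic : set R) bd.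
Proof. by apply: measurable_funTS; exact: measurable_bondp mrr hrr. Qed.
Let bd_norm t : `|bd t| <= Mb.
Proof. by rewrite gtr0_norm ?bondp_gt0// bondp_le. Qed.

Lemma integrable_rate_bond (f : R -> R) K : measurable_fun (`[0, 1]%classic : set R) f ->
  (forall s, 0 <= s <= 1 -> `|f s| <= K) ->
  leb.-integrable `[0, 1] (EFin \o (fun u => rr u * bd u * f u)).
Proof.
move=> mf fK; apply: (@integrable_bounded01 _ _ (Cr * Mb * K)).
  by apply: measurable_funM => //; exact: measurable_funM.
move=> s hs; rewrite !normrM; apply: ler_pM => //; [|exact: fK].
by apply: ler_pM => //; exact: hrr.
Qed.

Lemma integrable_bond_kappa (f : R -> R) K : measurable_fun (`[0, 1]%classic : set R) f ->
  (forall s, 0 <= s <= 1 -> `|f s| <= K) ->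
  leb.-integrable `[0, 1] (EFin \o (fun u => f u * bd u * kappa u)).
Proof.
move=> mf fK; apply: (@integrable_bounded01 _ _ (K * Mb * Kk)).
  by apply: measurable_funM; [exact: measurable_funM|exact: measurable_kappa].
move=> s hs; rewrite normrM; apply: ler_pM; [exact: normr_ge0|exact: normr_ge0| |exact: kappa_le].
by rewrite normrM; apply: ler_pM => //; exact: fK.
Qed.

Let masset : measurable_fun (`[0, 1]%classic : set R) asset.
Proof. by apply: measurable_funTS; exact: measurable_asset. Qed.

(** The absolutely continuous part of [d(bd X) = X d(bd) + bd dX]. The factor 1 shows it as the case
    of constant unit exposure. *)
Let drift1 u := rr u * bd u * asset u + 1 * bd u * kappa u.

Let idrift1 : leb.-integrable `[0, 1] (EFin \o drift1).
Proof.
have i1 := integrable_rate_bond masset asset_le.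
have i2 := @integrable_bond_kappa (cst 1) 1 (@measurable_cst _ _ _ _ _ _) _.
apply: (@integrableD _ _ _ leb _ (measurable_itv _) _ _ i1 (i2 _)).
by move=> s _; rewrite normr1.
Qed.

Let K1 := Cr * Mb * asset_const + (Mb * Cr) * Kk.
Let K2 := gLS_const al b C (Mb * Cr).

Let bdL x y : 0 <= x <= 1 -> 0 <= y <= 1 -> `|bd x - bd y| <= (Mb * Cr) * `|x - y|.
Proof. by move=> _ _; exact: bondp_lip. Qed.

(** The expression equals the integral of [rr bd (X v - X s) + (bd u - bd s) kappa]. Both
    differences are of order [(v - u)^(1 - al)], since [X] is Holder of order [b > 1 - al] and the
    bond is Lipschitz. *)
Let local_drift u v : 0 <= u -> u < v -> v <= 1 ->
  `|bd v * asset v - bd u * asset u - bd u * (g v - g u) - \int[leb]_(s in `[u, v]) drift1 s|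
   <= K1 * (v - u) `^ (2 - al).
Proof.
move=> u0 uv v1; have uv' := ltW uv.
have vu0 : 0 < v - u by rewrite subr_gt0.
have vu1 : v - u <= 1 by rewrite lerBlDr (le_trans v1)// lerDl.
have in01 s : u <= s <= v -> 0 <= s <= 1.
  by move=> /andP[h1 h2]; rewrite (le_trans u0 h1) (le_trans h2 v1).
pose f1 s := rr s * bd s * (asset v - asset s).
pose f2 s := (bd u - bd s) * kappa s.
have i1 : leb.-integrable `[0, 1] (EFin \o f1).
  apply: (@integrable_rate_bond (fun s => asset v - asset s) (`|asset v| + asset_bound)).
    exact: (measurable_funB (measurable_cst (asset v)) masset).
  by move=> s hs; rewrite (le_trans (ler_normB _ _))// lerD2l asset_le.
have i2 : leb.-integrable `[0, 1] (EFin \o f2).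
  apply: (@integrable_bounded01 _ _ ((Mb + Mb) * Kk)).
    exact: (measurable_funM (measurable_funB (measurable_cst (bd u)) mbd) measurable_kappa).
  move=> s hs; rewrite normrM; apply: ler_pM => //; last exact: kappa_le.
  by rewrite (le_trans (ler_normB _ _))// lerD.
have i12 : leb.-integrable `[0, 1] (EFin \o (fun s => f1 s + f2 s)).
  exact: (@integrableD _ _ _ leb _ (measurable_itv _) _ _ i1 i2).
have E : bd v * asset v - bd u * asset u - bd u * (g v - g u) - \int[leb]_(s in `[u, v]) drift1 s =
   \int[leb]_(s in `[u, v]) (f1 s + f2 s).
  have j1 := integrable_sub01 (integrable_rate_bondp mrr hrr) u0 v1.
  have j2 := integrable_sub01 integrable_kappa u0 v1.
  have j3 := integrable_sub01 idrift1 u0 v1.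
  have j4 : leb.-integrable `[u, v] (EFin \o (fun s => asset v * (rr s * bd s))).
    exact: (@integrableZl _ _ R leb _ (measurable_itv _) _ _ j1).
  have j5 : leb.-integrable `[u, v] (EFin \o (fun s => bd u * kappa s)).
    exact: (@integrableZl _ _ R leb _ (measurable_itv _) _ _ j2).
  have j6 : leb.-integrable `[u, v] (EFin \o (fun s => asset v * (rr s * bd s) + bd u * kappa s)).
    exact: (@integrableD _ _ R leb _ (measurable_itv _) _ _ j4 j5).
  transitivity (\int[leb]_(s in `[u, v]) ((asset v * (rr s * bd s) + bd u * kappa s) - drift1 s)).
    rewrite (@RintegralB _ _ _ leb _ _ _ (measurable_itv _) j6 j3); congr (_ - _).
    rewrite (@RintegralD _ _ _ leb _ _ _ (measurable_itv _) j4 j5).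
    rewrite (@RintegralZl _ _ _ leb _ _ _ (measurable_itv _) j1) (@RintegralZl _ _ _ leb _ _ _ (measurable_itv _) j2).
    rewrite -(bondpB mrr hrr u0 uv' v1) -(kappa_integral u0 uv' v1).
    have aux (bv bu gu gv lu lv : R) : bv * (gv + lv) - bu * (gu + lu) - bu * (gv - gu) =
       (gv + lv) * (bv - bu) + bu * (lv - lu) by ring.
    exact: aux.
  apply: eq_Rintegral => s _; rewrite /drift1 /f1 /f2.
  have aux (av r bs bu k as_ : R) : av * (r * bs) + bu * k - (r * bs * as_ + 1 * bs * k) =
     r * bs * (av - as_) + (bu - bs) * k by ring.
  exact: aux.
rewrite E.
have -> : K1 * (v - u) `^ (2 - al) = K1 * (v - u) `^ (1 - al) * (v - u).
  have h2 : 0 < 2 - al by rewrite subr_gt0 (lt_trans al1)// ltr1n.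
  rewrite -(mulr_powRB1 (ltW vu0) h2) -mulrA (mulrC (v - u)).
  by congr (_ * (_ `^ _ * _)); ring.
apply: normr_Rintegral_bound => // s us; have /andP[h1 h2] := us.
have sv0 : 0 <= v - s by rewrite subr_ge0.
rewrite (le_trans (ler_normD _ _))// /K1 mulrDl; apply: lerD.
  rewrite /f1 !normrM -[X in _ <= X]mulrA; apply: ler_pM; rewrite ?mulr_ge0//.
    by apply: ler_pM => //; apply: hrr; exact: in01.
  apply: le_trans (asset_holder _ _) _; [by apply: in01; rewrite uv' lexx|exact: in01|].
  rewrite ler_wpM2l ?addr_ge0// ger0_norm//.
  apply: (@le_trans _ _ ((v - u) `^ b)).
    by apply: ge0_ler_powR; rewrite ?nnegrE ?(ltW b0) ?(ltW vu0)// lerD2l lerN2.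
  by apply: ger_powR; [rewrite vu0|exact: ltW].
rewrite /f2 normrM -[X in _ <= X]mulrA mulrCA -[X in _ <= X]mulrCA.
rewrite (mulrC Kk) mulrA; apply: ler_pM => //; last by apply: kappa_le; exact: in01.
apply: le_trans (bondp_lip mrr hrr _ _) _; rewrite ler_wpM2l ?mulr_ge0// distrC ger0_norm ?subr_ge0//.
apply: (@le_trans _ _ (v - u)); first by rewrite lerD2r.
rewrite -[leLHS]powRr1 ?(ltW vu0)//; apply: ger_powR; first by rewrite vu0.
by rewrite gerBl ltW.
Qed.

(** [F] is the gap between both sides. In its increments the first-order term [bd u (g v - g u)] of
    [local_drift] cancels with that of [gLS_box_local], leaving order [2 - al > 1]; sewing makes [F]
    constant. *)
Lemma path_piece a d t : 0 <= a -> a <= d -> d <= t -> t <= 1 ->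
  bd d * asset d - bd a * asset a =
  \int[leb]_(s in `[a, d]) (rr s * bd s * asset s + 1 * bd s * kappa s) + gLS (box a d bd) g t.
Proof.
move=> a0 ad dt t1.
have mb : measurable_fun setT bd := measurable_bondp mrr hrr.
pose F u := bd u * asset u - \int[leb]_(s in `[0, u]) drift1 s - gLS (box 0 u bd) g t.
have H u v : 0 <= u -> u <= v -> v <= t -> `|F v - F u| <= (K1 + K2) * (v - u) `^ (2 - al).
  move=> u0; rewrite le_eqVlt => /predU1P[<- _|uv vt].
    by rewrite !subrr normr0 powR0 ?mulr0// subr_eq0 gt_eqF// (lt_trans al1)// ltr1n.
  have v1 := le_trans vt t1.
  have -> : F v - F u = (bd v * asset v - bd u * asset u - bd u * (g v - g u) - \int[leb]_(s in `[u, v]) drift1 s)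
      - (gLS (box u v bd) g t - bd u * (g v - g u)).
    rewrite /F (gLS_box_chasles al01 alb mb bdL hg (lexx 0) u0 (ltW uv) vt t1).
    rewrite -(Rintegral_chasles idrift1 u0 (ltW uv) v1).
    have aux (p p' i i' l l' q : R) : p - i - (l' + l) - (p' - i' - l') = p - p' - q - (i - i') - (l - q) by ring.
    exact: aux.
  rewrite mulrDl; apply: le_trans (ler_normB _ _) _; apply: lerD; first exact: local_drift.
  exact: (gLS_box_local al01 alb b1 mb bdL hg u0 (ltW uv) vt t1).
have p1 : 1 < 2 - al by rewrite ltrBrDr -ltrBrDl (_ : 2 - 1 = 1)//; ring.
have := sewing_const p1 H a0 ad dt.
rewrite /F (gLS_box_chasles al01 alb mb bdL hg (lexx 0) a0 ad dt t1).
rewrite -(Rintegral_chasles idrift1 a0 ad (le_trans dt t1)).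
have aux (p p' i i' l l' : R) : p - i - (l' + l) = p' - i' - l' -> p - p' = i - i' + l by lra.
exact: aux.
Qed.

End asset_path.

Lemma admissible_le (R : realType) (al : R) (f : R -> R) (s t : R) : s <= t ->
  admissible al f t -> admissible al f s.
Proof.
move=> st [mf hf nf]; split=> //.
  by move=> u /andP[u0 us]; apply: hf; rewrite u0 (le_trans us).
apply: le_lt_trans nf; apply: (@ge0_subset_integral _ _ _ (@lebesgue_measure R) _ _ (measurable_itv _) (measurable_itv _)).
- by apply: measurable_funTS; exact: measurable_normW_integrand.
- by move=> u _; rewrite adde_ge0 ?mfrac_ge0// lee_fin divr_ge0 ?powR_ge0.
- by move=> u /=; rewrite !in_itv/= => /andP[-> us]; exact: le_trans us st.
Qed.

Lemma Rintegral_zero (R : realType) (D : set R) :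
  \int[@lebesgue_measure R]_(x in D) (0 : R) = 0.
Proof. by rewrite /Rintegral integral0. Qed.

(** * Gains of piecewise constant exposures *)

Section gains.
Context {R : realType}.
Notation leb := (@lebesgue_measure R).
Variables al b : R.
Hypothesis al01 : 0 < al < 1.
Hypothesis alb : 1 - al < b.
Hypothesis b1 : b <= 1.
Variables (rr : R -> R) (Cr : R).
Hypothesis mrr : measurable_fun (`[0, 1]%classic : set R) rr.
Hypothesis hrr : forall s, 0 <= s <= 1 -> `|rr s| <= Cr.
Variables (g : R -> R) (C : R).
Hypothesis hg : holder01 b C g.
Variables (mu sg : R).
Local Notation gLS := (gLS_integral al).
Local Notation bd := (bondp rr).
Local Notation kap := (kappa rr mu sg).
Local Notation X := (asset rr g mu sg).
Implicit Types (ph W : R -> R) (a d t v c : R).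

Definition drift ph W u : R := rr u * bd u * W u + ph u * bd u * kap u.

(** [W] is a discounted wealth and [ph] the exposure to [X]: formally [dW = ph dX], stated for the
    undiscounted [bd W] as in the self-financing condition. The relation is linear in the pair. *)
Definition gain ph W : Prop :=
  [/\ forall t, 0 <= t <= 1 -> admissible al (fun u => ph u * bd u) t,
      leb.-integrable `[0, 1] (EFin \o drift ph W) &
      forall t, 0 <= t <= 1 ->
        bd t * W t - W 0 = \int[leb]_(u in `[0, t]) drift ph W u + gLS (fun u => ph u * bd u) g t].

Lemma gainD ph1 ph2 W1 W2 : gain ph1 W1 -> gain ph2 W2 ->
  gain (fun u => ph1 u + ph2 u) (fun u => W1 u + W2 u).
Proof.
move=> [a1 i1 e1] [a2 i2 e2].
have Ef : (fun u => (ph1 u + ph2 u) * bd u) = (fun u => ph1 u * bd u + ph2 u * bd u).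
  by apply/funext => u; rewrite mulrDl.
have Ed : drift (fun u => ph1 u + ph2 u) (fun u => W1 u + W2 u) = (fun u => drift ph1 W1 u + drift ph2 W2 u).
  by apply/funext => u; rewrite /drift; ring.
rewrite /gain Ef Ed; split.
- by move=> t ht; apply: admissibleD; [exact: a1|exact: a2].
- exact: (@integrableD _ _ _ leb _ (measurable_itv _) _ _ i1 i2).
- move=> t ht; have /andP[t0 t1] := ht.
  rewrite (gLSD al01 alb (a1 _ ht) (a2 _ ht) hg ht).
  rewrite (@RintegralD _ _ _ leb _ _ _ (measurable_itv _) (integrable_sub01 i1 (lexx 0) t1) (integrable_sub01 i2 (lexx 0) t1)).
  have aux (B p q p0 q0 j k l m : R) : B * p - p0 = j + l -> B * q - q0 = k + m ->
     B * (p + q) - (p0 + q0) = j + k + (l + m).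
    by move=> h1 h2; rewrite addrACA -h1 -h2; ring.
  by apply: aux; [exact: e1|exact: e2].
Qed.

Lemma gainZ c ph W : gain ph W -> gain (fun u => c * ph u) (fun u => c * W u).
Proof.
move=> [a1 i1 e1].
have Ef : (fun u => (c * ph u) * bd u) = (fun u => c * (ph u * bd u)).
  by apply/funext => u; rewrite mulrA.
have Ed : drift (fun u => c * ph u) (fun u => c * W u) = (fun u => c * drift ph W u).
  by apply/funext => u; rewrite /drift; ring.
rewrite /gain Ef Ed; split.
- by move=> t ht; apply: admissibleZ; exact: a1.
- exact: (@integrableZl _ _ R leb _ (measurable_itv _) _ _ i1).
- move=> t ht; have /andP[t0 t1] := ht.
  rewrite (gLSZ al01 alb c (a1 _ ht) hg ht).
  rewrite (@RintegralZl _ _ _ leb _ _ _ (measurable_itv _) (integrable_sub01 i1 (lexx 0) t1)).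
  by rewrite -mulrDr -e1// mulrBr mulrCA.
Qed.

Let mbd01 : measurable_fun (`[0, 1]%classic : set R) bd.
Proof. by apply: measurable_funTS; exact: measurable_bondp mrr hrr. Qed.

Let bd_norm t : `|bd t| <= expR Cr.
Proof. by rewrite gtr0_norm ?bondp_gt0// bondp_le. Qed.

Lemma integrable_drift ph W K K' : measurable_fun setT ph -> measurable_fun setT W ->
  (forall s, 0 <= s <= 1 -> `|ph s| <= K) -> (forall s, 0 <= s <= 1 -> `|W s| <= K') ->
  leb.-integrable `[0, 1] (EFin \o drift ph W).
Proof.
move=> mp mW hp hW.
have i1 := integrable_rate_bond mrr hrr (measurable_funTS mW) hW.
have i2 := integrable_bond_kappa mrr hrr mu sg (measurable_funTS mp) hp.
exact: (@integrableD _ _ _ leb _ (measurable_itv _) _ _ i1 i2).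
Qed.

(** Unit exposure on []a, d]] earns the increment of [X] over the elapsed part of that interval.
    [[0, t]] is cut at [Num.min a t] and [Num.min d t]: [W] is zero, then follows [path_piece], then
    stays constant while only the bond moves. *)
Lemma gain_block a d : 0 <= a -> a <= d -> d <= 1 ->
  gain (box a d (cst 1)) (fun u => X (Num.min u d) - X (Num.min u a)).
Proof.
move=> a0 ad d1.
have mX := measurable_asset mrr hrr hg mu sg.
have mb := measurable_bondp mrr hrr.
have minE (e u t : R) : e < u -> u <= t -> Num.min e t = e.
  by move=> eu ut; rewrite min_l// (le_trans (ltW eu) ut).
set ph := box a d (cst 1); set W := fun u => X (Num.min u d) - X (Num.min u a).
have Ef : (fun u => ph u * bd u) = box a d bd.
  by apply/funext => u; rewrite /ph /box; case: ifP => _; rewrite ?mul1r ?mul0r.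
have mW : measurable_fun setT W.
  by apply: measurable_funB; apply: (measurableT_comp mX); exact: measurable_minr.
have min01 (s e : R) : 0 <= s <= 1 -> 0 <= e -> 0 <= Num.min s e <= 1.
  by move=> /andP[s0 s1] e0; rewrite le_min s0 e0/= ge_min s1.
have hW s : 0 <= s <= 1 -> `|W s| <= asset_bound rr Cr g C mu sg + asset_bound rr Cr g C mu sg.
  move=> hs; rewrite (le_trans (ler_normB _ _))//.
  by apply: lerD; apply: (asset_le al01 alb b1 mrr hrr hg mu sg); apply: min01 => //; exact: le_trans ad.
have n1 (s : R) : 0 <= s <= 1 -> `|cst 1 s| <= 1 :> R by rewrite normr1.
have iD : leb.-integrable `[0, 1] (EFin \o drift ph W).
  apply: (@integrable_drift ph W 1 _ _ mW _ hW); first by apply: measurable_box; exact: measurable_cst.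
  by move=> s _; rewrite /ph /box; case: ifP => _; rewrite ?normr1 ?normr0.
have bdL x y : 0 <= x <= 1 -> 0 <= y <= 1 -> `|bd x - bd y| <= (expR Cr * Cr) * `|x - y|.
  by move=> _ _; exact: bondp_lip.
rewrite /gain Ef; split=> //.
  move=> t /andP[t0 t1]; apply: (admissible_le t1).
  exact: (admissible_box_lip al01 mb bdL a0 ad d1 d1).
move=> t /andP[t0 t1].
pose a' := Num.min a t; pose d' := Num.min d t.
have a'0 : 0 <= a' by rewrite /a' le_min a0.
have a'd' : a' <= d' by rewrite /a' /d' le_min !ge_min ad lexx orbT.
have d't : d' <= t by rewrite /d' ge_min lexx orbT.
have d'0 := le_trans a'0 a'd'; have a't := le_trans a'd' d't.
have d'1 := le_trans d't t1.
have W0 : W 0 = 0 by rewrite /W !min_l ?subrr// (le_trans a0).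
have Wt : W t = X d' - X a' by rewrite /W /d' /a' ![Num.min t _]minC.
have EgLS : gLS (box a d bd) g t = gLS (box a' d' bd) g t.
  apply: (eq_gLS al01) => // x /andP[x0 xt]; rewrite /box; congr (if _ then _ else _).
  by rewrite /a' /d' gt_min le_min xt andbT [t < x]ltNge xt orbF.
have P := path_piece al01 alb b1 mrr hrr hg mu sg a'0 a'd' d't t1.
have I1 : \int[leb]_(u in `[0, a']) drift ph W u = 0.
  transitivity (\int[leb]_(u in `[0, a']) (0 : R)); last first.
    exact: Rintegral_zero.
  apply: eq_Rintegral => u; rewrite inE/= in_itv/= /a' le_min => /and3P[u0 ua ut].
  rewrite /drift /ph /W /box [a < u]ltNge ua (min_l ua) (min_l (le_trans ua ad)).
  by rewrite subrr mulr0 !mul0r addr0.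
have jb := integrable_rate_bondp mrr hrr.
have jb1 := integrable_sub01 jb a'0 d'1.
have jb2 := integrable_sub01 jb d'0 t1.
have j1 : leb.-integrable `[0, 1] (EFin \o (fun s => rr s * bd s * X s + 1 * bd s * kap s)).
  exact: (@integrable_drift (cst 1) X 1 _ (measurable_cst _) mX n1 (asset_le al01 alb b1 mrr hrr hg mu sg)).
have I2 : \int[leb]_(u in `]a', d']) drift ph W u =
   \int[leb]_(s in `[a', d']) (rr s * bd s * X s + 1 * bd s * kap s) - X a' * (bd d' - bd a').
  have j1' := integrable_sub01 j1 a'0 d'1.
  have j2 : leb.-integrable `[a', d'] (EFin \o (fun s => X a' * (rr s * bd s))).
    exact: (@integrableZl _ _ R leb _ (measurable_itv _) _ _ jb1).
  have j3 : leb.-integrable `[a', d'] (EFin \o (fun s => (rr s * bd s * X s + 1 * bd s * kap s) - X a' * (rr s * bd s))).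
    exact: (@integrableB _ _ R leb _ (measurable_itv _) _ _ j1' j2).
  rewrite (bondpB mrr hrr a'0 a'd' d'1) -(@RintegralZl _ _ _ leb _ _ _ (measurable_itv _) jb1).
  rewrite -(@RintegralB _ _ _ leb _ _ _ (measurable_itv _) j1' j2).
  have j3' : leb.-integrable `]a', d'] (EFin \o (fun s => (rr s * bd s * X s + 1 * bd s * kap s) - X a' * (rr s * bd s))).
    exact: (@integrableS _ _ _ leb _ _ _ (measurable_itv _) (measurable_itv _) (@subset_itv_oc_cc _ _ _ _) j3).
  rewrite -(Rintegral_itv_obnd_cbnd j3').
  apply: eq_Rintegral => u; rewrite inE/= in_itv/= {1}/a' {1}/d' gt_min le_min => /andP[h1 /andP[ud ut]].
  have au : a < u by move: h1; rewrite [t < u]ltNge ut orbF.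
  rewrite [a'](minE _ _ _ au ut).
  rewrite /drift /ph /W /box au ud/= (min_l ud) (min_r (ltW au)).
  have aux (p q x y : R) : p * q * (x - y) = p * q * x - y * (p * q) by ring.
  by rewrite aux addrAC.
have I3 : \int[leb]_(u in `]d', t]) drift ph W u = (X d' - X a') * (bd t - bd d').
  rewrite (bondpB mrr hrr d'0 d't t1) -(@RintegralZl _ _ _ leb _ _ _ (measurable_itv _) jb2).
  have j3 : leb.-integrable `[d', t] (EFin \o (fun s => (X d' - X a') * (rr s * bd s))).
    exact: (@integrableZl _ _ R leb _ (measurable_itv _) _ _ jb2).
  have j3' : leb.-integrable `]d', t] (EFin \o (fun s => (X d' - X a') * (rr s * bd s))).
    exact: (@integrableS _ _ _ leb _ _ _ (measurable_itv _) (measurable_itv _) (@subset_itv_oc_cc _ _ _ _) j3).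
  rewrite -(Rintegral_itv_obnd_cbnd j3').
  apply: eq_Rintegral => u; rewrite inE/= in_itv/= {1}/d' gt_min => /andP[h1 ut].
  have du : d < u by move: h1; rewrite [t < u]ltNge ut orbF.
  rewrite [d'](minE _ _ _ du ut) [a'](minE _ _ _ (le_lt_trans ad du) ut).
  rewrite /drift /ph /W /box [u <= d]leNgt du andbF !mul0r addr0.
  by rewrite (min_r (ltW du)) (min_r (ltW (le_lt_trans ad du))) mulrC.
rewrite W0 Wt subr0 EgLS.
have c1 := Rintegral_chasles_oc iD a'0 a'd' d'1.
have c2 := Rintegral_chasles_oc iD d'0 d't t1.
rewrite I1 subr0 in c1; rewrite c1 I2 I3 in c2.
move: c2 P.
have aux (It A G Xd Xa Bd Ba Bt : R) : It - (A - Xa * (Bd - Ba)) = (Xd - Xa) * (Bt - Bd) ->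
   Bd * Xd - Ba * Xa = A + G -> Bt * (Xd - Xa) = It + G.
  move=> h1 h2.
  have -> : It = (Xd - Xa) * (Bt - Bd) + (A - Xa * (Bd - Ba)) by rewrite -h1 subrK.
  have -> : G = Bd * Xd - Ba * Xa - A by rewrite h2 addrC addKr.
  ring.
exact: aux.
Qed.

Lemma gain_zero : gain (cst 0) (cst 0).
Proof.
have := gainZ 0 (gain_block (lexx 0) (lexx 0) ler01).
rewrite (_ : (fun u => 0 * box 0 0 (cst 1) u) = cst 0); last by apply/funext => u; rewrite mul0r.
by rewrite (_ : (fun u => 0 * (X (Num.min u 0) - X (Num.min u 0))) = cst 0)//; apply/funext => u; rewrite mul0r.
Qed.

(** A portfolio of bonds alone; that the zero exposure has zero integral is read off [gain_zero]. *)
Lemma gain_cst v : gain (cst 0) (cst v).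
Proof.
have [az iz ez] := gain_zero.
have iD : leb.-integrable `[0, 1] (EFin \o drift (cst 0) (cst v)).
  apply: (@integrable_drift (cst 0) (cst v) 0 `|v|) => //.
  by move=> s _; rewrite normr0.
split=> // t ht; have /andP[t0 t1] := ht.
have := ez t ht; rewrite /cst mulr0 subrr.
have -> : \int[leb]_(u in `[0, t]) drift (cst 0) (cst 0) u = 0.
  transitivity (\int[leb]_(u in `[0, t]) (0 : R)); last exact: Rintegral_zero.
  by apply: eq_Rintegral => u _; rewrite /drift /cst !mulr0 !mul0r addr0.
rewrite add0r => <-; rewrite addr0.
have jb := integrable_sub01 (integrable_rate_bondp mrr hrr) (lexx 0) t1.
transitivity (\int[leb]_(u in `[0, t]) (v * (rr u * bd u))).
  rewrite (@RintegralZl _ _ _ leb _ _ _ (measurable_itv _) jb) -(bondpB mrr hrr (lexx 0) t0 t1) bondp0.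
  by rewrite mulrBr mulr1 mulrC.
by apply: eq_Rintegral => u _; rewrite /drift /cst !mul0r addr0 mulrC.
Qed.

Lemma gain_sum (I : Type) (s : seq I) (ph W : I -> R -> R) (c : I -> R) :
  (forall i, gain (ph i) (W i)) ->
  gain (fun u => \sum_(i <- s) c i * ph i u) (fun u => \sum_(i <- s) c i * W i u).
Proof.
move=> H; elim: s => [|i s IH].
  rewrite (_ : (fun u => \sum_(i <- [::]) c i * ph i u) = cst 0); last by apply/funext => u; rewrite big_nil.
  rewrite (_ : (fun u => \sum_(i <- [::]) c i * W i u) = cst 0); last by apply/funext => u; rewrite big_nil.
  exact: gain_zero.
rewrite (_ : (fun u => \sum_(j <- i :: s) c j * ph j u) = (fun u => c i * ph i u + \sum_(j <- s) c j * ph j u)); last first.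
  by apply/funext => u; rewrite big_cons.
rewrite (_ : (fun u => \sum_(j <- i :: s) c j * W j u) = (fun u => c i * W i u + \sum_(j <- s) c j * W j u)); last first.
  by apply/funext => u; rewrite big_cons.
exact: (gainD (gainZ (c i) (H i)) IH).
Qed.

End gains.

(** * Gaussian small balls and tails *)

Section normal_law.
Context {R : realType}.
Local Notation leb := (@lebesgue_measure R).

Lemma integral_normal_prob (m s : R) (f : R -> \bar R) : s != 0 ->
  (normal_prob m s).-integrable setT f ->
  (\int[normal_prob m s]_x f x = \int[leb]_x (f x * (normal_pdf m s x)%:E))%E.
Proof.
move=> s0 fi.
rewrite -(Radon_Nikodym_change_of_variables (normal_prob_dominates m s))//=.
have mf : measurable_fun setT f by exact: measurable_int fi.
apply: ae_eq_integral => //.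
- apply: emeasurable_funM => //; apply: (measurable_int leb).
  by apply: Radon_Nikodym_integrable; exact: normal_prob_dominates.
- apply: emeasurable_funM => //=; apply/measurableT_comp => //=.
  exact: measurable_normal_pdf.
- apply: ae_eqe_mul2l => /=.
  rewrite Radon_NikodymE//=; first exact: normal_prob_dominates.
  move=> abmu.
  case: cid => /= h [h1 h2 h3].
  apply: integral_ae_eq => //=.
  + by apply/measurable_EFinP; exact: measurable_normal_pdf.
  + by move=> E E01 mE; rewrite -h3.
Qed.

Lemma normal_peak_double (s : R) : normal_peak (2 * s) = normal_peak s / 2.
Proof.
rewrite /normal_peak.
have -> : (2 * s) ^+ 2 * pi *+ 2 = 2 ^+ 2 * (s ^+ 2 * pi *+ 2) :> R by ring.
by rewrite sqrtrM ?sqr_ge0// sqrtr_sqr ger0_norm// invfM mulrC.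
Qed.

Lemma normal_peak_le (s : R) : 0 < s -> normal_peak s <= s^-1.
Proof.
move=> s0; rewrite /normal_peak lef_pV2 ?posrE//; last first.
  by rewrite sqrtr_gt0 mulrn_wgt0// mulr_gt0 ?pi_gt0// exprn_gt0.
rewrite -[leLHS](ger0_norm (ltW s0)) -sqrtr_sqr.
apply: ler_wsqrtr; rewrite -mulrnAr ler_peMr ?sqr_ge0//.
have := @pi_ge2 R; lra.
Qed.

Definition moment_const (q : nat) : R := 2 * (4 * q%:R) ^+ q.

(* [t ^ q e^(-t/2) <= (4q)^q e^(-t/4)], since [e^(t/4) >= (t/(4q))^q] *)
Lemma normal_pdf_moment (m s x : R) (q : nat) : 0 < s -> (0 < q)%N ->
  normal_pdf m s x * (`|x - m| / s) ^+ (2 * q) <=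
  moment_const q * normal_pdf m (2 * s) x.
Proof.
move=> s0 q0.
have s20 : 2 * s != 0 by rewrite mulf_neq0// gt_eqF.
rewrite !normal_pdfE ?gt_eqF ?mulr_gt0//= /normal_fun normal_peak_double.
set t := (`|x - m| / s) ^+ 2.
have t0 : 0 <= t by exact: sqr_ge0.
have -> : - (x - m) ^+ 2 / (s ^+ 2 *+ 2) = - (t / 4) - t / 4.
  by rewrite /t expr_div_n real_normK ?num_real//; field; rewrite gt_eqF.
have -> : - (x - m) ^+ 2 / ((2 * s) ^+ 2 *+ 2) = - (t / 8).
  by rewrite /t expr_div_n real_normK ?num_real//; field; rewrite gt_eqF.
have key : t ^+ q * expR (- (t / 4)) <= (4 * q%:R) ^+ q.
  have q1 : 0 < q%:R :> R by rewrite ltr0n.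
  rewrite expRN -ler_pdivlMr ?invr_gt0 ?expR_gt0// invrK.
  have q4 : 0 < 4 * q%:R :> R by rewrite mulr_gt0.
  set z := t / (4 * q%:R).
  have z0 : 0 <= z by rewrite divr_ge0 ?(ltW q4).
  have -> : t / 4 = q%:R * z by rewrite /z; field; rewrite gt_eqF.
  have -> : t = (4 * q%:R) * z by rewrite /z; field; rewrite gt_eqF.
  rewrite expRM_natl exprMn ler_wpM2l ?exprn_ge0 ?(ltW q4)//.
  rewrite lerXn2r ?nnegrE ?expR_ge0//.
  by apply: le_trans (expR_ge1Dx _); rewrite lerDr.
rewrite exprM -/t expRD.
have p0 : 0 <= normal_peak s by exact: normal_peak_ge0.
have e1 : expR (- (t / 4)) <= expR (- (t / 8)) by rewrite ler_expR; lra.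
have e0 : 0 <= expR (- (t / 4)) by exact: expR_ge0.
have tq : 0 <= t ^+ q by exact: exprn_ge0.
rewrite /moment_const.
have c0 : 0 <= (4 * q%:R) ^+ q :> R by rewrite exprn_ge0// mulr_ge0.
have aux (p a b k e : R) : 0 <= p -> 0 <= a -> 0 <= k -> a <= b -> e * a <= k ->
    p * (a * a) * e <= 2 * k * (p / 2 * b).
  move=> p0' a0' k0' ab ek.
  have -> : p * (a * a) * e = p * (e * a * a) by ring.
  have -> : 2 * k * (p / 2 * b) = p * (k * b) by field.
  by rewrite ler_wpM2l//; apply: (le_trans (y := k * a)); rewrite ?ler_wpM2r ?ler_wpM2l.
exact: aux.
Qed.

Lemma integral_normal_pdf_le (m s : R) (f : R -> R) (k : R) : s != 0 -> 0 <= k ->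
  measurable_fun setT f -> (forall x, 0 <= f x <= k * normal_pdf m s x) ->
  (\int[leb]_x (f x)%:E <= k%:E)%E.
Proof.
move=> s0 k0 mf fk.
apply: (@le_trans _ _ (\int[leb]_x (k%:E * (normal_pdf m s x)%:E))%E).
  apply: ge0_le_integral => //=.
  - by move=> x _; rewrite lee_fin; case/andP: (fk x).
  - exact/measurable_EFinP.
  - apply/measurable_EFinP; apply: measurable_funM => //.
    exact: measurable_normal_pdf.
  - by move=> x _; rewrite -EFinM lee_fin; case/andP: (fk x).
rewrite ge0_integralZl//=.
- by rewrite integral_normal_pdf mule1.
- by apply/measurable_EFinP; exact: measurable_normal_pdf.
- by move=> x _; rewrite lee_fin normal_pdf_ge0.
Qed.

(** The density never exceeds [1 / s]. *)
Lemma normal_prob_itv_le (m s a b : R) : 0 < s -> a <= b ->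
  (normal_prob m s `[a, b] <= ((b - a) / s)%:E)%E.
Proof.
move=> s0 ab; rewrite /normal_prob.
apply: (@le_trans _ _ (\int[leb]_(x in `[a, b]) (s^-1)%:E)%E).
  apply: ge0_le_integral => //=.
  - by move=> x _; rewrite lee_fin normal_pdf_ge0.
  - by apply/measurable_EFinP/measurable_funTS; exact: measurable_normal_pdf.
  - move=> x _; rewrite lee_fin.
    apply: le_trans (normal_peak_le s0).
    by apply: normal_pdf_ub; rewrite gt_eqF.
rewrite integral_cst//= lebesgue_measure_itv/= lte_fin.
case: ltP => [_|ba]; first by rewrite -EFinB -EFinM mulrC.
by rewrite mule0 lee_fin mulr_ge0 ?invr_ge0 ?(ltW s0)// subr_ge0.
Qed.

(** Markov's inequality with the moment of order [2 q]; [normal_pdf_moment] dominates the weighted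
    density by a normal density of doubled scale. *)
Lemma normal_prob_tail_le (m s y : R) (q : nat) : 0 < s -> 0 < y -> (0 < q)%N ->
  (normal_prob m s [set x : R | (y <= `|x - m|)%R] <=
   (moment_const q * (s / y) ^+ (2 * q))%:E)%E.
Proof.
move=> s0 y0 q0; rewrite /normal_prob.
have s20 : 2 * s != 0 by rewrite mulf_neq0// gt_eqF.
set D := [set x | _].
have mD : measurable D.
  have -> : D = (fun x : R => `|x - m|) @^-1` `[y, +oo[.
    by apply/seteqP; split => x /=; rewrite in_itv/= andbT.
  rewrite -[X in measurable X]setTI.
  have mf : measurable_fun setT (fun x : R => `|x - m|).
    by apply: measurableT_comp => //; exact: measurable_funB.
  exact: mf.
have K0 : 0 <= moment_const q by rewrite mulr_ge0// exprn_ge0// mulr_ge0.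
have sy0 : 0 <= (s / y) ^+ (2 * q) by rewrite exprn_ge0// divr_ge0 ?ltW.
rewrite integral_mkcond.
have -> : ((fun x => (normal_pdf m s x)%:E) \_ D)%E =
    EFin \o (fun x => normal_pdf m s x * \1_D x).
  apply/funext => x /=; rewrite patchE indicE; case: ifPn => _; by rewrite ?mulr1 ?mulr0.
apply: (@integral_normal_pdf_le m (2 * s)) => //.
- by rewrite mulr_ge0.
- by apply: measurable_funM => //; exact: measurable_normal_pdf.
move=> x; rewrite mulr_ge0 ?normal_pdf_ge0//=.
rewrite indicE; case: (boolP (x \in D)) => xD; last first.
  by rewrite mulr0 !mulr_ge0// normal_pdf_ge0.
rewrite mulr1 mulrAC.
have yx : y <= `|x - m| by move: xD; rewrite inE.
rewrite -[leLHS]mulr1.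
apply: (@le_trans _ _ (normal_pdf m s x * (`|x - m| / s) ^+ (2 * q) * (s / y) ^+ (2 * q))).
  rewrite -mulrA ler_wpM2l ?normal_pdf_ge0// -exprMn exprn_ege1//.
  by rewrite mulrA divfK ?gt_eqF// ler_pdivlMr// mul1r.
by rewrite ler_wpM2r// normal_pdf_moment.
Qed.

End normal_law.

Section gaussian_estimates.
Context {d : measure_display} {Omega : measurableType d} {R : realType}.
Variable P : probability Omega R.
Variables (X : Omega -> R) (v : R).
Hypothesis mX : measurable_fun setT X.
Hypothesis gX : gaussian_rv P X.
Hypothesis iX : P.-integrable setT (EFin \o X).
Hypothesis iX2 : P.-integrable setT (fun w => (X w ^+ 2)%:E).
Hypothesis EX : (\int[P]_w (X w)%:E = 0)%E.
Hypothesis EX2 : (\int[P]_w (X w ^+ 2)%:E = (v ^+ 2)%:E)%E.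
Hypothesis v0 : 0 < v.

Let mpre (A : set R) : measurable A -> measurable (X @^-1` A).
Proof. by move=> mA; rewrite -[X in measurable X]setTI; exact: mX. Qed.

Let moment2 (m : R) : P.-integrable setT (fun w => ((X w - m) ^+ 2)%:E) /\
  (\int[P]_w ((X w - m) ^+ 2)%:E = (v ^+ 2 + m ^+ 2)%:E)%E.
Proof.
have i1 : P.-integrable setT (fun w => ((- (2 * m))%:E * (X w)%:E)%E).
  exact: (@integrableZl _ _ R P _ measurableT (- (2 * m)) _ iX).
have i2 : P.-integrable setT (fun w => (m ^+ 2)%:E).
  exact: finite_measure_integrable_cst.
have i12 : P.-integrable setT (fun w => ((- (2 * m))%:E * (X w)%:E + (m ^+ 2)%:E)%E).
  exact: (@integrableD _ _ _ P _ measurableT _ _ i1 i2).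
have fE : (fun w => ((X w - m) ^+ 2)%:E) =
    (fun w => (X w ^+ 2)%:E + ((- (2 * m))%:E * (X w)%:E + (m ^+ 2)%:E))%E.
  apply/funext => w; rewrite -EFinM -!EFinD; congr (_%:E).
  have aux (x : R) : (x - m) ^+ 2 = x ^+ 2 + (- (2 * m) * x + m ^+ 2) by ring.
  exact: aux.
rewrite fE; split; first exact: (@integrableD _ _ _ P _ measurableT _ _ iX2 i12).
rewrite (@integralD _ _ _ P _ measurableT _ _ iX2 i12).
rewrite (@integralD _ _ _ P _ measurableT _ _ i1 i2).
rewrite (@integralZl _ _ _ P _ measurableT _ iX) EX mule0 add0e EX2.
rewrite integral_cst// EFinD -[in RHS](mule1 (m ^+ 2)%:E); congr (_ + _ * _)%E; exact: probability_setT.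
Qed.

(** Comparing the parameters with [v] is enough; they need not be identified. The second moment
    gives [v^2 + m^2 <= 8 s^2]. By Chebyshev [[-2 v, 2 v]] has mass at least 3/4, while its normal
    mass is at most [4 v / s], so [s <= 6 v]. Then [m^2 <= 287 v^2 <= (17 v)^2]. *)
Lemma gaussian_scale : exists m s : R, [/\ v / 3 <= s, s <= 6 * v, `|m| <= 17 * v &
  forall A : set R, measurable A -> P (X @^-1` A) = normal_prob m s A].
Proof.
have [m [s [s0 law]]] := gX.
have [i2 E2] := moment2 m.
have sgt0 : 0 < s.
  (* A degenerate law would make the second moment about [m] vanish, whereas it is
     [v^2 + m^2 > 0]. *)
  rewrite lt_neqAle s0 andbT eq_sym; apply/eqP => s00.
  have := law [set m] (measurable_set1 m).
  rewrite /gaussian_law s00 eqxx diracE mem_set// => P1.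
  have Pc : P (~` (X @^-1` [set m])) = 0.
    by rewrite probability_setC ?P1 ?subee//; exact: mpre.
  have aeX : {ae P, forall w, X w = m}.
    exists (~` (X @^-1` [set m])); split.
    - by apply: measurableC; exact: mpre.
    - exact: Pc.
    - by move=> w /= nw Xm; apply: nw.
  have : (\int[P]_w ((X w - m) ^+ 2)%:E = \int[P]_w (cst 0 w))%E.
    apply: ae_eq_integral => //; first exact: measurable_int i2.
    by apply: filterS aeX => w -> _; rewrite subrr expr0n.
  rewrite E2 integral_cst// mul0e => -[]; apply/eqP.
  by rewrite gt_eqF// ltr_wpDr ?sqr_ge0// exprn_gt0.
have sn0 : s != 0 by rewrite gt_eqF.
have lawE A : measurable A -> P (X @^-1` A) = normal_prob m s A.
  by move=> mA; rewrite law// /gaussian_law (negbTE sn0).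
pose f x : \bar R := ((x - m) ^+ 2)%:E.
have mf : measurable_fun setT f.
  by apply/measurable_EFinP; apply: measurable_funX; exact: measurable_funB.
have f0 x : (0 <= f x)%E by rewrite lee_fin sqr_ge0.
have fN : (\int[normal_prob m s]_x f x = (v ^+ 2 + m ^+ 2)%:E)%E.
  rewrite -E2.
  pose T := g_sigma_algebraType (R.-ocitv.-measurable).
  pose Y : {mfun Omega >-> T} := HB.pack (X : Omega -> T) (isMeasurableFun.Build _ _ Omega T X mX).
  have -> : (\int[P]_w ((X w - m) ^+ 2)%:E = \int[distribution P Y]_x f x)%E.
    by rewrite (@ge0_integral_distribution _ _ _ _ _ P Y).
  by apply: (@eq_measure_integral _ T _ setT (distribution P Y) (normal_prob m s) f) => A mA _; exact: esym (lawE A mA).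
have low : v ^+ 2 + m ^+ 2 <= 8 * s ^+ 2.
  rewrite -lee_fin -fN integral_normal_prob//; last first.
    apply/integrableP; split => //.
    under eq_integral do rewrite gee0_abs//.
    by rewrite fN ltry.
  under eq_integral do rewrite -EFinM.
  apply: (@integral_normal_pdf_le _ m (2 * s)).
  - by rewrite mulf_neq0.
  - by rewrite mulr_ge0 ?sqr_ge0.
  - apply: measurable_funM; last exact: measurable_normal_pdf.
    by apply: measurable_funX; exact: measurable_funB.
  move=> x; rewrite mulr_ge0 ?sqr_ge0 ?normal_pdf_ge0//=.
  (* The case [q = 1], where the moment constant is 8. *)
  have := @normal_pdf_moment _ m s x 1 sgt0 isT.
  rewrite muln1 /moment_const expr1 mulr1 expr_div_n real_normK ?num_real//.
  have s2 : 0 < s ^+ 2 by rewrite exprn_gt0.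
  rewrite mulrA ler_pdivrMr// [leLHS]mulrC => /le_trans; apply.
  by rewrite le_eqVlt; apply/orP; left; apply/eqP; ring.
have up : s <= 6 * v.
  have mA : measurable (`[- (2 * v), 2 * v]%classic : set R) by exact: measurable_itv.
  have v2 : - (2 * v) <= 2 * v by rewrite lerNl -subr_ge0 opprK; rewrite addr_ge0// mulr_ge0// ltW.
  have := normal_prob_itv_le m sgt0 v2; rewrite -(lawE _ mA).
  set A := X @^-1` _ => PA.
  have mXA : measurable A by exact: mpre.
  have PC : (P (~` A) <= (1 / 4)%:E)%E.
    have : ((4 * v ^+ 2)%:E * P (~` A) <= (v ^+ 2)%:E)%E.
      have mC : measurable (~` A) by exact: measurableC.
      rewrite -EX2 -[X in P X](setIid (~` A)) -(integral_indic P mC mC).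
      rewrite -ge0_integralZl//=; last 2 first.
      - by apply/measurable_EFinP/measurable_funTS; exact: measurable_indic.
      - by rewrite lee_fin mulr_ge0// sqr_ge0.
      rewrite integral_mkcond.
      apply: ge0_le_integral => //=.
      - by move=> w _; rewrite patchE; case: ifPn => // _; rewrite -EFinM lee_fin mulr_ge0// mulr_ge0// sqr_ge0.
      - apply/(measurable_restrictT _ _).1; first exact: mC.
        by apply/measurable_EFinP/measurable_funTS; apply: measurable_funM => //; exact: measurable_indic.
      - exact: measurable_int iX2.
      - move=> w _; rewrite patchE; case: ifPn => [wA|_]; last by rewrite lee_fin sqr_ge0.
        rewrite indicE wA mule1 lee_fin.
        move: wA; rewrite inE /A/= in_itv/= => /negP; rewrite -ler_norml -ltNge => h.
        rewrite -[X in _ <= X ^+ 2]/(X w) -(real_normK (num_real (X w))).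
        have -> : 4 * v ^+ 2 = (2 * v) ^+ 2 by ring.
        by rewrite lerXn2r ?nnegrE// ?ltW// mulr_gt0.
    have PAf : P (~` A) \is a fin_num by apply: fin_num_measure; exact: measurableC mXA.
    have aux (p : \bar R) (a : R) : p \is a fin_num -> 0 < a ->
        ((4 * a)%:E * p <= a%:E)%E -> (p <= (1 / 4)%:E)%E.
      case: p => // p _ a0; rewrite -EFinM !lee_fin => h.
      by rewrite -(ler_pM2r a0); lra.
    have v20 : 0 < v ^+ 2 by rewrite exprn_gt0.
    exact: (aux _ _ PAf v20).
  have : (1 <= (1 / 4)%:E + ((2 * v - - (2 * v)) / s)%:E)%E.
    have <- : (P (~` A) + P A = 1)%E.
      by rewrite probability_setC// subeK//; apply: fin_num_measure.
    exact: leeD.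
  rewrite -EFinD lee_fin => h.
  have : 3 / 4 <= 4 * v / s.
    have -> : 4 * v / s = (2 * v - - (2 * v)) / s by congr (_ / _); ring.
    by lra.
  by rewrite ler_pdivlMr//; lra.
exists m, s; split => //.
- have : v ^+ 2 <= (3 * s) ^+ 2 by by have := sqr_ge0 m; have := sqr_ge0 s; move: low; rewrite exprMn; lra.
  rewrite ler_sqr ?nnegrE ?mulr_ge0 ?(ltW v0)// => vs.
  by rewrite ler_pdivrMr// mulrC.
- have : `|m| ^+ 2 <= (17 * v) ^+ 2.
    have : s ^+ 2 <= (6 * v) ^+ 2 by rewrite ler_sqr ?nnegrE ?mulr_ge0 ?(ltW v0).
    have : 0 <= v ^+ 2 by exact: sqr_ge0.
    by move: low; rewrite real_normK ?num_real// !exprMn; lra.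
  by rewrite ler_sqr ?nnegrE ?mulr_ge0 ?(ltW v0).
Qed.

Lemma gaussian_small_ball (e : R) : 0 <= e ->
  (P [set w | (`|X w| <= e)%R] <= (6 * e / v)%:E)%E.
Proof.
move=> e0; have [m [s [vs _ _ law]]] := gaussian_scale.
have s0 : 0 < s by apply: lt_le_trans vs; rewrite divr_gt0.
have -> : [set w | `|X w| <= e] = X @^-1` `[- e, e].
  by apply/seteqP; split => w /=; rewrite in_itv/= ler_norml.
rewrite law//; have ee : - e <= e by rewrite (le_trans _ e0)// oppr_le0.
apply: le_trans (normal_prob_itv_le _ s0 ee) _.
rewrite lee_fin opprK ler_pdivrMr//.
have -> : 6 * e / v * s = 6 * (e * (s / v)) by ring.
have : 1 <= 3 * (s / v).
  by rewrite mulrA ler_pdivlMr// mul1r mulrC -ler_pdivrMr.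
have aux (z : R) : 1 <= 3 * z -> e + e <= 6 * (e * z).
  by move=> h; have := ler_wpM2l e0 h; lra.
exact: aux.
Qed.

(** For [l <= 34 v] the right side is at least 1. Otherwise [|m| <= 17 v < l / 2], so the event puts
    [X] at distance at least [l / 2] from [m]. *)
Lemma gaussian_tail (l : R) (q : nat) : 0 < l -> (0 < q)%N ->
  (P [set w | (l <= `|X w|)%R] <=
   (moment_const q * (34 * v / l) ^+ (2 * q))%:E)%E.
Proof.
move=> l0 q0; have [m [s [vs sv mv law]]] := gaussian_scale.
have s0 : 0 < s by apply: lt_le_trans vs; rewrite divr_gt0.
have K1 : 1 <= moment_const q :> R.
  rewrite /moment_const.
  have : 1 <= (4 * q%:R) ^+ q :> R.
    by rewrite exprn_ege1// -natrM ler1n muln_gt0.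
  by move=> h; have := ler_wpM2l (ler0n R 2) h; lra.
have mD : measurable [set w | l <= `|X w|].
  have -> : [set w | l <= `|X w|] = (fun w => `|X w|) @^-1` `[l, +oo[.
    by apply/seteqP; split => x /=; rewrite in_itv/= andbT.
  rewrite -[X in measurable X]setTI.
  have mf : measurable_fun setT (fun x => `|X x|) by exact: measurableT_comp.
  exact: mf.
have [lv|vl] := leP l (34 * v).
  apply: (@le_trans _ _ 1%E); first exact: probability_le1.
  rewrite lee_fin -[X in X <= _]mul1r ler_pM// exprn_ege1//.
  by rewrite ler_pdivlMr// mul1r.
pose D := [set x : R | l / 2 <= `|x - m|].
have sub : [set w | l <= `|X w|] `<=` X @^-1` D.
  move=> w /= lw; have : `|X w| <= `|X w - m| + `|m|.
    by rewrite -[X in `|X| <= _](subrK m) ler_normD.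
  have aux (a b c : R) : l <= a -> a <= b + c -> c <= 17 * v -> l / 2 <= b by lra.
  by move=> h; exact: (aux _ _ _ lw h mv).
have mT : measurable D.
  have -> : D = (fun x : R => `|x - m|) @^-1` `[l / 2, +oo[.
    by apply/seteqP; split => x /=; rewrite in_itv/= andbT.
  rewrite -[X in measurable X]setTI.
  have mf : measurable_fun setT (fun x : R => `|x - m|).
    by apply: measurableT_comp => //; exact: measurable_funB.
  exact: mf.
have mDm := mpre mT.
apply: (le_trans (le_measure P (mem_set mD) (mem_set mDm) sub)).
suff : (P (X @^-1` D) <= (moment_const q * (34 * v / l) ^+ (2 * q))%:E)%E by [].
rewrite law//.
have l20 : 0 < l / 2 by rewrite divr_gt0.
apply: le_trans (normal_prob_tail_le _ s0 l20 q0) _.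
rewrite lee_fin ler_wpM2l//; first by rewrite (le_trans ler01).
rewrite lerXn2r ?nnegrE ?divr_ge0 ?mulr_ge0 ?(ltW s0) ?(ltW l0) ?(ltW v0)//.
rewrite invfM invrK mulrA mulrAC ler_wpM2r ?invr_ge0 ?(ltW l0)//.
have aux (a b : R) : 0 <= b -> a <= 6 * b -> a * 2 <= 34 * b by lra.
exact: aux (ltW v0) sv.
Qed.

End gaussian_estimates.

(** * Increments of fractional Brownian motion *)

Section fBm_increments.
Context {d : measure_display} {Omega : measurableType d} {R : realType}.
Variable P : probability Omega R.
Variables (H : R) (BH : R -> Omega -> R).
Hypothesis H0 : 0 < H.
Hypothesis fB : is_fBm P H BH.

Let mB t : 0 <= t <= 1 -> measurable_fun setT (BH t).
Proof. by move=> t1; exact: (fBm_measurable fB t1). Qed.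

Let cov s t : 0 <= s <= 1 -> 0 <= t <= 1 -> (\int[P]_w (BH t w * BH s w)%:E)%E =
  (2^-1 * (s `^ (2 * H) + t `^ (2 * H) - `|s - t| `^ (2 * H)))%:E.
Proof. by move=> s1 t1; rewrite -(fBm_covariance fB s1 t1) unlock. Qed.

(** Diagonal covariances are finite integrals of nonnegative functions, so squares are integrable;
    products follow from [|x y| <= x^2 + y^2]. *)
Let iprod s t : 0 <= s <= 1 -> 0 <= t <= 1 ->
  P.-integrable setT (fun w => (BH t w * BH s w)%:E).
Proof.
have sq u : 0 <= u <= 1 -> P.-integrable setT (fun w => (BH u w * BH u w)%:E).
  move=> u1; apply/integrableP; split.
    by apply/measurable_EFinP; apply: measurable_funM; exact: mB.
  under eq_integral do rewrite gee0_abs ?lee_fin -?expr2 ?sqr_ge0//.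
  by under eq_integral do rewrite expr2; rewrite cov// ltry.
move=> s1 t1.
have i2 := @integrableD _ _ _ P _ measurableT _ _ (sq _ t1) (sq _ s1).
apply: (le_integrable measurableT _ _ i2).
  by apply/measurable_EFinP; apply: measurable_funM; exact: mB.
move=> w _ /=; rewrite lee_fin [leRHS]ger0_norm; last first.
  by rewrite addr_ge0// -expr2 sqr_ge0.
have aux (x y : R) : `|x * y| <= x * x + y * y.
  by rewrite ler_norml; apply/andP; split; nra.
exact: aux.
Qed.

Let iB t : 0 <= t <= 1 -> P.-integrable setT (EFin \o BH t).
Proof.
move=> t1.
have i1 : P.-integrable setT (fun _ : Omega => 1%:E).
  exact: finite_measure_integrable_cst.
have i2 := @integrableD _ _ _ P _ measurableT _ _ (iprod t1 t1) i1.
apply: (le_integrable measurableT _ _ i2).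
  by apply/measurable_EFinP; exact: mB.
move=> w _ /=; rewrite lee_fin [leRHS]ger0_norm; last first.
  by rewrite addr_ge0// -expr2 sqr_ge0.
have aux (x : R) : `|x| <= x * x + 1.
  by rewrite ler_norml; apply/andP; split; nra.
exact: aux.
Qed.

Let EB t : 0 <= t <= 1 -> (\int[P]_w (BH t w)%:E = 0)%E.
Proof. by move=> t1; have := fBm_centered fB t1; rewrite unlock. Qed.

Variables s t : R.
Hypotheses (s1 : 0 <= s <= 1) (t1 : 0 <= t <= 1).
Let X w := BH t w - BH s w.

Let mX : measurable_fun setT X.
Proof. by apply: measurable_funB; exact: mB. Qed.

Let gX : gaussian_rv P X.
Proof.
have := @fBm_gaussian _ _ _ _ _ _ fB 2 (fun i => if i == ord0 then t else s)
  (fun i => if i == ord0 then 1 else -1).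
have : forall i : 'I_2, 0 <= (if i == ord0 then t else s) <= 1 by move=> i; case: ifP.
move=> h /(_ h).
congr (gaussian_rv _ _); apply/funext => w.
by rewrite big_ord_recl big_ord1/= mul1r mulN1r.
Qed.

Let iX : P.-integrable setT (EFin \o X).
Proof. exact: (@integrableB _ _ _ P _ measurableT _ _ (iB t1) (iB s1)). Qed.

Let EX : (\int[P]_w (X w)%:E = 0)%E.
Proof.
transitivity (\int[P]_w ((BH t w)%:E - (BH s w)%:E))%E; first by [].
rewrite (@integralB _ _ _ P _ measurableT _ _ (iB t1) (iB s1)).
by rewrite !EB// sube0.
Qed.

Let X2E : (fun w => (X w ^+ 2)%:E) =
  (fun w => ((BH t w * BH t w)%:E +
     ((-2)%:E * (BH t w * BH s w)%:E + (BH s w * BH s w)%:E)))%E.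
Proof.
apply/funext => w; rewrite -EFinM -!EFinD; congr (_%:E).
have aux (x y : R) : (x - y) ^+ 2 = x * x + (-2 * (x * y) + y * y) by ring.
exact: aux.
Qed.

Let i1 : P.-integrable setT (fun w => ((-2)%:E * (BH t w * BH s w)%:E)%E).
Proof. exact: (@integrableZl _ _ R P _ measurableT (-2) _ (iprod s1 t1)). Qed.

Let i12 : P.-integrable setT
  (fun w => ((-2)%:E * (BH t w * BH s w)%:E + (BH s w * BH s w)%:E)%E).
Proof. exact: (@integrableD _ _ _ P _ measurableT _ _ i1 (iprod s1 s1)). Qed.

Let iX2 : P.-integrable setT (fun w => (X w ^+ 2)%:E).
Proof.
rewrite X2E; exact: (@integrableD _ _ _ P _ measurableT _ _ (iprod t1 t1) i12).
Qed.

Let EX2 : (\int[P]_w (X w ^+ 2)%:E = ((`|t - s| `^ H) ^+ 2)%:E)%E.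
Proof.
rewrite X2E (@integralD _ _ _ P _ measurableT _ _ (iprod t1 t1) i12).
rewrite (@integralD _ _ _ P _ measurableT _ _ i1 (iprod s1 s1)).
rewrite (@integralZl _ _ _ P _ measurableT _ (iprod s1 t1)).
rewrite !cov// -EFinM -!EFinD; congr (_%:E).
rewrite !subrr normr0 powR0 ?mulf_neq0 ?gt_eqF//.
rewrite -powR_mulrn ?powR_ge0// -powRrM (mulrC H) distrC.
by field.
Qed.

Hypothesis st : s != t.

Let v0 : 0 < `|t - s| `^ H.
Proof. by rewrite powR_gt0// normr_gt0 subr_eq0 eq_sym. Qed.

Lemma fBm_small_ball (e : R) : 0 <= e ->
  (P [set w | (`|BH t w - BH s w| <= e)%R] <= (6 * e / `|t - s| `^ H)%:E)%E.
Proof. exact: (gaussian_small_ball mX gX iX iX2 EX EX2 v0). Qed.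

Lemma fBm_tail (l : R) (q : nat) : 0 < l -> (0 < q)%N ->
  (P [set w | (l <= `|BH t w - BH s w|)%R] <=
   (moment_const q * (34 * `|t - s| `^ H / l) ^+ (2 * q))%:E)%E.
Proof. exact: (gaussian_tail mX gX iX iX2 EX EX2 v0). Qed.

End fBm_increments.

(** * Holder continuity of the paths by dyadic chaining *)

Lemma nat_within_one (a c : nat) : (a < c.+1)%N -> (c < a.+2)%N -> c = a \/ c = a.+1.
Proof. lia. Qed.

Section dyadic_chaining.
Context {R : realType}.

Lemma within01_continuousP (g : R -> R) (x : R) : {within `[0, 1], continuous g} ->
  0 <= x <= 1 -> forall e, 0 < e -> exists2 dl, 0 < dl &
    forall y, 0 <= y <= 1 -> `|x - y| < dl -> `|g x - g y| < e.
Proof.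
move=> cg x01 e e0.
have := cg x; rewrite /continuous_at.
have -> : nbhs (x : subspace `[0, 1]) = within `[0, 1] (nbhs x).
  by rewrite nbhs_subspace_in//= in_itv/=.
move=> /cvgrPdist_lt/(_ _ e0); rewrite near_withinE => /nbhs_ballP[dl /= dl0 h].
by exists dl => // y y01 xy; apply: h => //=; rewrite in_itv/=.
Qed.

Variables (b : R) (g : R -> R) (N : nat).
Hypothesis b0 : 0 < b.
Hypothesis cg : {within `[0, 1], continuous g}.
Hypothesis incr : forall n k, (N <= n)%N -> (k < 2 ^ n)%N ->
  `|g (k.+1%:R / 2 ^+ n) - g (k%:R / 2 ^+ n)| <= ((2 ^+ n)^-1) `^ b.

Let r : R := 2^-1 `^ b.
Let r0 : 0 < r. Proof. by rewrite powR_gt0// invr_gt0. Qed.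
Let r1 : r < 1.
Proof.
have h : (2^-1 : R) < 1 by rewrite invf_lt1// ltr1n.
by have := gt0_ltr_powR b0 _ _ h; rewrite powR1 !nnegrE; apply; rewrite ?invr_ge0.
Qed.
Let rE n : ((2 ^+ n)^-1) `^ b = r ^+ n.
Proof.
have e (z : R) : 0 <= z -> (z ^+ n) `^ b = (z `^ b) ^+ n.
  move=> z0; rewrite -[z ^+ n]powR_mulrn// -powRrM mulrC powRrM.
  by rewrite powR_mulrn// powR_ge0.
by rewrite -exprVn e// invr_ge0.
Qed.

Let fl n (x : R) := Num.truncn (x * 2 ^+ n).
Let p n x : R := (fl n x)%:R / 2 ^+ n.
Let pw n : 0 < 2 ^+ n :> R. Proof. by rewrite exprn_gt0. Qed.

Let flP n x : 0 <= x -> (fl n x)%:R <= x * 2 ^+ n < (fl n x).+1%:R.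
Proof. by move=> x0; rewrite truncn_itv// mulr_ge0// ltW. Qed.

Let pP n x : 0 <= x -> 0 <= x - p n x < (2 ^+ n)^-1.
Proof.
move=> x0; have /andP[h1 h2] := flP n x0; apply/andP; split.
  by rewrite subr_ge0 /p ler_pdivrMr.
rewrite ltrBlDl /p -[X in _ + X]mul1r -mulrDl ltr_pdivlMr//.
by rewrite natr1.
Qed.

Let fl_le n x : 0 <= x <= 1 -> (fl n x <= 2 ^ n)%N.
Proof.
move=> /andP[x0 x1]; have /andP[h1 _] := flP n x0.
rewrite -(ler_nat R) natrX; apply: (le_trans h1).
by rewrite ler_piMl// ltW.
Qed.

Let p01 n x : 0 <= x <= 1 -> 0 <= p n x <= 1.
Proof.
move=> x01; rewrite /p divr_ge0 ?(ltW (pw n))//= ler_pdivrMr// mul1r.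
by rewrite -natrX ler_nat fl_le.
Qed.

Let fl_step n x : 0 <= x -> fl n.+1 x = (fl n x).*2 \/ fl n.+1 x = (fl n x).*2.+1.
Proof.
move=> x0; have /andP[h1 h2] := flP n x0; have /andP[k1 k2] := flP n.+1 x0.
have E : x * 2 ^+ n.+1 = 2 * (x * 2 ^+ n) by rewrite exprS mulrCA.
have d1 : ((fl n x).*2 < (fl n.+1 x).+1)%N.
  by rewrite -(ltr_nat R) -muln2 natrM; apply: le_lt_trans k2; rewrite E mulrC ler_wpM2l.
have d2 : (fl n.+1 x < (fl n x).*2.+2)%N.
  rewrite -(ltr_nat R) -doubleS -muln2 natrM; apply: le_lt_trans k1 _.
  by rewrite E mulrC ltr_pM2r.
exact: nat_within_one.
Qed.

Let p_step n x : (N <= n)%N -> 0 <= x <= 1 -> `|g (p n.+1 x) - g (p n x)| <= r ^+ n.+1.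
Proof.
move=> Nn x01; have /andP[x0 x1] := x01.
have E : p n x = ((fl n x).*2)%:R / 2 ^+ n.+1.
  by rewrite /p -muln2 natrM exprS invfM mulrA mulfK.
rewrite E /p; case: (fl_step n x0) => F; rewrite F.
  by rewrite subrr normr0 exprn_ge0// ltW.
rewrite -rE; apply: incr; first exact: leqW.
by have := fl_le n.+1 x01; rewrite F.
Qed.

Let p_chain n m x : (N <= n)%N -> 0 <= x <= 1 ->
  `|g (p (n + m) x) - g (p n x)| <= r ^+ n / (1 - r) * (1 - r ^+ m).
Proof.
move=> Nn x01; elim: m => [|m IH]; first by rewrite addn0 !subrr normr0 mulr0.
have -> : g (p (n + m.+1) x) - g (p n x) =
    (g (p (n + m).+1 x) - g (p (n + m) x)) + (g (p (n + m) x) - g (p n x)).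
  by rewrite addnS addrA subrK.
apply: le_trans (ler_normD _ _) _.
have := @p_step (n + m) x (leq_trans Nn (leq_addr _ _)) x01.
have r1' : 1 - r != 0 by rewrite subr_eq0 gt_eqF.
have -> : r ^+ n / (1 - r) * (1 - r ^+ m.+1) =
    r ^+ (n + m) + r ^+ n / (1 - r) * (1 - r ^+ m).
  by rewrite exprS exprD; field.
move=> h; apply: lerD => //; apply: le_trans h _.
by rewrite exprS ler_piMl ?exprn_ge0// ltW.
Qed.

Let small_pow (e : R) : 0 < e -> exists m, (2 ^+ m)^-1 < e.
Proof.
move=> e0; exists (Num.truncn (e^-1)).+1.
rewrite -[e in X in _ < X]invrK ltf_pV2 ?posrE ?invr_gt0//.
apply: lt_trans (truncnS_gt _) _.
by rewrite -natrX ltr_nat ltn_expl.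
Qed.

(** Continuity carries the geometric bound from the dyadic floors, which converge to [x], to [x]
    itself. *)
Let p_lim n x : (N <= n)%N -> 0 <= x <= 1 -> `|g x - g (p n x)| <= r ^+ n / (1 - r).
Proof.
move=> Nn x01; have /andP[x0 x1] := x01.
have r1' : 0 < 1 - r by rewrite subr_gt0.
apply/ler_addgt0Pr => e e0.
have [dl dl0 hd] := within01_continuousP cg x01 e0.
have [m dm] := small_pow dl0.
have dnm : (2 ^+ (n + m))^-1 <= (2 ^+ m)^-1 :> R.
  by rewrite lef_pV2 ?posrE// ler_weXn2l ?leq_addl// ler1n.
have := pP (n + m) x0 => /andP[q1 q2].
have := hd _ (p01 (n + m) x01).
rewrite ger0_norm// => /(_ (lt_trans (lt_le_trans q2 dnm) dm)) h.
have -> : g x - g (p n x) = (g x - g (p (n + m) x)) + (g (p (n + m) x) - g (p n x)).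
  by rewrite addrA subrK.
apply: le_trans (ler_normD _ _) _; rewrite addrC; apply: lerD; last exact: ltW.
apply: le_trans (p_chain m Nn x01) _.
rewrite ler_piMr ?divr_ge0 ?exprn_ge0 ?(ltW r0) ?(ltW r1')//.
by rewrite lerBlDr lerDl exprn_ge0// ltW.
Qed.

Let close n x y : (N <= n)%N -> 0 <= x <= 1 -> 0 <= y <= 1 -> x <= y -> y - x < (2 ^+ n)^-1 ->
  `|g x - g y| <= r ^+ n * (1 + 2 / (1 - r)).
Proof.
move=> Nn x01 y01 xy yx.
have [x0 x1] := andP x01; have [y0 y1] := andP y01.
have pxy : `|g (p n y) - g (p n x)| <= r ^+ n.
  have /andP[h1 h2] := flP n x0; have /andP[k1 k2] := flP n y0.
  have d1 : (fl n x < (fl n y).+1)%N.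
    by rewrite -(ltr_nat R); apply: (le_lt_trans h1); apply: le_lt_trans k2; rewrite ler_pM2r.
  have d2 : (fl n y < (fl n x).+2)%N.
    rewrite -(ltr_nat R); apply: (le_lt_trans k1).
    have : (y - x) * 2 ^+ n < 1 by rewrite -ltr_pdivlMr// mul1r.
    by move: h2; rewrite mulrBl -[X in _ -> _ -> _ < X]natr1; lra.
  have : fl n y = fl n x \/ fl n y = (fl n x).+1 by exact: nat_within_one.
  case=> F; rewrite /p F.
    by rewrite subrr normr0 exprn_ge0// ltW.
  rewrite -rE; apply: incr => //.
  by have := fl_le n y01; rewrite F.
have := p_lim Nn x01; have := p_lim Nn y01; rewrite (distrC (g y)) => hy hx.
have -> : g x - g y = (g x - g (p n x)) + ((g (p n y) - g y) - (g (p n y) - g (p n x))).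
  by ring.
apply: le_trans (ler_normD _ _) _.
apply: le_trans (lerD hx (ler_normB _ _)) _.
apply: le_trans (lerD (lexx _) (lerD hy pxy)) _.
have -> : r ^+ n * (1 + 2 / (1 - r)) = r ^+ n / (1 - r) + (r ^+ n / (1 - r) + r ^+ n) by ring.
by [].
Qed.

(** Points closer than [2^-n] have equal or adjacent dyadic floors at level [n], and from a floor to
    its point the increments form a geometric series of ratio [r = 2^(-b)]. Points further apart
    than [2^-N] are handled by boundedness of [g]. *)
Lemma dyadic_chaining : exists C, forall x y, 0 <= x <= 1 -> 0 <= y <= 1 ->
  `|g x - g y| <= C * `|x - y| `^ b.
Proof.
have r1' : 0 < 1 - r by rewrite subr_gt0.
pose M := \sum_(k < (2 ^ N).+1) `|g (k%:R / 2 ^+ N)| + r ^+ N / (1 - r).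
have gM x : 0 <= x <= 1 -> `|g x| <= M.
  move=> x01; rewrite -[g x](subrK (g (p N x))) addrC.
  apply: le_trans (ler_normD _ _) _; apply: lerD; last exact: p_lim.
  have h : (fl N x < (2 ^ N).+1)%N by rewrite ltnS fl_le.
  rewrite (bigD1 (Ordinal h))//= lerDl.
  exact: sumr_ge0.
have M0 : 0 <= M by apply: le_trans (gM 0 _); rewrite ?lexx ?ler01.
pose A := r^-1 * (1 + 2 / (1 - r)).
have A0 : 0 <= A.
  by rewrite mulr_ge0 ?invr_ge0 ?(ltW r0)// addr_ge0// divr_ge0// ltW.
pose B := 2 * M * (r ^+ N)^-1.
have B0 : 0 <= B by rewrite !mulr_ge0// invr_ge0 exprn_ge0// ltW.
exists (A + B).
suff main x y : 0 <= x <= 1 -> 0 <= y <= 1 -> x <= y -> `|g x - g y| <= (A + B) * `|x - y| `^ b.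
  move=> x y x01 y01; case: (leP x y) => [xy|/ltW yx]; first exact: main.
  by rewrite distrC (distrC x); exact: main.
move=> x01 y01 xy; rewrite [X in X `^ b]distrC [X in X `^ b]ger0_norm ?subr_ge0//.
have pb0 : 0 <= (y - x) `^ b by exact: powR_ge0.
have [far|near] := leP (2 ^+ N)^-1 (y - x).
  apply: (@le_trans _ _ (B * (y - x) `^ b)); last by rewrite ler_wpM2r// lerDr.
  apply: (@le_trans _ _ (2 * M)).
    apply: le_trans (ler_normB _ _) _.
    by rewrite mulrDl !mul1r; apply: lerD; exact: gM.
  rewrite /B -mulrA ler_peMr ?mulr_ge0//.
  rewrite -ler_pdivrMl ?invr_gt0 ?exprn_gt0// mulr1 invrK -rE.
  by rewrite ge0_ler_powR ?nnegrE ?invr_ge0 ?subr_ge0// ltW.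
have [->|xny] := eqVneq x y.
  by rewrite subrr normr0 mulr_ge0 ?addr_ge0// powR_ge0.
have dl0 : 0 < y - x by rewrite subr_gt0 lt_neqAle xny.
apply: (@le_trans _ _ (A * (y - x) `^ b)); last by rewrite ler_wpM2r// lerDl.
(* The least level [n >= N] with [2^-(n+1) <= y - x]. Minimality gives [y - x < 2^-n], and for
   [n = N] the current case does; the factor [r^-1] in [A] pays for the gap between the two
   levels. *)
have ex : exists n, (N <= n)%N && ((2 ^+ n.+1)^-1 <= y - x).
  have [m /ltW dm] := small_pow dl0.
  exists (N + m)%N; rewrite leq_addr/=; apply: le_trans dm.
  by rewrite lef_pV2 ?posrE// ler_weXn2l ?ler1n// -addnS (leq_trans (leqnSn _))// leq_addl.
case: (ex_minnP ex) => n /andP[Nn hn] nmin.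
have cl : y - x < (2 ^+ n)^-1.
  move: Nn; rewrite leq_eqVlt => /orP[/eqP <- //|Nn].
  have n0 : (0 < n)%N by exact: leq_ltn_trans Nn.
  rewrite ltNge; apply/negP => h.
  have := nmin n.-1; rewrite (prednK n0) h andbT -ltnS (prednK n0) Nn => /(_ isT).
  by rewrite -ltnS (prednK n0) ltnn.
apply: le_trans (close Nn x01 y01 xy cl) _.
rewrite /A mulrAC ler_wpM2r//.
  by rewrite addr_ge0// divr_ge0// ltW.
rewrite -ler_pdivrMl ?invr_gt0// invrK -exprS -rE.
by rewrite ge0_ler_powR ?nnegrE ?invr_ge0 ?exprn_ge0 ?(ltW dl0)// ltW.
Qed.

End dyadic_chaining.

Section borel_cantelli.
Context {d : measure_display} {Omega : measurableType d} {R : realType}.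
Variable P : probability Omega R.

Lemma borel_cantelli (E : (set Omega)^nat) (M : R) : 0 <= M ->
  (forall n, measurable (E n)) -> (forall n, (P (E n) <= (M / 2 ^+ n)%:E)%E) ->
  {ae P, forall w, exists N, forall n, (N <= n)%N -> ~ E n w}.
Proof.
move=> M0 mE EM.
have S : (\sum_(0 <= n <oo) P (E n) < +oo)%E.
  apply: (@le_lt_trans _ _ (2 * M)%:E); last exact: ltry.
  apply: le_trans (epsilon_trick0 xpredT (_ : 0 <= 2 * M)); last by rewrite mulr_ge0.
  apply: lee_nneseries => // n _.
  apply: le_trans (EM n) _; rewrite lee_fin natrX exprS invfM mulrACA divff// mul1r.
  by rewrite lexx.
exists (lim_sup_set E); split.
- by apply: bigcap_measurable => // n _; exact: bigcup_measurable.
- exact: lim_sup_set_cvg0.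
move=> w /= nE n _ /=.
apply: contrapT => nw; apply: nE; exists n => m nm Em; apply: nw.
by exists m.
Qed.

End borel_cantelli.

Section fBm_regularity.
Context {d : measure_display} {Omega : measurableType d} {R : realType}.
Variable P : probability Omega R.
Variables (H b : R) (BH : R -> Omega -> R).
Hypothesis fB : is_fBm P H BH.
Hypotheses (b0 : 0 < b) (bH : b < H).

(** With [q] such that [(H - b) q >= 1], each of the [2^n] increments of level [n] exceeds
    [2^(-n b)] with probability of order [4^-n]. The union bound leaves [2^-n], and Borel-Cantelli
    provides the hypothesis of the chaining. *)
Lemma fBm_holder : {ae P, forall w, exists C, forall x y,
  0 <= x <= 1 -> 0 <= y <= 1 -> `|BH x w - BH y w| <= C * `|x - y| `^ b}.
Proof.
have H0 : 0 < H by exact: lt_trans bH.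
have Hb0 : 0 < H - b by rewrite subr_gt0.
pose q := (Num.truncn (H - b)^-1).+1.
have q1 : 1 <= (H - b) * q%:R.
  by rewrite -ler_pdivrMl// mulr1; apply/ltW; exact: truncnS_gt.
pose dy n k : R := k%:R / 2 ^+ n.
have dy01 n k : (k <= 2 ^ n)%N -> 0 <= dy n k <= 1.
  move=> kn; rewrite divr_ge0 ?exprn_ge0//= ler_pdivrMr ?exprn_gt0// mul1r.
  by rewrite -natrX ler_nat.
pose h n : R := (2 ^+ n)^-1.
have h0 n : 0 < h n by rewrite invr_gt0 exprn_gt0.
pose A n k := [set w | h n `^ b <= `|BH (dy n k.+1) w - BH (dy n k) w|].
have mA n k : (k < 2 ^ n)%N -> measurable (A n k).
  move=> kn; rewrite -[X in measurable X]setTI.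
  have -> : A n k = (fun w => `|BH (dy n k.+1) w - BH (dy n k) w|) @^-1` `[h n `^ b, +oo[.
    by apply/seteqP; split => x /=; rewrite in_itv/= andbT.
  have mf : measurable_fun setT (fun w => `|BH (dy n k.+1) w - BH (dy n k) w|).
    apply: measurableT_comp => //; apply: measurable_funB.
      by apply: (fBm_measurable fB); exact: dy01.
    by apply: (fBm_measurable fB); apply: dy01; exact: ltnW.
  exact: mf.
pose K : R := moment_const q * 34 ^+ (2 * q).
have K0 : 0 <= K.
  by rewrite !mulr_ge0 ?exprn_ge0// mulr_ge0.
have PA n k : (k < 2 ^ n)%N -> (P (A n k) <= (K * h n ^+ 2)%:E)%E.
  move=> kn.
  have dE : `|dy n k.+1 - dy n k| = h n.
    by rewrite /dy -mulrBl -natr1 addrAC subrr add0r mul1r ger0_norm// ltW.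
  have := @fBm_tail _ _ _ P H BH H0 fB (dy n k) (dy n k.+1) (dy01 _ _ (ltnW kn)) (dy01 _ _ kn).
  have ne : dy n k != dy n k.+1.
    by rewrite eq_sym -subr_eq0 -normr_gt0 dE.
  move=> /(_ ne (h n `^ b) q); rewrite powR_gt0// => /(_ isT isT) /le_trans; apply.
  rewrite dE lee_fin /K -(mulrA (moment_const q)) ler_wpM2l ?mulr_ge0 ?exprn_ge0 ?mulr_ge0//.
  rewrite -(mulrA 34) exprMn ler_wpM2l ?exprn_ge0//.
  rewrite -powRB; last by rewrite (gt_eqF (h0 n)) implybT.
  rewrite -[leLHS]powR_mulrn ?powR_ge0// -powRrM -[leRHS]powR_mulrn ?(ltW (h0 n))//.
  apply: ger_powR; first by rewrite h0/= invf_le1 ?exprn_gt0// exprn_ege1// ler1n.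
  by rewrite natrM mulrCA -[leLHS]mulr1 ler_wpM2l.
pose E n := \big[setU/set0]_(k < 2 ^ n) A n k.
have mE n : measurable (E n) by apply: bigsetU_measurable => k _; exact: mA.
have PE n : (P (E n) <= (K / 2 ^+ n)%:E)%E.
  apply: (@le_trans _ _ (\sum_(k < 2 ^ n) P (A n k))%E).
    by apply: Boole_inequality => k kn; exact: mA.
  apply: (@le_trans _ _ (\sum_(k < 2 ^ n) (K * h n ^+ 2)%:E)%E).
    by apply: lee_sum => k _; exact: PA.
  rewrite sumEFin lee_fin sumr_const card_ord -[leLHS]mulr_natr natrX.
  by rewrite /h expr2 -!mulrA mulVf ?mulr1// expf_neq0.
apply: filterS (borel_cantelli K0 mE PE) => w [N hN].
apply: (@dyadic_chaining _ b (BH^~ w) N) => //.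
  exact: (fBm_continuous fB).
move=> n k Nn kn; rewrite -/(h n) leNgt; apply/negP => /ltW Aw.
apply: (hN n Nn); rewrite /E -bigcup_mkord; by exists k.
Qed.

End fBm_regularity.

(** * Adapted variables; measurability of the bond *)

Section adapted.
Context {d : measure_display} {Omega : measurableType d} {R : realType}.
Variables (P : probability Omega R) (bd st : R -> Omega -> R).

Definition market_events (t : R) : set (set Omega) :=
  [set E | P.-negligible E \/
    exists (u : R) (A : set R), [/\ 0 <= u <= t, measurable A &
      E = bd u @^-1` A \/ E = st u @^-1` A]].

(** Phrased as measurability for the generated sigma-algebra taken as a measurable structure, so
    that the closure properties of [measurable_fun] apply. *)
Definition adapted (t : R) (X : Omega -> R) : Prop :=
  measurable_fun (setT : set (g_sigma_algebraType (market_events t))) X.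

Lemma adaptedP t X : adapted t X <->
  forall A : set R, measurable A -> market_filtration P bd st t (X @^-1` A).
Proof.
split=> [h A mA|h mT A mA]; first by have := h measurableT A mA; rewrite setTI.
by rewrite setTI; exact: h.
Qed.

Lemma market_filtration_sub s t : s <= t ->
  market_filtration P bd st s `<=` market_filtration P bd st t.
Proof.
move=> st'; apply: sub_smallest2r; first exact: smallest_sigma_algebra.
move=> E [nE|[u [A [/andP[u0 us] mA EA]]]]; [by left|right].
by exists u, A; split => //; rewrite u0 (le_trans us).
Qed.

Lemma adapted_sub s t X : s <= t -> adapted s X -> adapted t X.
Proof.
move=> st' /adaptedP h; apply/adaptedP => A mA.
by apply: market_filtration_sub st' _ _; exact: h.
Qed.

Lemma adapted_bd u t : 0 <= u <= t -> adapted t (bd u).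
Proof.
move=> ut; apply/adaptedP => A mA; apply: sub_sigma_algebra; right.
by exists u, A; split => //; left.
Qed.

Lemma adapted_st u t : 0 <= u <= t -> adapted t (st u).
Proof.
move=> ut; apply/adaptedP => A mA; apply: sub_sigma_algebra; right.
by exists u, A; split => //; right.
Qed.

(** Completeness is what makes the added negligible sets measurable. *)
Lemma market_filtration_measurable t : measure_is_complete P ->
  (forall u, 0 <= u <= t -> measurable_fun setT (bd u)) ->
  (forall u, 0 <= u <= t -> measurable_fun setT (st u)) ->
  market_filtration P bd st t `<=` measurable.
Proof.
move=> cP mb ms; apply: smallest_sub; first exact: sigma_algebra_measurable.
move=> E [nE|[u [A [ut mA [->|->]]]]]; first exact: cP.
- by have := mb u ut measurableT A mA; rewrite setTI.
- by have := ms u ut measurableT A mA; rewrite setTI.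
Qed.

End adapted.

Section bond_stock.
Context {d : measure_display} {Omega : measurableType d} {R : realType}.
Local Notation leb := (@lebesgue_measure R).
Variables (r : R -> Omega -> R).
Hypothesis rb : bounded_rate r.

Lemma measurable_rate_path w : measurable_fun (`[0, 1]%classic : set R) (r ^~ w).
Proof.
have [mr _] := rb.
have := measurable_comp _ _ mr (measurable_funTS (@pair2_measurable _ _ (measurableTypeR R) Omega w)).
apply => //.
- by apply: measurableX => //; exact: measurable_itv.
- by move=> p [x /= x01 <-].
Qed.

Lemma bond_bondp w t : 0 <= t <= 1 -> bond r t w = bondp (r ^~ w) t.
Proof. by move=> t01; rewrite /bond /bondp /logbond clamp01_id. Qed.

Lemma measurable_bond u : 0 <= u <= 1 -> measurable_fun setT (bond r u).
Proof.
move=> /andP[u0 u1]; apply: measurableT_comp => //.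
have [mr _] := rb.
pose D : set (measurableTypeR R * Omega) := `[0, u] `*` setT.
have mD : measurable D by apply: measurableX => //; exact: measurable_itv.
have mrD : measurable_fun setT ((fun p => r p.1 p.2) \_ D).
  pose D1 : set (measurableTypeR R * Omega) := `[0, 1] `*` setT.
  have mD1 : measurable D1 by apply: measurableX => //; exact: measurable_itv.
  have D1D : D `<=` D1.
    move=> p [/= h _]; split => //; move: h; rewrite /= !in_itv/= => /andP[-> h].
    exact: le_trans h u1.
  have h : measurable_fun D (fun p => r p.1 p.2) := measurable_funS mD1 D1D mr.
  have := (measurable_restrictT (fun p => r p.1 p.2) mD).1 h.
  exact.
have mk := measurableT_comp mrD (@measurable_swap _ _ Omega (measurableTypeR R)).
have := @measurable_section_integral _ _ _ _ R leb _ mk.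
congr (measurable_fun _ _); apply/funext => w.
rewrite [RHS]Rintegral_mkcond; apply: eq_Rintegral => s _.
by rewrite /= !patchE /D/=; congr (if _ then _ else _); apply/idP/idP; rewrite !inE/= => -[].
Qed.

End bond_stock.

(** * Left continuity of the filtration at time 1 *)

Section approximation.
Context {d : measure_display} {Omega : measurableType d} {R : realType}.
Variables (P : probability Omega R) (bd st : R -> Omega -> R).
Hypothesis cP : measure_is_complete P.
Hypothesis mb : forall u, 0 <= u <= 1 -> measurable_fun setT (bd u).
Hypothesis ms : forall u, 0 <= u <= 1 -> measurable_fun setT (st u).

Local Notation F := (market_filtration P bd st).

Definition before_one (m : nat) : R := 1 - m.+1%:R^-1.

Lemma before_one_ge0 m : 0 <= before_one m.
Proof. by rewrite subr_ge0 invf_le1 ?ltr0n// ler1n. Qed.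

Lemma before_one_lt1 m : before_one m < 1.
Proof. by rewrite ltrBlDr ltrDl invr_gt0 ltr0n. Qed.

Lemma before_one_lt m n : (m < n)%N -> before_one m < before_one n.
Proof.
by move=> mn; rewrite ltrD2l ltrN2 ltf_pV2 ?posrE ?ltr0n// ltr_nat ltnS.
Qed.

Lemma before_one_le m n : (m <= n)%N -> before_one m <= before_one n.
Proof.
by rewrite leq_eqVlt => /predU1P[->//|/before_one_lt/ltW].
Qed.

Lemma before_one_cvg t : t < 1 -> exists n, t < before_one n.
Proof.
move=> t1; exists (Num.truncn (1 - t)^-1).
rewrite ltrBrDl -ltrBrDr -[X in _ < X]invrK ltf_pV2 ?posrE ?ltr0n ?invr_gt0 ?subr_gt0//.
exact: truncnS_gt.
Qed.

Lemma cvg_before_one : before_one n @[n --> \oo] --> (1 : R).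
Proof.
apply/cvgrPdist_lt => e e0.
have [N hN] := @before_one_cvg (1 - e) ltac:(by rewrite ltrBlDr ltrDl).
exists N => // n /= Nn.
rewrite ger0_norm ?subr_ge0 ?ltW ?before_one_lt1// ltrBlDr -ltrBlDl.
exact: lt_le_trans hN (before_one_le Nn).
Qed.

Hypothesis cb : forall w, bd (before_one n) w @[n --> \oo] --> bd 1 w.
Hypothesis cs : forall w, st (before_one n) w @[n --> \oo] --> st 1 w.

Let mF t : t <= 1 -> F t `<=` measurable.
Proof.
move=> t1; apply: market_filtration_measurable => // u /andP[u0 ut].
  by apply: mb; rewrite u0 (le_trans ut).
by apply: ms; rewrite u0 (le_trans ut).
Qed.

Let symd (E A : set Omega) : set Omega := (E `\` A) `|` (A `\` E).

(** Events that can be decided, up to small probability, strictly before time 1. They form a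
    sigma-algebra containing [F 1], which is the form of left continuity used here. *)
Let approx : set (set Omega) := [set E | measurable E /\
  forall e : R, 0 < e -> exists m A, F (before_one m) A /\ (P (symd E A) < e%:E)%E].

Let msymd E A : measurable E -> measurable A -> measurable (symd E A).
Proof. by move=> mE mA; apply: measurableU; exact: measurableD. Qed.

Let F_U m (A : (set Omega)^nat) : (forall n, F (before_one m) (A n)) ->
  F (before_one m) (\bigcup_n A n).
Proof. by have [_ _] := smallest_sigma_algebra setT (market_events P bd st (before_one m)); apply. Qed.

Let F_bigU m (A : (set Omega)^nat) n : (forall k, (k < n)%N -> F (before_one m) (A k)) ->
  F (before_one m) (\big[setU/set0]_(k < n) A k).
Proof.
move=> FA; rewrite -bigcup_mkord bigcup_mkcond.
apply: F_U => k; case: ifPn => [|_]; first by rewrite inE/=; exact: FA.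
by have [] := smallest_sigma_algebra setT (market_events P bd st (before_one m)).
Qed.

(** A countable union is replaced by a finite one at cost [e / 2], and each of its [n] members by an
    event known earlier; the largest of these [n] times serves for all. *)
Let approx_sigma : sigma_algebra setT approx.
Proof.
split.
- split => // e e0; exists 0%N, set0; split.
    by have [] := smallest_sigma_algebra setT (market_events P bd st (before_one 0%N)).
  by rewrite /symd !set0D setU0 measure0 lte_fin.
- move=> E [mE aE]; split; first by rewrite setTD; exact: measurableC.
  move=> e e0; have [m [A [FA PA]]] := aE _ e0; exists m, (setT `\` A); split.
    by have [_ h _] := smallest_sigma_algebra setT (market_events P bd st (before_one m)); exact: h.
  suff -> : symd (setT `\` E) (setT `\` A) = symd E A by [].
  apply/seteqP; split => w; rewrite /symd /=.
    by case=> -[h1 h2]; [right|left]; split; [|tauto| |tauto]; apply: contrapT; tauto.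
  by case=> -[h1 h2]; [right|left]; split; tauto.
- move=> E aE; have mE n : measurable (E n) by have [] := aE n.
  have mU : measurable (\bigcup_n E n) by exact: bigcup_measurable.
  split => // e e0.
  have e20 : 0 < e / 2 by rewrite divr_gt0.
  pose T n := \big[setU/set0]_(k < n) E k.
  have mT n : measurable (T n) by exact: bigsetU_measurable.
  have [n hn] : exists n, (P (\bigcup_n E n `\` T n) < (e / 2)%:E)%E.
    pose Dn n := \bigcup_n E n `\` T n.
    have mD n : measurable (Dn n) by exact: measurableD.
    have D0 : \bigcap_n Dn n = set0.
      apply/seteqP; split => // w /= h.
      have [[k _ Ek] _] := h 0%N I.
      have [_ /= nT] := h k.+1 I; apply: nT.
      by rewrite /T -bigcup_mkord; exists k => /=.
    have := @nonincreasing_cvg_mu _ _ _ P Dn.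
    have PD0 : (P (Dn 0%N) < +oo)%E by rewrite ltey_eq fin_num_measure.
    have mI : measurable (\bigcap_n Dn n) by rewrite D0.
    move=> /(_ PD0 mD mI).
    have nD : nonincreasing_seq Dn.
      move=> i j ij; apply/subsetPset; apply: setDS.
      rewrite /T -!bigcup_mkord => w [k /= ki Ek]; exists k => //=.
      exact: leq_trans ki ij.
    move=> /(_ nD); rewrite D0 measure0 => /fine_cvgP[_ /cvgrPdist_lt/(_ _ e20)[N _ hN]].
    exists N; have := hN N (leqnn N); rewrite /= sub0r normrN ger0_norm; last exact: fine_ge0.
    by rewrite -lte_fin fineK// fin_num_measure.
  (* The divisor [n + 1] keeps [en] well defined and positive when [n = 0]. *)
  pose en : R := e / 2 / n.+1%:R.
  have en0 : 0 < en by rewrite divr_gt0.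
  have /choice[mA hA] : forall k, exists mA : nat * set Omega,
      F (before_one mA.1) mA.2 /\ (P (symd (E k) mA.2) < en%:E)%E.
    by move=> k; have [_ /(_ _ en0)[m [A hA]]] := aE k; exists (m, A).
  pose M := (\max_(k < n) (mA k).1)%N.
  pose B := \big[setU/set0]_(k < n) (mA k).2.
  exists M, B; split.
    apply: (@F_bigU M (fun k => (mA k).2) n) => k kn.
    apply: market_filtration_sub (proj1 (hA k)).
    by apply: before_one_le; exact: (leq_bigmax (Ordinal kn)).
  have mAk k : measurable (mA k).2.
    by apply: (mF _ (proj1 (hA k))); exact/ltW/before_one_lt1.
  have sub : symd (\bigcup_n E n) B `<=`
      (\bigcup_n E n `\` T n) `|` \big[setU/set0]_(k < n) symd (E k) (mA k).2.
    rewrite /B /T -bigcup_mkord -(bigcup_mkord n (fun k => (mA k).2)).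
    rewrite -(bigcup_mkord n (fun k => symd (E k) (mA k).2)) => w [[[k _ Ek] nB]|[[k kn Ak] nE]].
      have [[j jn Ej]|nT] := pselect ((\bigcup_(k in `I_n) E k) w).
        right; exists j => //; left; split => // Aj; apply: nB; by exists j.
      by left; split => //; exists k.
    by right; exists k => //; right; split => // Ek; apply: nE; exists k.
  have mS : measurable (\big[setU/set0]_(k < n) symd (E k) (mA k).2).
    by apply: bigsetU_measurable => k _; exact: msymd.
  have mB : measurable B by apply: bigsetU_measurable => k _; exact: mAk.
  have mDT := measurableD mU (mT n).
  apply: le_lt_trans (le_measure P (mem_set (msymd mU mB)) (mem_set (measurableU _ _ mDT mS)) sub) _.
  apply: le_lt_trans (@measureU2 _ _ _ P _ _ mDT mS) _.
  have -> : e = e / 2 + e / 2 by rewrite -splitr.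
  rewrite EFinD; apply: lte_leD => //.
    by rewrite fin_num_measure.
  have mEA k : (k < n)%N -> measurable (symd (E k) (mA k).2) by move=> _; exact: msymd.
  apply: le_trans (@Boole_inequality _ _ _ P _ n mEA) _.
  apply: (@le_trans _ _ (\sum_(k < n) en%:E)%E).
    by apply: lee_sum => k _; exact/ltW/(proj2 (hA k)).
  rewrite sumEFin lee_fin sumr_const card_ord -[leLHS]mulr_natr /en.
  by rewrite mulrAC ler_pdivrMr// ler_wpM2l ?(ltW e20)// ler_nat.
Qed.

Let F_approx m : F (before_one m) `<=` approx.
Proof.
move=> E FE; split; first by apply: mF FE; exact/ltW/before_one_lt1.
move=> e e0; exists m, E; split => //.
by rewrite /symd setDv setU0 measure0 lte_fin.
Qed.

Let approx_cvg (X : Omega -> R) (Y : nat -> Omega -> R) :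
  (forall m, adapted P bd st (before_one m) (Y m)) ->
  (forall w, Y n w @[n --> \oo] --> X w) ->
  forall A, measurable A -> approx (X @^-1` A).
Proof.
move=> aY YX A mA.
pose T := g_sigma_algebraType approx.
have mY n : measurable_fun (setT : set T) (Y n).
  move=> _ B mB; rewrite setTI; apply: sub_sigma_algebra; apply: (@F_approx n).
  exact: (adaptedP _ _ _ _ _).1.
have mX : measurable_fun (setT : set T) X.
  by apply: (measurable_fun_cvg mY) => w _; exact: YX.
have := mX measurableT A mA; rewrite setTI.
by apply: smallest_sub => //; exact: approx_sigma.
Qed.

(** Generators at times before 1 are already known earlier; those at time 1 come from limits of
    earlier values by path continuity. *)
Let F1_approx : F 1 `<=` approx.
Proof.
apply: smallest_sub; first exact: approx_sigma.
move=> E [nE|[u [A [/andP[u0 u1] mA EA]]]].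
  by apply: (@F_approx 0%N); apply: sub_sigma_algebra; left.
move: u1; rewrite le_eqVlt => /predU1P[u1|u1].
  have h m : 0 <= before_one m <= before_one m by rewrite before_one_ge0 lexx.
  case: EA => ->; rewrite u1.
    by apply: (@approx_cvg _ (fun m => bd (before_one m))) => // m; exact: adapted_bd.
  by apply: (@approx_cvg _ (fun m => st (before_one m))) => // m; exact: adapted_st.
have [m um] := before_one_cvg u1.
apply: (@F_approx m); apply: sub_sigma_algebra; right.
by exists u, A; split => //; rewrite u0 ltW.
Qed.

(** At level [k] the events [xi >= (j + 1) / 2^k], [j < 4^k], are replaced by events known before 1,
    each with error below [8^-k]. The total error [2^-k] is summable, so almost surely all of them
    are exact for large [k]; their normalised count is then the dyadic floor of [xi] once
    [xi < 2^k]. *)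
Lemma adapted_approximation (xi : Omega -> R) : (forall w, 0 <= xi w) ->
  (forall A : set R, measurable A -> F 1 (xi @^-1` A)) ->
  exists (tm : nat -> R) (Z : nat -> Omega -> R),
  [/\ tm 0%N = 0, forall n, tm n < tm n.+1, forall n, tm n < 1,
     forall t, t < 1 -> exists n, t < tm n &
     [/\ forall w, Z 0%N w = 0, forall n, adapted P bd st (tm n) (Z n) &
        {ae P, forall w, Z n w @[n --> \oo] --> xi w}]].
Proof.
move=> xi0 xiF.
pose E k j := [set w | j.+1%:R / 2 ^+ k <= xi w].
have aE k j : approx (E k j).
  apply: F1_approx.
  have -> : E k j = xi @^-1` `[j.+1%:R / 2 ^+ k, +oo[.
    by apply/seteqP; split => w /=; rewrite in_itv/= andbT.
  by apply: xiF.
have e0 k : 0 < (8 ^+ k)^-1 :> R by rewrite invr_gt0 exprn_gt0.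
have /choice[mA hA] : forall kj : nat * nat, exists mA : nat * set Omega,
    F (before_one mA.1) mA.2 /\ (P (symd (E kj.1 kj.2) mA.2) < ((8 ^+ kj.1)^-1)%:E)%E.
  by move=> [k j]; have [_ /(_ _ (e0 k))[m [A h]]] := aE k j; exists (m, A).
pose A k j := (mA (k, j)).2.
pose M k := (\max_(j < 4 ^ k) (mA (k, nat_of_ord j)).1)%N.
have FA k j : (j < 4 ^ k)%N -> F (before_one (M k)) (A k j).
  move=> jk; apply: market_filtration_sub (proj1 (hA (k, j))).
  by apply: before_one_le; exact: (leq_bigmax (Ordinal jk)).
pose Z k w : R := (2 ^+ k)^-1 * \sum_(j < 4 ^ k) \1_(A k j) w.
have aZ k : adapted P bd st (before_one (M k)) (Z k).
  apply: measurable_funM => //; apply: measurable_sum => j.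
  by apply: measurable_indic; exact: FA.
(* The indices increase strictly and reach [M k] at step [k + 1], where [Z k] is therefore known.
   Shifting by one makes the sequence start with 0 at time 0. *)
pose mm := fix mm k := if k is k'.+1 then (maxn (mm k') (M k')).+1 else 0%N.
pose Zs k w := if k is k'.+1 then Z k' w else 0.
exists (fun k => before_one (mm k)), Zs; split.
- by rewrite /before_one/= invr1 subrr.
- by move=> n; apply: before_one_lt; rewrite /= ltnS leq_maxl.
- by move=> n; exact: before_one_lt1.
- move=> t /before_one_cvg[n tn]; exists n; apply: lt_le_trans tn _.
  apply: before_one_le; elim: n => // n IH.
  by rewrite /= ltnS; apply: leq_trans IH _; exact: leq_maxl.
split => //.
  case=> [|n]; first exact: measurable_cst.
  apply: adapted_sub (aZ n); apply: before_one_le.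
  by rewrite /= leqW// leq_maxr.
have mE k j : measurable (E k j) by have [] := aE k j.
have mA' k j : measurable (A k j).
  by apply: (mF _ (proj1 (hA (k, j)))); exact/ltW/before_one_lt1.
pose Bad k := \big[setU/set0]_(j < 4 ^ k) symd (E k j) (A k j).
have mBad k : measurable (Bad k) by apply: bigsetU_measurable => j _; exact: msymd.
have PBad k : (P (Bad k) <= (1 / 2 ^+ k)%:E)%E.
  have mEA j : (j < 4 ^ k)%N -> measurable (symd (E k j) (A k j)) by move=> _; exact: msymd.
  apply: le_trans (@Boole_inequality _ _ _ P _ _ mEA) _.
  apply: (@le_trans _ _ (\sum_(j < 4 ^ k) ((8 ^+ k)^-1)%:E)%E).
    by apply: lee_sum => j _; exact/ltW/(proj2 (hA (k, nat_of_ord j))).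
  rewrite sumEFin lee_fin sumr_const card_ord -[leLHS]mulr_natr natrX.
  have -> : 8 ^+ k = 2 ^+ k * 4 ^+ k :> R by rewrite -exprMn; congr (_ ^+ _); ring.
  by rewrite invfM mulfVK ?expf_neq0// mul1r.
apply: filterS (borel_cantelli ler01 mBad PBad) => w [N hN].
rewrite -(cvg_shiftS).
apply/cvgrPdist_lt => e e0'.
have [K xiK] : exists K, xi w < 2 ^+ K.
  exists (Num.truncn (xi w)).+1; apply: lt_trans (truncnS_gt _) _.
  by rewrite -natrX ltr_nat ltn_expl.
have [K' eK] : exists K, (2 ^+ K)^-1 < e.
  exists (Num.truncn (e^-1)).+1.
  rewrite -[e in X in _ < X]invrK ltf_pV2 ?posrE ?invr_gt0 ?exprn_gt0//.
  apply: lt_trans (truncnS_gt _) _.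
  by rewrite -natrX ltr_nat ltn_expl.
exists (maxn N (maxn K K')) => // k /=; rewrite !geq_max => /and3P[Nk Kk K'k].
have p2 : 0 < 2 ^+ k :> R by rewrite exprn_gt0.
have -> : Z k w = (2 ^+ k)^-1 * (Num.truncn (2 ^+ k * xi w))%:R.
  congr (_ * _).
  (* Off the exceptional sets the indicators are those of [j + 1 <= 2^k xi], and the number of such
     [j < 4^k] is the integer part. *)
  transitivity (\sum_(j < 4 ^ k) (j.+1%:R <= 2 ^+ k * xi w :> R)%:R : R).
    apply: eq_bigr => j _; rewrite indicE; congr (_%:R); congr nat_of_bool.
    have EA : A k j w <-> E k j w.
      have nB : ~ symd (E k j) (A k j) w.
        move=> h; apply: (hN k Nk); rewrite /Bad -(bigcup_mkord _ (fun j => symd (E k j) (A k j))).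
        by exists (nat_of_ord j); [exact: (ltn_ord j)|exact: h].
      split=> h; apply: contrapT => nh; apply: nB; [by right|by left].
    apply/idP/idP => [|h]; first by rewrite inE => /EA; rewrite /E/= ler_pdivrMr// mulrC.
    by rewrite inE; apply/EA; rewrite /E/= ler_pdivrMr// mulrC.
  have y0 : 0 <= 2 ^+ k * xi w by rewrite mulr_ge0// ltW.
  have yt : 2 ^+ k * xi w < (4 ^ k)%:R.
    rewrite (_ : 4 = 2 * 2)%N// expnMn natrM !natrX ltr_pM2l//.
    by apply: lt_le_trans xiK _; rewrite ler_weXn2l// ler1n.
  move: (2 ^+ k * xi w) y0 yt => y y0 yt.
  have jE (j : nat) : (j.+1%:R <= y) = (j < Num.truncn y)%N by rewrite -truncn_ge_nat.
  under eq_bigr do rewrite jE.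
  have tk : (Num.truncn y <= 4 ^ k)%N.
    rewrite -ltnS -(ltr_nat R); apply: (@le_lt_trans _ _ y).
      by rewrite truncn_le.
    by apply: lt_trans yt _; rewrite ltr_nat.
  rewrite -natr_sum; congr (_%:R).
  have S n (t : nat) : (\sum_(j < n) (j < t))%N = minn n t.
    elim: n => [|n IH]; first by rewrite big_ord0 min0n.
    rewrite big_ord_recr/= IH; lia.
  by rewrite S; exact/minn_idPr.
have y0 : 0 <= 2 ^+ k * xi w by rewrite mulr_ge0// ltW.
have /andP[h1 h2] := truncn_itv y0.
set t := (Num.truncn _)%:R in h1 *.
have -> : xi w - (2 ^+ k)^-1 * t = (2 ^+ k)^-1 * (2 ^+ k * xi w - t).
  by rewrite mulrBr mulKf// gt_eqF.
rewrite ger0_norm; last by rewrite mulr_ge0 ?invr_ge0 ?(ltW p2)// subr_ge0.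
apply: (@lt_trans _ _ (2 ^+ k)^-1); last first.
  by apply: le_lt_trans eK; rewrite lef_pV2 ?posrE ?exprn_gt0// ler_weXn2l// ler1n.
rewrite -[ltRHS]mulr1 ltr_pM2l ?invr_gt0// ltrBlDl.
by rewrite /t natr1.
Qed.

End approximation.

(** * Adapted left-continuous processes are predictable *)

Section predictability.
Context {d : measure_display} {Omega : measurableType d} {R : realType}.
Variables (P : probability Omega R) (bd st : R -> Omega -> R).
Local Notation F := (market_filtration P bd st).

Definition predictable_generators : set (set (R * Omega)) :=
  [set E | (exists A, F 0 A /\ E = [set 0] `*` A) \/
    exists (s t : R) (A : set Omega),
      [/\ 0 <= s, s < t, t <= 1, F s A & E = `]s, t] `*` A]].

Let D : set (R * Omega) := `[0, 1] `*` setT.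
Let T := g_sigma_algebraType predictable_generators.

(** Passes from the sigma-algebra on the whole product, where measurable functions are handled, to
    the one on [[0, 1]] times [Omega] with the same generators. *)
Lemma predictable_trace (E : set (R * Omega)) :
  <<s predictable_generators >> E -> predictable_sets F (D `&` E).
Proof.
have [S0 SD SU] := smallest_sigma_algebra D predictable_generators.
have : sigma_algebra setT [set E | <<s D, predictable_generators>> (D `&` E)].
  split=> [|A /= SA|A SA] /=.
  - by rewrite setI0.
  - by rewrite setTD; have := SD _ SA; rewrite setDIr setDv set0U setDE.
  - by rewrite setI_bigcupr; exact: SU.
move=> sH.
have GH : predictable_generators `<=` [set E | <<s D, predictable_generators>> (D `&` E)].
  move=> A GA /=; have SA : <<s D, predictable_generators>> A by exact: sub_sigma_algebra.
  by have := SD _ (SD _ SA); rewrite setDD.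
exact: (smallest_sub sH GH).
Qed.

Lemma F_setT s : F s setT.
Proof.
have [S0 SD _] := smallest_sigma_algebra setT (market_events P bd st s).
by have := SD _ S0; rewrite setD0.
Qed.

Lemma measurable_predictable_step (s t : R) (X : Omega -> R) : 0 <= s -> s < t -> t <= 1 ->
  adapted P bd st s X ->
  measurable_fun (setT : set T) (fun p => if (s < p.1) && (p.1 <= t) then X p.2 else 0).
Proof.
move=> s0 lst t1 /adaptedP aX.
have mI (A : set Omega) : F s A -> measurable (`]s, t] `*` A : set T).
  move=> FA; apply: sub_sigma_algebra; right.
  by exists s, t, A.
move=> _ B mB; rewrite setTI.
have E1 : (fun p : T => if (s < p.1) && (p.1 <= t) then X p.2 else 0) @^-1` B =
    (`]s, t] `*` (X @^-1` B)) `|` (if `[< B 0 >] then ~` (`]s, t] `*` setT) else set0).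
  apply/seteqP; split => -[x w] /=; rewrite !in_itv/=.
    case: ifPn => [xst Bx|xst B0]; first by left.
    by right; rewrite asboolT//= => -[]; rewrite in_itv/= (negbTE xst).
  case=> [[-> //]|]; case: asboolP => // B0 /=; rewrite in_itv/=.
  by case: ifPn => // h nh; case: nh.
rewrite E1; apply: measurableU; first by apply: mI; exact: aX.
case: asboolP => _; last exact: measurable0.
by apply: measurableC; apply: mI; exact: F_setT.
Qed.

Lemma measurable_predictable_zero (X : Omega -> R) : adapted P bd st 0 X ->
  measurable_fun (setT : set T) (fun p => if p.1 == 0 then X p.2 else 0).
Proof.
move=> /adaptedP aX.
have mI (A : set Omega) : F 0 A -> measurable ([set 0] `*` A : set T).
  by move=> FA; apply: sub_sigma_algebra; left; exists A.
move=> _ B mB; rewrite setTI.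
have E1 : (fun p : T => if p.1 == 0 then X p.2 else 0) @^-1` B =
    ([set 0] `*` (X @^-1` B)) `|` (if `[< B 0 >] then ~` ([set 0] `*` setT) else set0).
  apply/seteqP; split => -[x w] /=.
    case: eqP => [xst Bx|xst B0]; first by left.
    by right; rewrite asboolT//= => -[].
  case=> [[-> //]|]; first by rewrite eqxx.
  case: asboolP => // B0 /=.
  by case: eqP => // h nh; case: nh.
rewrite E1; apply: measurableU; first by apply: mI; exact: aX.
case: asboolP => _; last exact: measurable0.
by apply: measurableC; apply: mI; exact: F_setT.
Qed.

(** Separates time 1, where [Y] is 0 and left continuity is not assumed. *)
Lemma measurable_not_one : measurable ([set p | p.1 != 1] : set T).
Proof.
have m01 (t : R) : 0 < t -> t <= 1 -> measurable (`]0, t] `*` setT : set T).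
  move=> t0 t1; apply: sub_sigma_algebra; right.
  by exists 0, t, setT; split => //; exact: F_setT.
have mB : measurable (\bigcup_n (`]0, before_one n.+1] `*` setT) : set T).
  apply: bigcup_measurable => n _; apply: m01; last exact/ltW/before_one_lt1.
  exact: le_lt_trans (before_one_ge0 n) (before_one_lt (ltnSn n)).
suff -> : [set p : T | p.1 != 1] = ~` ((`]0, 1] `*` setT) `\`
    \bigcup_n (`]0, before_one n.+1] `*` setT)).
  by apply: measurableC; apply: measurableD => //; exact: m01.
apply/seteqP; split => -[t w] /=.
  move=> tn1 [[]]; rewrite in_itv/= => /andP[t0 t1] _; apply.
  have /before_one_cvg[n tn] : t < 1 by rewrite lt_neqAle tn1.
  exists n => //; split => //=; rewrite in_itv/= t0/=.
  by apply/ltW/(lt_trans tn); exact: before_one_lt.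
move=> h; apply/eqP => t1; apply: h; rewrite t1; split.
  by split => //=; rewrite in_itv/= ltr01 lexx.
by move=> [n _ [/=]]; rewrite in_itv/= => /andP[_]; rewrite leNgt before_one_lt1.
Qed.

Variable Y : R -> Omega -> R.
Hypothesis aY : forall t, 0 <= t < 1 -> adapted P bd st t (Y t).
Hypothesis lY : forall w t, 0 < t < 1 -> forall e, 0 < e ->
  exists2 dl, 0 < dl & forall s, 0 <= s -> t - dl < s < t -> `|Y s w - Y t w| < e.
Hypothesis Y1 : forall w, Y 1 w = 0.

Let k (n j : nat) : R := j%:R / n.+1%:R.
(** Freezes [Y] at the left point of each grid cell: predictable by adaptedness, and convergent to
    [Y] before time 1 by left continuity. *)
Let Yn (n : nat) (p : T) : R := (if p.1 == 0 then Y 0 p.2 else 0) +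
  \sum_(j < n.+1) (if (k n j < p.1) && (p.1 <= k n j.+1) then Y (k n j) p.2 else 0).

Let kS n j : k n j < k n j.+1.
Proof. by rewrite ltr_pM2r ?invr_gt0// ltr_nat. Qed.
Let k_le n i j : (i <= j)%N -> k n i <= k n j.
Proof. by move=> ij; rewrite ler_pM2r ?invr_gt0// ler_nat. Qed.
Let k0 n j : 0 <= k n j. Proof. by rewrite divr_ge0. Qed.
Let k1 n j : (j <= n.+1)%N -> k n j <= 1.
Proof. by move=> jn; rewrite ler_pdivrMr// mul1r ler_nat. Qed.
Let k1' n j : (j < n.+1)%N -> k n j < 1.
Proof. by move=> jn; rewrite ltr_pdivrMr// mul1r ltr_nat. Qed.

Let mYn n : measurable_fun setT (Yn n).
Proof.
apply: measurable_funD.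
  by apply: measurable_predictable_zero; apply: aY; rewrite lexx ltr01.
apply: measurable_sum => j; apply: measurable_predictable_step; [exact: k0|exact: kS|exact: k1|].
by apply: aY; rewrite k0 k1'.
Qed.

Let YnE n t w : 0 < t <= 1 -> exists j, [/\ k n j < t, t <= k n j.+1, (j < n.+1)%N & Yn n (t, w) = Y (k n j) w].
Proof.
move=> /andP[t0 t1].
have ex : exists j, t <= k n j.+1 by exists n; rewrite /k divff.
case: (ex_minnP ex) => j tj jmin.
have jn : (j < n.+1)%N by rewrite ltnS; apply: jmin; rewrite /k divff.
have kj : k n j < t.
  case: j tj jmin jn => [|j] tj jmin jn; first by rewrite /k mul0r.
  by rewrite ltNge; apply/negP => /jmin; rewrite ltnn.
exists j; split => //; rewrite /Yn /= gt_eqF// add0r.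
rewrite (bigD1 (Ordinal jn))//= kj tj /= big1 ?addr0// => i /negP ij.
case: ifP => // /andP[h1 h2]; case: ij; apply/eqP/val_inj => /=.
apply/eqP; rewrite eqn_leq; apply/andP; split; rewrite leqNgt; apply/negP => h.
  by have := lt_le_trans h1 tj; rewrite ltNge (k_le n h).
by have := lt_le_trans kj h2; rewrite ltNge (k_le n h).
Qed.

Lemma left_continuous_predictable : predictable F Y.
Proof.
pose Z (p : T) : R := if (0 <= p.1) && (p.1 < 1) then Y p.1 p.2 else 0.
have mZ : measurable_fun setT Z.
  pose Zn n (p : T) : R := Yn n p * \1_[set p : T | p.1 != 1] p.
  have mZn n : measurable_fun setT (Zn n).
    apply: measurable_funM => //; apply: measurable_indic.
    exact: measurable_not_one.
  apply: (measurable_fun_cvg mZn) => -[t w] _.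
  rewrite /Zn /Z /=.
  have [t1|t1] := ltP t 1; last first.
    rewrite andbF.
    have E n : Yn n (t, w) * \1_[set p : T | p.1 != 1] (t, w) = 0.
      move: t1; rewrite le_eqVlt => /predU1P[<-|t1].
        by rewrite indicE memNset ?mulr0//= eqxx.
      rewrite /Yn /= gt_eqF ?(lt_trans ltr01)// big1 ?addr0 ?mul0r// => j _.
      have kt : k n j.+1 < t by apply: le_lt_trans t1; exact: (k1 (ltn_ord j)).
      by rewrite [t <= _]leNgt kt andbF.
    by under eq_fun do rewrite E; exact: cvg_cst.
  rewrite andbT.
  have I1 : \1_[set p : T | p.1 != 1] (t, w) = 1 :> R.
    by rewrite indicE mem_set//= lt_eqF.
  under eq_fun do rewrite I1 mulr1.
  have [t0|t0] := leP 0 t; last first.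
    have E n : Yn n (t, w) = 0.
      rewrite /Yn /= lt_eqF// add0r big1// => j _.
      by rewrite [_ < t]ltNge (le_trans (ltW t0) (k0 n j)).
    by under eq_fun do rewrite E; exact: cvg_cst.
  move: t0; rewrite le_eqVlt => /predU1P[t0|t0].
    have E n : Yn n (t, w) = Y t w.
      rewrite /Yn /= -t0 eqxx big1 ?addr0// => j _.
      by rewrite ltNge k0.
    by under eq_fun do rewrite E; exact: cvg_cst.
  apply/cvgrPdist_lt => e e0.
  have [|dl dl0 hdl] := lY w (t := t) _ e0; first by rewrite t0.
  exists (Num.truncn (dl^-1)) => // n /= Nn.
  have [j [kj jt jn ->]] := YnE n w (t := t) ltac:(by rewrite t0 ltW).
  rewrite distrC; apply: hdl => //; rewrite kj andbT ltrBlDr.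
  apply: le_lt_trans jt _; rewrite /k -natr1 mulrDl mul1r ltrD2l.
  rewrite -[dl]invrK ltf_pV2 ?posrE ?invr_gt0//.
  by apply: lt_le_trans (truncnS_gt _) _; rewrite ler_nat.
move=> A mA.
have -> : D `&` [set p | A (Y p.1 p.2)] = D `&` (Z @^-1` A).
  have ZE t w : 0 <= t <= 1 -> Z (t, w) = Y t w.
    move=> /andP[t0]; rewrite /Z /= t0 le_eqVlt => /predU1P[->|->//].
    by rewrite ltxx Y1.
  by apply/seteqP; split => -[t w] [[/= h _] /=] Ap; split => //;
    move: h Ap; rewrite in_itv/= => /ZE; rewrite /preimage/= => ->.
by apply: predictable_trace; have := mZ measurableT A mA; rewrite setTI.
Qed.

End predictability.

(** * The bump function and one trading period *)

Section bump.
Context {R : realType}.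

(** It vanishes at 0, has values in [[0, 1]] and is close to 1 far from 0 on either side, so that
    large moves of either sign are gains. Being rational, it has a Taylor remainder in closed
    form. *)
Definition bump (x : R) : R := x ^+ 2 / (1 + x ^+ 2).
Definition dbump (x : R) : R := 2 * x / (1 + x ^+ 2) ^+ 2.

Let den (x : R) : 0 < 1 + x ^+ 2.
Proof. by rewrite ltr_pwDl// sqr_ge0. Qed.

Lemma bump0 : bump 0 = 0. Proof. by rewrite /bump expr0n mul0r. Qed.

Lemma bump_ge0 x : 0 <= bump x.
Proof. by rewrite divr_ge0 ?sqr_ge0// ltW. Qed.

Lemma bump_le1 x : bump x <= 1.
Proof. by rewrite ler_pdivrMr// mul1r lerDr. Qed.

Lemma bump_ge x : 2 <= `|x| -> 4 / 5 <= bump x.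
Proof.
move=> x2; have : 2 ^+ 2 <= x ^+ 2.
  by rewrite -(real_normK (num_real x)) ler_sqr ?nnegrE.
by rewrite /bump ler_pdivlMr//; lra.
Qed.

Lemma bump_taylor x y : `|bump y - bump x - dbump x * (y - x)| <= 2 * (y - x) ^+ 2.
Proof.
have dx := den x; have dy := den y.
have -> : bump y - bump x - dbump x * (y - x) =
    (y - x) ^+ 2 * ((1 - x ^+ 2 - 2 * x * y) / ((1 + x ^+ 2) ^+ 2 * (1 + y ^+ 2))).
  by rewrite /bump /dbump; field; rewrite !gt_eqF.
have d0 : 0 < (1 + x ^+ 2) ^+ 2 * (1 + y ^+ 2) by rewrite mulr_gt0// exprn_gt0.
rewrite normrM ger0_norm ?sqr_ge0// mulrC ler_wpM2r ?sqr_ge0//.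
rewrite normrM normfV (gtr0_norm d0) ler_pdivrMr//.
have x2 : 0 <= x ^+ 2 by exact: sqr_ge0.
have y2 : 0 <= y ^+ 2 by exact: sqr_ge0.
have xy1 : 0 <= (x + y) ^+ 2 by exact: sqr_ge0.
have xy2 : 0 <= (x - y) ^+ 2 by exact: sqr_ge0.
apply: (@le_trans _ _ (2 * ((1 + x ^+ 2) * (1 + y ^+ 2)))).
  have p0 : 0 <= x ^+ 2 * y ^+ 2 by rewrite mulr_ge0.
  move: xy1 xy2; rewrite sqrrD sqrrB -mulr_natl => xy1 xy2.
  rewrite ler_norml mulrDl mul1r mulrDr mulr1.
  by apply/andP; split; lra.
rewrite ler_pM2l// expr2 -mulrA ler_peMl ?mulr_ge0 ?(ltW dx) ?(ltW dy)//.
by rewrite lerDl.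
Qed.

End bump.

Section period.
Context {R : realType}.
Variables (X : R -> R) (a l K : R) (N : nat).
Hypotheses (a0 : 0 <= a) (l0 : 0 <= l) (al1 : a + l <= 1).

Definition mesh (a l : R) (N k : nat) : R := a + l * (k%:R / N.+1%:R).

(** The derivative of [x |-> bump (K (x - X a))] at the left mesh point: the exposure that the chain
    rule prescribes. *)
Definition weight (k : nat) : R := K * dbump (K * (X (mesh a l N k) - X a)).

Definition period_gain (t : R) : R := \sum_(k < N.+1) weight k *
  (X (Num.min t (mesh a l N k.+1)) - X (Num.min t (mesh a l N k))).

Definition period_position (t : R) : R :=
  \sum_(k < N.+1) weight k * box (mesh a l N k) (mesh a l N k.+1) (cst 1) t.

Local Notation u := (mesh a l N).

Lemma mesh0 : u 0 = a. Proof. by rewrite /mesh mul0r mulr0 addr0. Qed.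
Lemma meshN : u N.+1 = a + l. Proof. by rewrite /mesh divff ?mulr1. Qed.

Lemma mesh_le i j : (i <= j)%N -> u i <= u j.
Proof. by move=> ij; rewrite lerD2l ler_wpM2l// ler_pM2r ?invr_gt0// ler_nat. Qed.

Lemma mesh_ge k : a <= u k. Proof. by rewrite -{1}mesh0 mesh_le. Qed.

Lemma mesh_leN k : (k <= N.+1)%N -> u k <= a + l.
Proof. by move=> kN; rewrite -meshN mesh_le. Qed.

Lemma meshS k : u k.+1 - u k = l / N.+1%:R.
Proof. by rewrite /mesh -natr1; ring. Qed.

Lemma period_gain_before t : t <= a -> period_gain t = 0.
Proof.
move=> ta; rewrite /period_gain big1// => k _.
by rewrite !min_l ?subrr ?mulr0// (le_trans ta)// mesh_ge.
Qed.

Lemma period_gain_after t : a + l <= t -> period_gain t = period_gain (a + l).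
Proof.
move=> ta; apply: eq_bigr => k _; congr (_ * (X _ - X _)).
  by rewrite !min_r// ?(le_trans _ ta)// mesh_leN.
by rewrite !min_r// ?(le_trans _ ta)// mesh_leN// ltnW.
Qed.

Lemma period_position_before t : t <= a -> period_position t = 0.
Proof.
move=> ta; rewrite /period_position big1// => k _.
by rewrite /box ltNge (le_trans ta (mesh_ge k))/= mulr0.
Qed.

Lemma period_position_after t : a + l < t -> period_position t = 0.
Proof.
move=> ta; rewrite /period_position big1// => k _.
by rewrite /box [t <= _]leNgt (le_lt_trans (mesh_leN (ltn_ord k)) ta)/= andbF mulr0.
Qed.

(** The gain is a Riemann sum, compared cell by cell with a telescoping sum of [bump]. By
    [bump_taylor] a cell costs at most [2 K^2 C^2 (l / (N + 1))^(2 b)], and the [N + 1] cells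
    together are of order [(N + 1)^(1 - 2 b)]: this is where [b > 1/2] will matter. *)
Lemma period_gain_bump (C b t : R) : 0 <= b -> 0 <= C ->
  (forall x y, 0 <= x <= 1 -> 0 <= y <= 1 -> `|X x - X y| <= C * `|x - y| `^ b) ->
  0 <= t <= 1 ->
  `|period_gain t - bump (K * (X (Num.min t (a + l)) - X (Num.min t a)))| <=
    2 * C ^+ 2 * (K ^+ 2 * N.+1%:R `^ (1 - 2 * b)).
Proof.
move=> b0 C0 XC t01; have /andP[t0 t1] := t01.
have N0 : 0 < N.+1%:R :> R by rewrite ltr0n.
have B0 : 0 <= 2 * C ^+ 2 * (K ^+ 2 * N.+1%:R `^ (1 - 2 * b)).
  by apply: mulr_ge0; apply: mulr_ge0; rewrite ?sqr_ge0 ?powR_ge0.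
have [ta|a_t] := leP t a.
  rewrite period_gain_before// !min_l// ?subrr ?mulr0 ?bump0 ?subrr ?normr0//.
  by rewrite (le_trans ta)// lerDl.
pose s k := Num.min t (u k).
pose f k := bump (K * (X (s k) - X a)).
have s0 : s 0%N = a by rewrite /s mesh0 min_r// ltW.
have -> : bump (K * (X (Num.min t (a + l)) - X a)) = \sum_(k < N.+1) (f k.+1 - f k).
  rewrite -(big_mkord xpredT (fun k => f k.+1 - f k)) telescope_sumr//.
  by rewrite /f s0 subrr mulr0 bump0 subr0 /s meshN.
have s01 k : (k <= N.+1)%N -> 0 <= s k <= 1.
  move=> kN; rewrite /s le_min t0 (le_trans a0 (mesh_ge k))/=.
  by rewrite ge_min t1.
have sS k : `|s k.+1 - s k| <= l / N.+1%:R.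
  rewrite -(meshS k) /s; have := mesh_le (leqnSn k).
  have aux (p q : R) : p <= q -> `|Num.min t q - Num.min t p| <= q - p.
    move=> pq; have [tp|pt] := leP t p.
      by rewrite min_l ?(le_trans tp)// subrr normr0 subr_ge0.
    have [tq|qt] := leP t q; rewrite ger0_norm ?subr_ge0//; last exact: ltW.
    by rewrite lerD2r.
  exact: aux.
have XS k : (k < N.+1)%N -> (X (s k.+1) - X (s k)) ^+ 2 <= C ^+ 2 * (l / N.+1%:R) `^ (2 * b).
  move=> kN; have := XC (s k.+1) (s k) (s01 k.+1 kN) (s01 k (ltnW kN)).
  move=> h; have {}h : `|X (s k.+1) - X (s k)| <= C * (l / N.+1%:R) `^ b.
    apply: le_trans h _; rewrite ler_wpM2l// ge0_ler_powR ?nnegrE ?normr_ge0 ?divr_ge0//.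
  have -> : (l / N.+1%:R) `^ (2 * b) = ((l / N.+1%:R) `^ b) ^+ 2.
    by rewrite (mulrC 2) powRrM powR_mulrn ?powR_ge0.
  rewrite -exprMn -(real_normK (num_real (X _ - X _))) ler_sqr ?nnegrE//.
  by rewrite mulr_ge0// powR_ge0.
rewrite /period_gain -sumrB; apply: le_trans (ler_norm_sum _ _ _) _.
apply: (@le_trans _ _ (\sum_(k < N.+1) 2 * (K ^+ 2 * (C ^+ 2 * (l / N.+1%:R) `^ (2 * b))))).
  apply: ler_sum => k _.
  rewrite -/(s k.+1) -/(s k).
  have [tu|ut] := leP t (u k).
    have -> : s k.+1 = s k.
      by rewrite /s !min_l// (le_trans tu)// mesh_le.
    have -> : f k.+1 = f k.
      by rewrite /f /s !min_l// (le_trans tu)// mesh_le.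
    rewrite !subrr mulr0 subrr normr0; apply: mulr_ge0 => //.
    by apply: mulr_ge0; rewrite ?sqr_ge0//; apply: mulr_ge0; rewrite ?sqr_ge0 ?powR_ge0.
  have sk : s k = u k by rewrite /s min_r// ltW.
  have := bump_taylor (K * (X (s k) - X a)) (K * (X (s k.+1) - X a)).
  rewrite -/(f k) -/(f k.+1) distrC.
  have -> : K * (X (s k.+1) - X a) - K * (X (s k) - X a) = K * (X (s k.+1) - X (s k)).
    by rewrite -mulrBr opprB addrA subrK.
  have -> : dbump (K * (X (s k) - X a)) * (K * (X (s k.+1) - X (s k))) =
      weight k * (X (s k.+1) - X (s k)).
    by rewrite mulrA [X in X * _ = _]mulrC /weight -sk.
  move=> /le_trans; apply.
  by rewrite ler_pM2l// exprMn ler_wpM2l ?sqr_ge0// XS.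
rewrite sumr_const card_ord -[leLHS]mulr_natr.
have l1 : l <= 1 by apply: le_trans al1; rewrite lerDr.
have zN : (l / N.+1%:R) `^ (2 * b) * N.+1%:R <= N.+1%:R `^ (1 - 2 * b).
  rewrite addrC powRD; last by rewrite (gt_eqF N0) implybT.
  rewrite powRr1 ?(ltW N0)// ler_wpM2r ?(ltW N0)//.
  have -> : N.+1%:R `^ (- (2 * b)) = N.+1%:R^-1 `^ (2 * b).
    by rewrite -powR_inv1 ?(ltW N0)// -powRrM mulN1r.
  rewrite ge0_ler_powR ?nnegrE ?mulr_ge0 ?invr_ge0 ?(ltW N0)//.
  by rewrite ler_piMl// invr_ge0 ltW.
have -> : 2 * (K ^+ 2 * (C ^+ 2 * (l / N.+1%:R) `^ (2 * b))) * N.+1%:R =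
    2 * C ^+ 2 * (K ^+ 2 * ((l / N.+1%:R) `^ (2 * b) * N.+1%:R)) by ring.
by rewrite ler_wpM2l ?mulr_ge0 ?sqr_ge0// ler_wpM2l ?sqr_ge0.
Qed.

End period.

(** * The strategy along one path and its convergence *)

Lemma cvg_rsum {R : realType} {T : Type} (F : set_system T) {FF : Filter F} (I : Type)
    (s : seq I) (f : I -> T -> R) (a : I -> R) : (forall i, f i x @[x --> F] --> a i) ->
  \sum_(i <- s) f i x @[x --> F] --> \sum_(i <- s) a i.
Proof.
move=> fa; elim: s => [|i s IH].
  under eq_fun do rewrite big_nil; rewrite big_nil; exact: cvg_cst.
under eq_fun do rewrite big_cons; rewrite big_cons.
by apply: cvgD; [exact: fa|exact: IH].
Qed.

Section strategy.
Context {R : realType}.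
Variables (tm l K : nat -> R) (N : nat -> nat) (V0 : R).

Section path.
Variables (X : R -> R) (z : nat -> R).

Definition gain_in n t := period_gain X (tm n) (l n) (K n) (N n) t.
Definition position_in n t := period_position X (tm n) (l n) (K n) (N n) t.

(** In period [m] the stake is [z m - wealth m]; a gain of exactly 1 would bring wealth to the
    target [z m]. *)
Fixpoint wealth n : R :=
  if n is m.+1 then wealth m + (z m - wealth m) * gain_in m (tm m.+1) else V0.

Definition stake n : R := z n - wealth n.

Definition wealth_upto M t : R := V0 + \sum_(n < M) stake n * gain_in n t.
Definition position_upto M t : R := \sum_(n < M) stake n * position_in n t.

End path.

(** Some index [n] with [t <= tm n]; by [wealth_upto_extend] the choice is immaterial. If [t] lies
    beyond all [tm n] it is 0. *)
Definition horizon (t : R) : nat := xget 0%N [set n | t <= tm n].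

Definition dwealth X z t := wealth_upto X z (horizon t) t.
Definition dposition X z t := position_upto X z (horizon t) t.

Hypothesis tm0 : tm 0%N = 0.
Hypothesis l0 : forall n, 0 <= l n.
Hypothesis tml : forall n, tm n + l n <= tm n.+1.
Hypothesis tm1 : forall n, tm n < 1.
Hypothesis tm_cvg : forall t, t < 1 -> exists n, t < tm n.

Lemma tm_le m n : (m <= n)%N -> tm m <= tm n.
Proof.
elim: n => [|n IH]; first by rewrite leqn0 => /eqP ->.
rewrite leq_eqVlt => /predU1P[->//|/IH h]; apply: le_trans h _.
by apply: le_trans (tml n); rewrite lerDl.
Qed.

Lemma tm_ge0 n : 0 <= tm n. Proof. by rewrite -tm0 tm_le. Qed.

Lemma tml1 n : tm n + l n <= 1.
Proof. by apply: le_trans (tml n) (ltW (tm1 _)). Qed.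

Lemma horizonP t : t < 1 -> t <= tm (horizon t).
Proof. by move=> /tm_cvg[n tn]; apply: (@xgetI _ 0%N [set n | t <= tm n] n); exact: ltW. Qed.

Section path.
Variables (X : R -> R) (z : nat -> R).
Local Notation w_ := (wealth X z).

Lemma gain_in_before n t : t <= tm n -> gain_in X n t = 0.
Proof. by move=> h; apply: period_gain_before. Qed.

Lemma gain_in_after n t : tm n.+1 <= t -> gain_in X n t = gain_in X n (tm n.+1).
Proof.
have tn := tml n; move=> h; rewrite /gain_in period_gain_after ?(le_trans tn)//.
by rewrite [in RHS]period_gain_after.
Qed.

(** A period contributes nothing before it starts, so extra periods starting at or after [t] change
    nothing. *)
Lemma wealth_upto_extend M1 M2 t : t <= tm M1 -> t <= tm M2 ->
  wealth_upto X z M1 t = wealth_upto X z M2 t /\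
  position_upto X z M1 t = position_upto X z M2 t.
Proof.
suff main m n : (m <= n)%N -> t <= tm m -> wealth_upto X z n t = wealth_upto X z m t /\
    position_upto X z n t = position_upto X z m t.
  by move=> t1 t2; case: (leqP M1 M2) => [h|/ltnW h]; have [-> ->] := main _ _ h ltac:(assumption).
move=> mn tmm; elim: n mn => [|n IH]; first by rewrite leqn0 => /eqP ->.
rewrite leq_eqVlt => /predU1P[->//|]; rewrite ltnS => mn; have [<- <-] := IH mn.
have tn : t <= tm n by apply: le_trans tmm (tm_le mn).
rewrite /wealth_upto /position_upto !big_ord_recr/= gain_in_before//.
rewrite /position_in period_position_before//.
by rewrite !mulr0 !addr0.
Qed.

Lemma dwealthE M t : t <= tm M -> dwealth X z t = wealth_upto X z M t.
Proof.
move=> tM; have t1 : t < 1 by apply: le_lt_trans tM (tm1 M).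
by have [] := wealth_upto_extend (horizonP t1) tM.
Qed.

Lemma dpositionE M t : t <= tm M -> dposition X z t = position_upto X z M t.
Proof.
move=> tM; have t1 : t < 1 by apply: le_lt_trans tM (tm1 M).
by have [] := wealth_upto_extend (horizonP t1) tM.
Qed.

Lemma wealth_upto_tm M t : tm M <= t -> wealth_upto X z M t = w_ M.
Proof.
elim: M => [|M IH] Mt; first by rewrite /wealth_upto big_ord0 addr0.
rewrite /wealth_upto big_ord_recr/= addrA -/(wealth_upto X z M t) IH.
  by rewrite gain_in_after.
by apply: le_trans Mt; exact: tm_le.
Qed.

Lemma dwealth_in n t : tm n <= t <= tm n.+1 -> dwealth X z t = w_ n + stake X z n * gain_in X n t.
Proof.
move=> /andP[nt tn]; rewrite (dwealthE tn) /wealth_upto big_ord_recr/= addrA.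
by rewrite -/(wealth_upto X z n t) wealth_upto_tm.
Qed.

Lemma dwealth0 : dwealth X z 0 = V0.
Proof. by rewrite (@dwealthE 0%N) ?tm0// /wealth_upto big_ord0 addr0. Qed.

(** Let [e n] be the distance from wealth to target. As the final gain is within 1/2 of 1,
    [e (n+1) <= |z (n+1) - z n| + e n / 2], which drives [e n] to 0; the bound 2 on gains controls
    wealth inside the periods. *)
Lemma dwealth_cvg (y : R) : (z n @[n --> \oo] --> y) ->
  (exists n0, forall n, (n0 <= n)%N -> `|1 - gain_in X n (tm n.+1)| <= 1 / 2 /\
     forall t, tm n <= t <= tm n.+1 -> `|gain_in X n t| <= 2) ->
  dwealth X z t @[t --> 1^'-] --> y.
Proof.
move=> zy [n0 hn0].
pose e n := `|stake X z n|.
have eS n : (n0 <= n)%N -> e n.+1 <= `|z n.+1 - z n| + e n / 2.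
  move=> /hn0[h _]; rewrite /e /stake/=.
  have -> : z n.+1 - (w_ n + (z n - w_ n) * gain_in X n (tm n.+1)) =
      (z n.+1 - z n) + (z n - w_ n) * (1 - gain_in X n (tm n.+1)) by ring.
  apply: le_trans (ler_normD _ _) _; rewrite lerD2l normrM ler_wpM2l//.
  by rewrite -[leRHS]mul1r.
have e_cvg d : 0 < d -> exists n1, forall n, (n1 <= n)%N -> e n <= d.
  move=> d0.
  have [n1 hn1] : exists n1, forall n, (n1 <= n)%N -> `|z n.+1 - z n| <= d / 4.
    have d8 : 0 < d / 8 by rewrite divr_gt0.
    have /cvgrPdist_lt/(_ _ d8)[n1 _ h1] := zy.
    exists n1 => n n1n; have := h1 n n1n; have := h1 n.+1 (leqW n1n) => /= h2 h3.
    have -> : z n.+1 - z n = (y - z n) - (y - z n.+1) by ring.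
    apply: le_trans (ler_normB _ _) _; lra.
  pose m := maxn n0 n1.
  (* Iterating the contraction: perturbations of at most [d / 4] per step add up to at most
     [d / 2]. *)
  have em j : e (m + j)%N <= d / 2 + e m / 2 ^+ j.
    elim: j => [|j IH]; first by rewrite addn0 expr0 divr1 lerDr divr_ge0// ltW.
    have mj : (n0 <= m + j)%N by rewrite (leq_trans _ (leq_addr _ _))// leq_maxl.
    have mj1 : (n1 <= m + j)%N by rewrite (leq_trans _ (leq_addr _ _))// leq_maxr.
    have := eS _ mj; have := hn1 _ mj1; rewrite addnS => h1 h2.
    rewrite exprS invfM.
    have aux (p q r s t : R) : p <= d / 4 -> q <= p + r / 2 -> r <= d / 2 + t * s ->
        q <= d / 2 + t * (2^-1 * s) by lra.
    exact: aux h1 h2 IH.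
  have [j hj] : exists j, e m / (d / 2) < 2 ^+ j.
    exists (Num.truncn (e m / (d / 2))).+1; apply: lt_trans (truncnS_gt _) _.
    by rewrite -natrX ltr_nat ltn_expl.
  exists (m + j)%N => n mjn; have -> : (n = m + (n - m))%N.
    by rewrite subnKC// (leq_trans _ mjn)// leq_addr.
  apply: le_trans (em _) _.
  have : e m / 2 ^+ (n - m) <= d / 2.
    rewrite ler_pdivrMr ?exprn_gt0// mulrC -ler_pdivrMr ?divr_gt0//.
    apply: (le_trans (ltW hj)); rewrite ler_weXn2l ?ler1n//.
    by rewrite leq_subRL ?(leq_trans _ mjn)// leq_addr.
  by lra.
apply/cvgrPdist_lt => d d0.
have d8 : 0 < d / 8 by rewrite divr_gt0.
have [n1 hn1] := e_cvg _ d8.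
have /cvgrPdist_lt/(_ _ d8)[n2 _ hn2] := zy.
pose m := maxn n0 (maxn n1 n2).
near=> t.
have t1 : t < 1 by near: t; exact: nbhs_left_lt.
have mt : tm m < t by near: t; apply: nbhs_left_gt; exact: tm1.
have [n [mn nt]] : exists n, (m <= n)%N /\ tm n <= t <= tm n.+1.
  have ex : exists n, t <= tm n by have [n /ltW tn] := tm_cvg t1; exists n.
  case: (ex_minnP ex) => -[|n] tn nmin.
    by have := lt_le_trans mt tn; rewrite ltNge tm_le.
  exists n; rewrite tn andbT; split.
    by rewrite leqNgt; apply/negP => h; have := lt_le_trans mt tn; rewrite ltNge tm_le.
  by rewrite leNgt; apply/negP => /ltW/nmin; rewrite ltnn.
move: mn; rewrite !geq_max => /and3P[n0n n1n n2n].
rewrite (dwealth_in nt).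
have [_ /(_ _ nt) g2] := hn0 _ n0n.
have := hn1 _ n1n; have := hn2 _ n2n; rewrite /e /= => h2 h1.
have -> : y - (w_ n + stake X z n * gain_in X n t) =
    (y - z n) + (stake X z n - stake X z n * gain_in X n t).
  by rewrite /stake; ring.
apply: le_lt_trans (ler_normD _ _) _.
apply: le_lt_trans (lerD (lexx _) (ler_normB _ _)) _; rewrite normrM.
have : `|stake X z n| * `|gain_in X n t| <= `|stake X z n| * 2 by rewrite ler_wpM2l.
by lra.
Unshelve. all: by end_near.
Qed.

Lemma box_left_cvg (a c t : R) : box a c (cst 1) s @[s --> t^'-] --> box a c (cst 1) t.
Proof.
apply: cvg_near_cst.
have [a_t|ta] := ltP a t; last first.
  near=> s.
  have st : s < t by near: s; exact: nbhs_left_lt.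
  have sa : s <= a by exact: le_trans (ltW st) ta.
  by rewrite /box !ltNge ta sa.
have [tc|ct] := leP t c.
  near=> s.
  have st : s < t by near: s; exact: nbhs_left_lt.
  have sa : a < s by near: s; exact: nbhs_left_gt.
  by rewrite /box a_t tc sa (le_trans (ltW st) tc).
near=> s.
have sc : c < s by near: s; exact: nbhs_left_gt.
by rewrite /box [t <= c]leNgt ct [s <= c]leNgt sc !andbF.
Unshelve. all: by end_near.
Qed.

Lemma dposition_left_cvg t : t < 1 -> dposition X z s @[s --> t^'-] --> dposition X z t.
Proof.
move=> t1; have [M tM] := tm_cvg t1.
rewrite (dpositionE (ltW tM)).
apply: (@cvg_trans _ (position_upto X z M s @[s --> t^'-])).
  apply: near_eq_cvg; near=> s.
  rewrite (@dpositionE M)//; apply: le_trans (ltW tM).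
  by apply/ltW; near: s; exact: nbhs_left_lt.
rewrite /position_upto; apply: cvg_rsum => n; apply: cvgMl_tmp.
rewrite /position_in /period_position; apply: cvg_rsum => k; apply: cvgMl_tmp.
exact: box_left_cvg.
Unshelve. all: by end_near.
Qed.

Lemma dwealth_left_cvg t : continuous X -> t < 1 -> dwealth X z s @[s --> t^'-] --> dwealth X z t.
Proof.
move=> cX t1; have [M tM] := tm_cvg t1.
rewrite (dwealthE (ltW tM)).
apply: (@cvg_trans _ (wealth_upto X z M s @[s --> t^'-])).
  apply: near_eq_cvg; near=> s.
  rewrite (@dwealthE M)//; apply: le_trans (ltW tM).
  by apply/ltW; near: s; exact: nbhs_left_lt.
have cm c : {for t, continuous (fun s => X (Num.min s c))}.
  apply: continuous_comp; last exact: cX.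
  apply: (@lipschitz_continuous_real _ (fun s => Num.min s c) 1) => x y.
  rewrite mul1r; case: (leP x c) => xc; case: (leP y c) => yc //.
  - by rewrite !ler0_norm; lra.
  - by rewrite !ger0_norm; lra.
  - by rewrite subrr normr0.
suff : {for t, continuous (wealth_upto X z M)} by apply: cvg_at_left_filter.
apply: cvgD; first exact: cvg_cst.
apply: cvg_rsum => n; apply: cvgMl_tmp.
rewrite /gain_in /period_gain; apply: cvg_rsum => k; apply: cvgMl_tmp.
by apply: cvgB; exact: cm.
Unshelve. all: by end_near.
Qed.

End path.

End strategy.

(** * Adaptedness and gains of the strategy *)

Section strategy_adapted.
Context {d : measure_display} {Omega : measurableType d} {R : realType}.
Variables (P : probability Omega R) (bd st : R -> Omega -> R).
Variables (tm l K : nat -> R) (N : nat -> nat) (V0 : R).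
Hypothesis tm0 : tm 0%N = 0.
Hypothesis l0 : forall n, 0 <= l n.
Hypothesis tml : forall n, tm n + l n <= tm n.+1.
Hypothesis tm1 : forall n, tm n < 1.
Variables (X : Omega -> R -> R) (z : nat -> Omega -> R).
Local Notation ad := (adapted P bd st).
Hypothesis aX : forall u, 0 <= u <= 1 -> ad u (X ^~ u).
Hypothesis az : forall n, ad (tm n) (z n).

Let tm_0 n : 0 <= tm n. Proof. exact: (tm_ge0 tm0 l0 tml). Qed.
Let tml_1 n : tm n + l n <= 1. Proof. exact: (tml1 tml tm1). Qed.

Let Xat u t : 0 <= u -> u <= t -> t <= 1 -> ad t (X ^~ u).
Proof.
by move=> u0 ut t1; apply: (adapted_sub ut); apply: aX; rewrite u0 (le_trans ut).
Qed.

Let adapted_weight n k t : mesh (tm n) (l n) (N n) k <= t -> t <= 1 ->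
  ad t (fun w => weight (X w) (tm n) (l n) (K n) (N n) k).
Proof.
move=> ut t1; apply: measurable_funM => //.
have tu : tm n <= mesh (tm n) (l n) (N n) k by exact: mesh_ge.
have m1 : ad t (fun w => K n * (X w (mesh (tm n) (l n) (N n) k) - X w (tm n))).
  apply: measurable_funM => //; apply: measurable_funB.
    by apply: Xat => //; apply: le_trans tu.
  by apply: Xat => //; apply: le_trans ut.
have md : measurable_fun setT (@dbump R).
  apply: continuous_measurable_fun => x; rewrite /dbump.
  apply: cvgM; first by apply: cvgM; [exact: cvg_cst|exact: cvg_id].
  have c1 : 1 + x0 ^+ 2 @[x0 --> x] --> 1 + x ^+ 2.
    by apply: cvgD; [exact: cvg_cst|exact: exprn_continuous].
  apply: cvgV; first by rewrite expf_neq0// gt_eqF// ltr_pwDl// sqr_ge0.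
  exact: (continuous_comp c1 (@exprn_continuous _ 2 _)).
exact: (measurableT_comp md m1).
Qed.

(** Cells not yet begun at [t] contribute 0; for the others the weight uses prices up to [t]
    only. *)
Let adapted_gain_in n t : t <= 1 -> tm n <= t -> ad t (fun w => gain_in tm l K N (X w) n t).
Proof.
move=> t1 nt; apply: measurable_sum => k.
set u0 := mesh (tm n) (l n) (N n) k; set u1 := mesh (tm n) (l n) (N n) k.+1.
have u01 : u0 <= u1 by exact: mesh_le.
have u00 : 0 <= u0 by apply: le_trans (tm_0 n) _; exact: mesh_ge.
have t0 : 0 <= t by exact: le_trans (tm_0 n) nt.
have [tu|/ltW ut] := leP t u0.
  under eq_fun do rewrite (min_l (le_trans tu u01)) subrr mulr0.
  exact: measurable_cst.
apply: measurable_funM; first exact: adapted_weight.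
apply: measurable_funB; apply: Xat => //; rewrite ?ge_min ?lexx ?le_min ?t0//.
exact: le_trans u01.
Qed.

Let adapted_wealth n : ad (tm n) (fun w => wealth tm l K N V0 (X w) (z ^~ w) n).
Proof.
elim: n => [|n IH]; first exact: measurable_cst.
have le_n : tm n <= tm n.+1 by exact: (tm_le l0 tml).
have IH' : ad (tm n.+1) (fun w => wealth tm l K N V0 (X w) (z ^~ w) n) by exact: (adapted_sub le_n IH).
apply: measurable_funD; first exact: IH'.
apply: measurable_funM.
  have az' : ad (tm n.+1) (z n) by apply: adapted_sub le_n _; exact: az.
  by apply: measurable_funB; [exact: az'|exact: IH'].
by apply: adapted_gain_in => //; exact: ltW.
Qed.

Let adapted_stake n t : tm n <= t -> ad t (fun w => stake tm l K N V0 (X w) (z ^~ w) n).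
Proof.
move=> nt; apply: (adapted_sub nt); apply: measurable_funB; first exact: az.
exact: adapted_wealth.
Qed.

(** The number of terms, [horizon t], is deterministic, and a period not begun at [t] contributes 0,
    so no stake is used before it is known. *)
Lemma adapted_dwealth t : 0 <= t <= 1 -> ad t (fun w => dwealth tm l K N V0 (X w) (z ^~ w) t).
Proof.
move=> /andP[t0 t1]; apply: measurable_funD => //; apply: measurable_sum => n.
have [tn|/ltW nt] := leP t (tm n).
  under eq_fun do rewrite (gain_in_before _ _ l0) ?mulr0//.
  exact: measurable_cst.
by apply: measurable_funM; [exact: adapted_stake|exact: adapted_gain_in].
Qed.

Lemma adapted_dposition t : 0 <= t <= 1 -> ad t (fun w => dposition tm l K N V0 (X w) (z ^~ w) t).
Proof.
move=> /andP[t0 t1]; apply: measurable_sum => n.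
have [tn|/ltW nt] := leP t (tm n).
  under eq_fun do rewrite /position_in (period_position_before _ _ _ (l0 n) tn) mulr0.
  exact: measurable_cst.
apply: measurable_funM; first exact: adapted_stake.
apply: measurable_sum => k.
have [tu|/ltW ut] := leP t (mesh (tm n) (l n) (N n) k).
  under eq_fun do rewrite /box ltNge tu mulr0.
  exact: measurable_cst.
by apply: measurable_funM; [exact: adapted_weight|exact: measurable_cst].
Qed.

End strategy_adapted.

Section strategy_gain.
Context {R : realType}.
Variables (al b : R).
Hypotheses (al01 : 0 < al < 1) (alb : 1 - al < b) (b1 : b <= 1).
Variables (rr : R -> R) (Cr : R) (g : R -> R) (C : R).
Hypothesis mrr : measurable_fun (`[0, 1]%classic : set R) rr.
Hypothesis hrr : forall s, 0 <= s <= 1 -> `|rr s| <= Cr.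
Hypothesis hg : holder01 b C g.
Variables (mu sg : R).
Variables (tm l K : nat -> R) (N : nat -> nat) (V0 : R) (z : nat -> R).
Hypothesis tm0 : tm 0%N = 0.
Hypothesis l0 : forall n, 0 <= l n.
Hypothesis tml : forall n, tm n + l n <= tm n.+1.
Hypothesis tm1 : forall n, tm n < 1.
Local Notation X := (asset rr g mu sg).

(** Linearity: a constant wealth plus multiples of [gain_block], one for each cell of each period.
    Stakes and weights are mere constants here, the path being fixed. *)
Lemma strategy_gain M : gain al rr g mu sg
  (position_upto tm l K N V0 X z M) (wealth_upto tm l K N V0 X z M).
Proof.
have block n (k : 'I_(N n).+1) : gain al rr g mu sg
    (box (mesh (tm n) (l n) (N n) k) (mesh (tm n) (l n) (N n) k.+1) (cst 1))
    (fun u => X (Num.min u (mesh (tm n) (l n) (N n) k.+1)) -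
              X (Num.min u (mesh (tm n) (l n) (N n) k))).
  apply: (gain_block al01 alb b1 mrr hrr hg).
  - by apply: le_trans (tm_ge0 tm0 l0 tml n) _; exact: mesh_ge.
  - exact: mesh_le.
  - by apply: le_trans (tml1 tml tm1 n); apply: mesh_leN.
have per n : gain al rr g mu sg
    (position_in tm l K N X n) (gain_in tm l K N X n).
  exact: (gain_sum al01 alb b1 mrr hrr hg (index_enum _)
    (fun k : 'I_(N n).+1 => weight X (tm n) (l n) (K n) (N n) k) (block n)).
have tot := gain_sum al01 alb b1 mrr hrr hg (index_enum 'I_M)
  (fun n : 'I_M => stake tm l K N V0 X z n) (fun n : 'I_M => per n).
have res := gainD al01 alb hg (gain_cst al01 alb b1 mrr hrr hg mu sg V0) tot.
have -> : position_upto tm l K N V0 X z M = fun u => cst 0 u +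
    \sum_(n < M) stake tm l K N V0 X z n * position_in tm l K N X n u.
  by apply/funext => u; rewrite add0r.
exact: res.
Qed.

End strategy_gain.

(** * Choice of the period lengths, scales and meshes *)

Section parameters.
Context {R : realType}.

(** Since [1 - H > 0], a small [l] satisfies [c l <= (eps / 12) l^H]; then [K] is set so that
    [2 / K = eps l^H / 12]. The bounded quantity is the small-ball estimate for an increment over
    time [l] not exceeding [2 / K] plus a drift [c l]. *)
Lemma small_scale (H c gap eps : R) : 0 < H -> H < 1 -> 0 <= c -> 0 < gap -> 0 < eps ->
  exists l K : R, [/\ 0 < l, l <= gap, 0 < K & 6 * (2 / K + c * l) / l `^ H <= eps].
Proof.
move=> H0 H1 c0 gap0 eps0.
have H1' : 0 < 1 - H by rewrite subr_gt0.
pose y := eps / (12 * (c + 1)).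
have c1 : 0 < c + 1 by rewrite ltr_wpDl.
have y0 : 0 < y by rewrite divr_gt0// mulr_gt0.
pose l := Num.min gap (y `^ (1 - H)^-1).
have l0 : 0 < l by rewrite lt_min gap0 powR_gt0.
have lH0 : 0 < l `^ H by rewrite powR_gt0.
exists l, (24 / (eps * l `^ H)); split => //.
- by rewrite ge_min lexx.
- by rewrite divr_gt0// mulr_gt0.
have ly : l `^ (1 - H) <= y.
  apply: (@le_trans _ _ ((y `^ (1 - H)^-1) `^ (1 - H))).
    by rewrite ge0_ler_powR ?nnegrE ?powR_ge0 ?(ltW l0) ?(ltW H1')// ge_min lexx orbT.
  by rewrite -powRrM mulVf ?gt_eqF// powRr1// ltW.
have lE : l = l `^ (1 - H) * l `^ H.
  by rewrite -powRD ?subrK ?powRr1 ?(ltW l0)// oner_eq0.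
rewrite ler_pdivrMr//.
have -> : 2 / (24 / (eps * l `^ H)) = eps * l `^ H / 12.
  by field; rewrite !gt_eqF.
have h : c * l <= eps / 12 * l `^ H.
  rewrite {1}lE mulrA ler_wpM2r ?(ltW lH0)//.
  apply: (@le_trans _ _ ((c + 1) * y)).
    by rewrite ler_pM ?powR_ge0// lerDl.
  by rewrite le_eqVlt; apply/orP; left; apply/eqP; rewrite /y; field; rewrite gt_eqF.
have aux (e p q : R) : q <= e / 12 * p -> 6 * (e * p / 12 + q) <= e * p by lra.
exact: aux.
Qed.

Lemma fine_mesh (b y : R) : 1 / 2 < b -> 0 < y -> exists N : nat, y * N.+1%:R `^ (1 - 2 * b) <= 1.
Proof.
move=> b2 y0; have b0 : 0 < 2 * b - 1 by lra.
exists (Num.truncn (y `^ (2 * b - 1)^-1)).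
set N := Num.truncn _.
have N0 : 0 < N.+1%:R :> R by rewrite ltr0n.
have -> : 1 - 2 * b = - (2 * b - 1) by ring.
rewrite powRN ler_pdivrMr ?powR_gt0// mul1r.
apply: (@le_trans _ _ ((y `^ (2 * b - 1)^-1) `^ (2 * b - 1))).
  by rewrite -powRrM mulVf ?gt_eqF// powRr1// ltW.
rewrite ge0_ler_powR ?nnegrE ?powR_ge0 ?(ltW b0) ?(ltW N0)//.
exact/ltW/truncnS_gt.
Qed.

Lemma continuous_clamp01 (f : R -> R) : {within `[0, 1], continuous f} ->
  continuous (f \o clamp01).
Proof.
move=> cf x; apply/cvgrPdist_lt => e e0.
have [dl dl0 h] := within01_continuousP cf (clamp01_itv x) e0.
near=> y; apply: h; first exact: clamp01_itv.
apply: le_lt_trans (clamp01_lip _ _) _.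
by near: y; apply: cvgr_dist_lt.
Unshelve. all: by end_near.
Qed.

End parameters.

Section good_periods.
Context {R : realType}.
Variables (tm l K : nat -> R) (N : nat -> nat) (b C : R) (X : R -> R).
Hypothesis tm0 : tm 0%N = 0.
Hypothesis l0 : forall n, 0 <= l n.
Hypothesis tml : forall n, tm n + l n <= tm n.+1.
Hypothesis tm1 : forall n, tm n < 1.
Hypothesis b0 : 0 <= b.
Hypothesis C0 : 0 <= C.
Hypothesis XC : forall x y, 0 <= x <= 1 -> 0 <= y <= 1 -> `|X x - X y| <= C * `|x - y| `^ b.
Hypothesis K0 : forall n, 0 < K n.
Hypothesis KN : forall n, n.+1%:R * K n ^+ 2 * (N n).+1%:R `^ (1 - 2 * b) <= 1.

(** The factor [n + 1] in [KN] absorbs the random Holder constant, so that [K] and [N] can be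
    deterministic: once [n + 1 >= 8 C^2] the gain is within 1/4 of [bump]. After a large enough move
    [bump] lies in [[4/5, 1]], and [1/4 + 1/5 <= 1/2]. *)
Lemma good_periods :
  (exists n0, forall n, (n0 <= n)%N -> 2 / K n <= `|X (tm n + l n) - X (tm n)|) ->
  exists n0, forall n, (n0 <= n)%N -> `|1 - gain_in tm l K N X n (tm n.+1)| <= 1 / 2 /\
     forall t, tm n <= t <= tm n.+1 -> `|gain_in tm l K N X n t| <= 2.
Proof.
move=> [n0 hn0].
have C2 : 0 <= 8 * C ^+ 2 by rewrite mulr_ge0// sqr_ge0.
pose n1 := Num.truncn (8 * C ^+ 2).
have err n t : (n1 <= n)%N -> 0 <= t <= 1 ->
    `|gain_in tm l K N X n t - bump (K n * (X (Num.min t (tm n + l n)) - X (Num.min t (tm n))))| <= 1 / 4.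
  move=> n1n t01.
  apply: le_trans (period_gain_bump (K n) (N n) (tm_ge0 tm0 l0 tml n) (l0 n) (tml1 tml tm1 n) b0 C0 XC t01) _.
  have h1 : 8 * C ^+ 2 <= n.+1%:R.
    by apply/ltW; apply: lt_le_trans (truncnS_gt _) _; rewrite ler_nat.
  have z0 : 0 <= K n ^+ 2 * (N n).+1%:R `^ (1 - 2 * b).
    by apply: mulr_ge0; rewrite ?sqr_ge0 ?powR_ge0.
  have := ler_wpM2r z0 h1; have := KN n; rewrite -mulrA.
  have aux (p q c : R) : p * q <= 1 -> 8 * c * q <= p * q -> 2 * c * q <= 1 / 4 by lra.
  exact: aux.
exists (maxn n0 n1) => n; rewrite geq_max => /andP[n0n n1n].
have t0 m : 0 <= tm m by exact: (tm_ge0 tm0 l0 tml).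
split.
  have := err n (tm n.+1) n1n; rewrite t0 ltW// => /(_ isT).
  rewrite min_r// min_r; last by apply: le_trans (tml n); rewrite lerDl.
  set B := bump _.
  have B1 : B <= 1 by exact: bump_le1.
  have B2 : 4 / 5 <= B.
    apply: bump_ge; rewrite normrM gtr0_norm//.
    by rewrite mulrC -ler_pdivrMr// hn0.
  rewrite ler_norml => /andP[h1 h2]; rewrite ler_norml.
  by apply/andP; split; lra.
move=> t /andP[nt tn].
have := err n t n1n; rewrite (le_trans (t0 n) nt) (le_trans tn (ltW (tm1 _))) => /(_ isT).
set B := bump _.
have B1 : B <= 1 by exact: bump_le1.
have B0 : 0 <= B by exact: bump_ge0.
rewrite ler_norml => /andP[h1 h2]; rewrite ler_norml.
by apply/andP; split; lra.
Qed.

End good_periods.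

Lemma asset_increment {R : realType} (rr g : R -> R) (Cr mu sg x y : R) : sg != 0 ->
  measurable_fun (`[0, 1]%classic : set R) rr -> (forall s, 0 <= s <= 1 -> `|rr s| <= Cr) ->
  x <= y -> `|g y - g x| - kappa_bound Cr mu sg * (y - x) <= `|asset rr g mu sg y - asset rr g mu sg x|.
Proof.
move=> sg0 mrr hrr xy.
have h : `|(mu * (y - x) - (logbond rr y - logbond rr x)) / sg| <= kappa_bound Cr mu sg * (y - x).
  have sg0' : 0 < `|sg| by rewrite normr_gt0.
  rewrite normrM normfV /kappa_bound mulrAC ler_wpM2r ?invr_ge0//.
  apply: le_trans (ler_normB _ _) _; rewrite mulrDl; apply: lerD.
    by rewrite normrM [`|y - x|]ger0_norm// subr_ge0.
  have := logbond_lipT mrr hrr x y.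
  by rewrite [`|y - x|]ger0_norm// subr_ge0.
have -> : asset rr g mu sg y - asset rr g mu sg x =
   (g y - g x) + (mu * (y - x) - (logbond rr y - logbond rr x)) / sg.
  by rewrite /asset; field.
rewrite lerBlDr; apply: le_trans (lerD (lexx _) h).
rewrite -[X in _ <= _ + X]normrN; apply: le_trans (ler_normD _ _).
by rewrite addrK.
Qed.

(** * The portfolio on the market *)

Section market_model.
Context {R : realType} {d : measure_display} {Omega : measurableType d}.
Variables (P : probability Omega R) (H : R).
Variables (BH : R -> Omega -> R) (r : R -> Omega -> R) (S0 mu sigma : R).
Hypothesis BH_fBm : is_fBm P H BH.
Hypothesis rb : bounded_rate r.
Hypothesis S0_gt0 : 0 < S0.
Hypothesis sigma_neq0 : sigma != 0.

Local Notation bd := (bond r).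
Local Notation st := (stock S0 mu sigma BH).
Local Notation ad := (adapted P bd st).

(** The path of [BH] frozen outside [[0, 1]], hence continuous on the whole line. *)
Definition noise (w : Omega) : R -> R := (BH ^~ w) \o clamp01.
Definition price (w : Omega) : R -> R := asset (r ^~ w) (noise w) mu sigma.

Lemma rate_bound : exists Cr, forall w s, 0 <= s <= 1 -> `|r s w| <= Cr.
Proof. by have [_ [C h]] := rb; exists C => w s; exact: h. Qed.

Lemma bond_gt0 t w : 0 < bd t w. Proof. exact: expR_gt0. Qed.

Lemma stock_gt0 t w : 0 < st t w.
Proof. by rewrite mulr_gt0// expR_gt0. Qed.

Lemma measurable_stock u : 0 <= u <= 1 -> measurable_fun setT (st u).
Proof.
move=> u01; apply: measurable_funM => //; apply: measurableT_comp => //.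
apply: measurable_funD => //; apply: measurable_funM => //.
exact: (fBm_measurable BH_fBm).
Qed.

Lemma noiseE w u : 0 <= u <= 1 -> noise w u = BH u w.
Proof. by move=> u01; rewrite /noise /= clamp01_id. Qed.

Lemma continuous_noise w : continuous (noise w).
Proof. by apply: continuous_clamp01; exact: (fBm_continuous BH_fBm). Qed.

Lemma continuous_price w : continuous (price w).
Proof.
have [Cr hr] := rate_bound; move=> t.
apply: cvgD; first exact: continuous_noise.
apply: cvgMr_tmp; apply: cvgB; first by apply: cvgMl_tmp; exact: cvg_id.
exact: (continuous_logbond (measurable_rate_path rb w) (hr w)).
Qed.

Lemma bond_stock_limit w :
  bd (before_one n) w @[n --> \oo] --> bd 1 w /\ st (before_one n) w @[n --> \oo] --> st 1 w.
Proof.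
have [Cr hr] := rate_bound.
have b01 n : 0 <= (before_one n : R) <= 1 by rewrite before_one_ge0 ltW// before_one_lt1.
have one01 : 0 <= (1 : R) <= 1 by rewrite ler01 lexx.
have lim (f : R -> R) : continuous f -> f (before_one n) @[n --> \oo] --> f 1.
  by move=> cf; apply: (cvg_comp _ _ (@cvg_before_one R)); exact: cf.
split.
  rewrite (bond_bondp _ w one01); under eq_fun do rewrite (bond_bondp _ w (b01 _)).
  exact: (lim _ (continuous_bondp (measurable_rate_path rb w) (hr w))).
have -> : st 1 w = S0 * expR (mu * 1 + sigma * noise w 1) by rewrite noiseE.
have -> : (fun n => st (before_one n) w) =
    (fun n => (fun t => S0 * expR (mu * t + sigma * noise w t)) (before_one n)).
  by apply/funext => n; rewrite noiseE.
apply: (lim (fun t => S0 * expR (mu * t + sigma * noise w t))) => t; apply: cvgMl_tmp.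
apply: (cvg_comp _ expR); last exact: continuous_expR.
by apply: cvgD; apply: cvgMl_tmp; [exact: cvg_id|exact: continuous_noise].
Qed.

(** The price is a function of the bond and the stock at time [u], through their logarithms. *)
Lemma adapted_price u : 0 <= u <= 1 -> ad u (price ^~ u).
Proof.
move=> u01; have uu : 0 <= u <= u by case/andP: u01 => ->; rewrite lexx.
have aB := @adapted_bd _ _ _ P bd st _ _ uu; have aS := @adapted_st _ _ _ P bd st _ _ uu.
have -> : price ^~ u = fun w => (ln (st u w / S0) - mu * u) / sigma + (mu * u - ln (bd u w)) / sigma.
  apply/funext => w; rewrite /price /asset noiseE// (bond_bondp _ w u01) /bondp expRK.
  have -> : ln (st u w / S0) = mu * u + sigma * BH u w.
    by rewrite /stock [S0 * _]mulrC mulfK ?gt_eqF// expRK.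
  by field.
apply: measurable_funD; apply: measurable_funM => //.
  apply: measurable_funB => //; apply: measurableT_comp; first exact: measurable_ln.
  by apply: measurable_funM.
by apply: measurable_funB => //; apply: measurableT_comp; first exact: measurable_ln.
Qed.

Lemma noise_holder b : 0 < b -> b < H ->
  {ae P, forall w, exists2 C, 0 <= C & holder01 b C (noise w)}.
Proof.
move=> b0 bH; apply: filterS (fBm_holder BH_fBm b0 bH) => w [C hC].
exists `|C| => //; split; first by apply: continuous_measurable_fun; exact: continuous_noise.
move=> x y x01 y01; rewrite !noiseE//; apply: le_trans (hC x y x01 y01) _.
by rewrite ler_wpM2r ?powR_ge0// ler_norm.
Qed.

Section strategy.
Variables (tm l K : nat -> R) (N : nat -> nat) (V0 : R) (z : nat -> Omega -> R).
Hypothesis tm0 : tm 0%N = 0.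
Hypothesis l0 : forall n, 0 <= l n.
Hypothesis tml : forall n, tm n + l n <= tm n.+1.
Hypothesis tm1 : forall n, tm n < 1.
Hypothesis tm_cvg : forall t, t < 1 -> exists n, t < tm n.
Hypothesis az : forall n, ad (tm n) (z n).

Definition disc_wealth t w := dwealth tm l K N V0 (price w) (z ^~ w) t.
Definition exposure t w := dposition tm l K N V0 (price w) (z ^~ w) t.

(** The holdings solve [pi0 bd + pi1 st = bd W] and [sigma pi1 st = ph bd], with [W] the discounted
    wealth and [ph] the exposure. Both are set to 0 at time 1, which neither the self-financing
    condition nor the left limit sees. *)
Definition bonds_held t w : R :=
  if t < 1 then disc_wealth t w - exposure t w / sigma else 0.
Definition shares_held t w : R :=
  if t < 1 then exposure t w * bd t w / (sigma * st t w) else 0.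

Lemma adapted_disc_wealth t : 0 <= t <= 1 -> ad t (disc_wealth t).
Proof. by move=> t01; apply: adapted_dwealth => //; exact: adapted_price. Qed.

Lemma adapted_exposure t : 0 <= t <= 1 -> ad t (exposure t).
Proof. by move=> t01; apply: adapted_dposition => //; exact: adapted_price. Qed.

Lemma left_cvgP (f : R -> R) t : f s @[s --> t^'-] --> f t -> forall e, 0 < e ->
  exists2 dl, 0 < dl & forall s, 0 <= s -> t - dl < s < t -> `|f s - f t| < e.
Proof.
move=> /cvgrPdist_lt h e /h [dl /= dl0 hd]; exists dl => // s _ /andP[s1 s2].
rewrite distrC; apply: hd => //=.
by rewrite ger0_norm ?subr_ge0 ?ltW//; lra.
Qed.

Lemma predictable_bonds : predictable (market_filtration P bd st) bonds_held.
Proof.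
apply: left_continuous_predictable.
- move=> t /andP[t0 t1]; rewrite /bonds_held t1.
  have t01 : 0 <= t <= 1 by rewrite t0 ltW.
  apply: measurable_funB; first exact: adapted_disc_wealth.
  by apply: measurable_funM; [exact: adapted_exposure|exact: measurable_cst].
- move=> w t /andP[t0 t1]; apply: (@left_cvgP (bonds_held ^~ w)); rewrite /bonds_held t1.
  apply: (@cvg_trans _ ((disc_wealth s w - exposure s w / sigma) @[s --> t^'-])).
    apply: near_eq_cvg; near=> s; rewrite ifT//.
    by apply: lt_trans t1; near: s; exact: nbhs_left_lt.
  apply: cvgB; first by apply: dwealth_left_cvg => //; exact: continuous_price.
  by apply: cvgMr_tmp; exact: dposition_left_cvg.
- by move=> w; rewrite /bonds_held ltxx.
Unshelve. all: by end_near.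
Qed.

Lemma predictable_shares : predictable (market_filtration P bd st) shares_held.
Proof.
have [Cr hr] := rate_bound.
apply: left_continuous_predictable.
- move=> t /andP[t0 t1]; rewrite /shares_held t1.
  have t01 : 0 <= t <= 1 by rewrite t0 ltW.
  have tt : 0 <= t <= t by rewrite t0 lexx.
  have aB := @adapted_bd _ _ _ P bd st _ _ tt; have aS := @adapted_st _ _ _ P bd st _ _ tt.
  apply: measurable_funM; first by apply: measurable_funM => //; exact: adapted_exposure.
  have -> : (fun w => (sigma * st t w)^-1) = (fun w => sigma^-1 * expR (- ln (st t w))).
    by apply/funext => w; rewrite invfM expRN lnK// posrE stock_gt0.
  apply: measurable_funM => //; apply: measurableT_comp => //.
  by apply: measurableT_comp => //; apply: measurableT_comp; first exact: measurable_ln.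
- move=> w t /andP[t0 t1]; apply: (@left_cvgP (shares_held ^~ w)); rewrite /shares_held t1.
  have t01 : 0 <= t <= 1 by rewrite !ltW.
  pose f s := exposure s w * bondp (r ^~ w) s / (sigma * (S0 * expR (mu * s + sigma * noise w s))).
  have fE s : 0 <= s <= 1 -> exposure s w * bd s w / (sigma * st s w) = f s.
    by move=> s01; rewrite /f (noiseE w s01) (bond_bondp r w s01) /stock.
  rewrite (fE t t01).
  apply: (@cvg_trans _ (f s @[s --> t^'-])).
    apply: near_eq_cvg; near=> s.
    have st1 : s < t by near: s; exact: nbhs_left_lt.
    have s0 : 0 < s by near: s; exact: nbhs_left_gt.
    have s01 : 0 <= s <= 1 by rewrite (ltW s0) (ltW (lt_trans st1 t1)).
    by rewrite (lt_trans st1 t1) (fE s s01).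
  apply: cvgM.
    apply: cvgM; first exact: dposition_left_cvg.
    apply: cvg_at_left_filter.
    exact: (continuous_bondp (measurable_rate_path rb w) (hr w)).
  apply: cvgV; first by rewrite mulf_neq0// mulf_neq0// gt_eqF// expR_gt0.
  apply: cvgMl_tmp; apply: cvgMl_tmp.
  apply: (cvg_comp _ expR); last exact: continuous_expR.
  apply: cvg_at_left_filter.
  by apply: cvgD; apply: cvgMl_tmp; [exact: cvg_id|exact: continuous_noise].
- by move=> w; rewrite /shares_held ltxx.
Unshelve. all: by end_near.
Qed.

Lemma portfolio_valueE t w : t < 1 ->
  portfolio_value bd st bonds_held shares_held t w = bd t w * disc_wealth t w.
Proof.
move=> t1; rewrite /portfolio_value /bonds_held /shares_held t1.
have s0 : st t w != 0 by rewrite gt_eqF// stock_gt0.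
have aux (v e b s : R) : s != 0 -> (v - e / sigma) * b + e * b / (sigma * s) * s = b * v.
  by move=> s0'; field; rewrite sigma_neq0 s0'.
exact: aux.
Qed.

Lemma bond_zero w : bd 0 w = 1.
Proof. by rewrite bond_bondp ?lexx ?ler01// bondp0. Qed.

Lemma portfolio_value0 w : portfolio_value bd st bonds_held shares_held 0 w = V0.
Proof.
by rewrite portfolio_valueE// bond_zero mul1r /disc_wealth dwealth0.
Qed.

(** Some [tm M] lies beyond [T], so on [[0, T]] only finitely many periods matter and
    [strategy_gain] applies path by path; drift and volatility of the portfolio reduce to those of
    [gain]. *)
Lemma strategy_self_financing (al b T : R) : 1 - H < al -> al < 1 / 2 -> 1 - al < b ->
  0 < b -> b < H -> b <= 1 -> 0 < al -> 0 < T -> T < 1 ->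
  self_financing P H S0 mu sigma BH r bonds_held shares_held T.
Proof.
move=> Hal al2 alb b0 bH b1 al0 T0 T1.
have al01 : 0 < al < 1 by rewrite al0/=; lra.
have [Cr hr] := rate_bound.
have [M /ltW TM] := tm_cvg T1.
pose ph w := position_upto tm l K N V0 (price w) (z ^~ w) M.
pose W w := wealth_upto tm l K N V0 (price w) (z ^~ w) M.
have G : {ae P, forall w, gain al (r ^~ w) (noise w) mu sigma (ph w) (W w)}.
  apply: filterS (noise_holder b0 bH) => w [C C0 hg].
  exact: (strategy_gain al01 alb b1 (measurable_rate_path rb w) (hr w) hg mu sigma K N V0
    (z ^~ w) tm0 l0 tml tm1 M).
have T_1 u : 0 <= u <= T -> u < 1 by move=> /andP[_ uT]; exact: le_lt_trans uT T1.
have T01 u : 0 <= u <= T -> 0 <= u <= 1.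
  by move=> uT; rewrite (ltW (T_1 u uT)) andbT; case/andP: uT.
have WE w u : 0 <= u <= T -> disc_wealth u w = W w u.
  by move=> /andP[_ uT]; apply: dwealthE => //; exact: le_trans uT TM.
have phE w u : 0 <= u <= T -> exposure u w = ph w u.
  by move=> /andP[_ uT]; apply: dpositionE => //; exact: le_trans uT TM.
have driftE w u : 0 <= u <= T ->
    bonds_held u w * r u w * bd u w + shares_held u w * mu * st u w =
    drift (r ^~ w) mu sigma (ph w) (W w) u.
  move=> uT; rewrite /bonds_held /shares_held (T_1 u uT) (WE w u uT) (phE w u uT).
  rewrite /drift /kappa -(bond_bondp r w (T01 u uT)).
  have s0 : st u w != 0 by rewrite gt_eqF// stock_gt0.
  have aux (v e b' s' q : R) : s' != 0 -> (v - e / sigma) * q * b' + e * b' / (sigma * s') * mu * s' =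
      q * b' * v + e * b' * ((mu - q) / sigma).
    by move=> s0'; field; rewrite sigma_neq0 s0'.
  exact: aux.
have volE w u : 0 <= u <= T ->
    sigma * shares_held u w * st u w = ph w u * bondp (r ^~ w) u.
  move=> uT; rewrite /shares_held (T_1 u uT) (phE w u uT) -(bond_bondp r w (T01 u uT)).
  have s0 : st u w != 0 by rewrite gt_eqF// stock_gt0.
  have aux (e b' s' : R) : s' != 0 -> sigma * (e * b' / (sigma * s')) * s' = e * b'.
    by move=> s0'; field; rewrite sigma_neq0 s0'.
  exact: aux.
rewrite /self_financing; split.
  apply: filterS G => w [_ i1 _].
  have i2 := integrable_sub01 i1 (lexx 0) (ltW T1).
  apply: eq_integrable i2; first exact: measurable_itv.
  by move=> u; rewrite inE/= in_itv/= => uT; rewrite (driftE w u uT).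
exists al; split => //.
- apply: filterS G => w [adm _ _].
  rewrite (eq_normW al (volE w)).
  by have [|_ _] := adm T; first by rewrite (ltW T0) (ltW T1).
- apply: filterS G => w [_ _ eqn] t /andP[t0 tT].
  have t_1 : t < 1 by exact: le_lt_trans tT T1.
  have t01 : 0 <= t <= 1 by rewrite t0 (ltW t_1).
  have sub u : 0 <= u <= t -> 0 <= u <= T.
    by move=> /andP[u0 ut]; rewrite u0 (le_trans ut tT).
  rewrite portfolio_value0 (portfolio_valueE w t_1) (WE w t (sub t _)) ?t0 ?lexx//.
  have W0 : W w 0 = V0.
    rewrite -(WE w 0); last by rewrite lexx ltW.
    exact: dwealth0.
  have gE : gLS_integral al (fun u => sigma * shares_held u w * st u w) (BH ^~ w) t =
      gLS_integral al (fun u => ph w u * bondp (r ^~ w) u) (noise w) t.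
    apply: (eq_gLS al01).
      by move=> u ut; exact: volE (sub u ut).
    by move=> u ut; rewrite noiseE//; exact: T01 (sub u ut).
  have dE : \int[lebesgue_measure]_(u in `[0, t])
        (bonds_held u w * r u w * bd u w + shares_held u w * mu * st u w) =
      \int[lebesgue_measure]_(u in `[0, t]) drift (r ^~ w) mu sigma (ph w) (W w) u.
    by apply: eq_Rintegral => u; rewrite inE/= in_itv/= => ut; exact: driftE (sub u ut).
  rewrite gE dE -addrA -(eqn t t01) W0 (bond_bondp r w t01).
  by rewrite addrC subrK.
Qed.

End strategy.

End market_model.

(** * Almost sure convergence and the theorem *)

(** With [eps = 2^-n] in [small_scale], [B^H] moves by at most [2 / K + c l] in period [n] with
    probability at most [2^-n]. By Borel-Cantelli all late periods see a larger move; the drift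
    takes away at most [c l], so [X] moves by at least [2 / K] and [good_periods] applies. *)
Lemma market_hedging (R : realType) (d : measure_display) (Omega : measurableType d)
    (P : probability Omega R) (H : R) (BH r : R -> Omega -> R) (mu sigma : R)
    (tm : nat -> R) (z : nat -> Omega -> R) (V0 : R) (b : R) (y : Omega -> R) :
  is_fBm P H BH -> bounded_rate r -> sigma != 0 -> H < 1 -> 1 / 2 < b -> b < H -> b <= 1 ->
  tm 0%N = 0 -> (forall n, tm n < tm n.+1) -> (forall n, tm n < 1) ->
  (forall t, t < 1 -> exists n, t < tm n) ->
  {ae P, forall w, z n w @[n --> \oo] --> y w} ->
  exists (l K : nat -> R) (N : nat -> nat), [/\ forall n, 0 <= l n,
    forall n, tm n + l n <= tm n.+1 &
    {ae P, forall w, disc_wealth BH r mu sigma tm l K N V0 z t w @[t --> 1^'-] --> y w}].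
Proof.
move=> fB rb sg0 H1 b2 bH b1 tm0 tmS tm1 tmc zy.
have b0 : 0 < b by apply: lt_trans b2; rewrite divr_gt0.
have H0 : 0 < H by exact: lt_trans bH.
have [Cr hr] := rate_bound rb.
have [w0 _] : exists w0 : Omega, True by exists point.
have Cr0 : 0 <= Cr by apply: le_trans (hr w0 0 _) => //; rewrite lexx ler01.
pose c := kappa_bound Cr mu sigma.
have c0 : 0 <= c by rewrite divr_ge0// addr_ge0.
have e0 n : 0 < 1 / 2 ^+ n :> R by rewrite divr_gt0// exprn_gt0.
have gap n : 0 < tm n.+1 - tm n by rewrite subr_gt0.
have /choice[lK hlK] : forall n, exists lK : R * R,
    [/\ 0 < lK.1, lK.1 <= tm n.+1 - tm n, 0 < lK.2 &
        6 * (2 / lK.2 + c * lK.1) / lK.1 `^ H <= 1 / 2 ^+ n].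
  by move=> n; have [l [K h]] := small_scale H0 H1 c0 (gap n) (e0 n); exists (l, K).
pose l n := (lK n).1; pose K n := (lK n).2.
have l0 n : 0 < l n by have [] := hlK n.
have K0 n : 0 < K n by have [] := hlK n.
have lS n : tm n + l n <= tm n.+1 by rewrite -lerBrDl; have [] := hlK n.
have /choice[N hN] : forall n, exists N : nat,
    n.+1%:R * K n ^+ 2 * N.+1%:R `^ (1 - 2 * b) <= 1.
  by move=> n; apply: fine_mesh => //; rewrite mulr_gt0// exprn_gt0.
have l0' n : 0 <= l n by exact: ltW.
exists l, K, N; split => //.
have t_0 n : 0 <= tm n := tm_ge0 tm0 l0' lS n.
have tl01 n : 0 <= tm n + l n <= 1 by rewrite addr_ge0//= (tml1 lS tm1).
have t01 n : 0 <= tm n <= 1 by rewrite t_0 ltW.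
pose E n := [set w | `|BH (tm n + l n) w - BH (tm n) w| <= 2 / K n + c * l n].
have e1 n : 0 <= 2 / K n + c * l n.
  by apply: addr_ge0; [rewrite divr_ge0 ?(ltW (K0 n))|rewrite mulr_ge0].
have mE n : measurable (E n).
  rewrite -[X in measurable X]setTI.
  have -> : E n = (fun w => `|BH (tm n + l n) w - BH (tm n) w|) @^-1` `]-oo, (2 / K n + c * l n)].
    by apply/seteqP; split => x /=; rewrite in_itv.
  have mf : measurable_fun setT (fun w => `|BH (tm n + l n) w - BH (tm n) w|).
    apply: measurableT_comp => //; apply: measurable_funB; exact: (fBm_measurable fB).
  exact: mf.
have PE n : (P (E n) <= (1 / 2 ^+ n)%:E)%E.
  have ne : tm n != tm n + l n by rewrite lt_eqF// ltrDl.
  apply: le_trans (fBm_small_ball H0 fB (t01 n) (tl01 n) ne (e1 n)) _.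
  have -> : tm n + l n - tm n = l n by rewrite addrC addKr.
  rewrite lee_fin ger0_norm//.
  by have [_ _ _] := hlK n.
apply: filterS3 (borel_cantelli ler01 mE PE) zy (noise_holder fB b0 bH) => w [n0 hn0] zw [C C0 hg].
have mr := measurable_rate_path rb w.
apply: (dwealth_cvg (tm := tm)) => //.
apply: (@good_periods R tm l K N b (asset_const Cr C mu sigma)) => //.
- exact: ltW.
- by rewrite addr_ge0.
- by move=> x y' x01 y01; exact: (asset_holder b1 mr (hr w) hg mu sigma x01 y01).
exists n0 => n n0n.
have tlt : tm n <= tm n + l n by rewrite lerDl.
apply: le_trans (asset_increment (noise BH w) mu sg0 mr (hr w) tlt).
rewrite !noiseE//; have -> : tm n + l n - tm n = l n by rewrite addrC addKr.
rewrite lerBrDr; apply/ltW; rewrite ltNge; apply/negP => Ew.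
exact: hn0 n0n Ew.
Qed.

Theorem theorem4p3 (R : realType) (d : measure_display)
    (Omega : measurableType d) (P : probability Omega R)
    (P_complete : measure_is_complete P)
    (H : R) (H_gt : 1 / 2 < H) (H_lt : H < 1)
    (BH : R -> Omega -> R) (BH_fBm : is_fBm P H BH)
    (r : R -> Omega -> R) (r_bounded : bounded_rate r)
    (S0 mu sigma : R) (S0_gt0 : 0 < S0) (sigma_neq0 : sigma != 0) :
  let bd := bond r in
  let st := stock S0 mu sigma BH in
  let F := market_filtration P bd st in
  forall (xi : Omega -> R) (V0 : R), contingent_claim F xi ->
  exists pi0 pi1 : R -> Omega -> R,
    [/\ predictable F pi0 /\ predictable F pi1,
        forall T : R, 0 < T -> T < 1 ->
          self_financing P H S0 mu sigma BH r pi0 pi1 T,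
        {ae P, forall w, portfolio_value bd st pi0 pi1 0 w = V0} &
        {ae P, forall w,
           portfolio_value bd st pi0 pi1 t w @[t --> 1^'-] --> xi w}].
Proof.
move=> bd st F xi V0 [xi0 xiF].
(* Halfway between [1/2] and [H]: above [1/2] for the Riemann sums, below [H] for the path
   regularity. *)
pose b := (1 / 2 + H) / 2.
have b2 : 1 / 2 < b by rewrite /b; lra.
have bH : b < H by rewrite /b; lra.
have b1 : b <= 1 by rewrite ltW// (lt_trans bH).
have b0 : 0 < b by apply: lt_trans b2; rewrite divr_gt0.
have [Cr hr] := rate_bound r_bounded.
have one01 : 0 <= (1 : R) <= 1 by rewrite ler01 lexx.
(* The hedge works in discounted units, so the target is the discounted claim. *)
pose y w := xi w / bd 1 w.
have y0 w : 0 <= y w by rewrite divr_ge0// expR_ge0.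
have ay : adapted P bd st 1 y.
  apply: measurable_funM; first by apply/adaptedP; exact: xiF.
  have -> : (fun w => (bd 1 w)^-1) = (fun w => expR (- ln (bd 1 w))).
    by apply/funext => w; rewrite expRN lnK// posrE bond_gt0.
  apply: measurableT_comp => //; apply: measurableT_comp => //.
  by apply: measurableT_comp; [exact: measurable_ln|exact: adapted_bd].
have yF A : measurable A -> F (1 : R) (y @^-1` A) by exact: (adaptedP _ _ _ _ _).1.
have lim w := bond_stock_limit S0 mu sigma BH_fBm r_bounded w.
have [tm [z [tm0 tmS tm1 tmc [_ az zy]]]] :=
  adapted_approximation P_complete (measurable_bond r_bounded)
    (measurable_stock S0 mu sigma BH_fBm) (fun w => (lim w).1) (fun w => (lim w).2) y0 yF.
have [l [K [N [l0 tml cvg]]]] :=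
  market_hedging mu V0 BH_fBm r_bounded sigma_neq0 H_lt b2 bH b1 tm0 tmS tm1 tmc zy.
exists (bonds_held BH r mu sigma tm l K N V0 z), (shares_held BH r S0 mu sigma tm l K N V0 z).
split.
- split.
    exact: (predictable_bonds BH_fBm r_bounded S0_gt0 sigma_neq0 K N V0 tm0 l0 tml tm1 tmc az).
  exact: (predictable_shares BH_fBm r_bounded S0_gt0 sigma_neq0 K N V0 tm0 l0 tml tm1 tmc az).
- move=> T T0 T1.
  (* Halfway between [1 - b] and [1/2]; as [b < H], it also exceeds [1 - H]. *)
  pose al := (1 - b + 1 / 2) / 2.
  have Hal : 1 - H < al by rewrite /al; lra.
  have al2 : al < 1 / 2 by rewrite /al; lra.
  have alb : 1 - al < b by rewrite /al; lra.
  have al0 : 0 < al by rewrite /al; lra.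
  exact: (strategy_self_financing mu BH_fBm r_bounded S0_gt0 sigma_neq0 K N V0 z
    tm0 l0 tml tm1 tmc Hal al2 alb b0 bH b1 al0 T0 T1).
- by apply: filterE => w; exact: portfolio_value0.
apply: filterS cvg => w cw.
(* Discounting is undone: by continuity of the bond, [bd t] times the discounted wealth tends to
   [bd 1] times the discounted claim. *)
have -> : xi w = bd 1 w * y w.
  by rewrite /y mulrC divfK// gt_eqF// bond_gt0.
have cb : bondp (r ^~ w) t @[t --> 1^'-] --> bd 1 w.
  rewrite /bd (bond_bondp r w one01); apply: cvg_at_left_filter.
  exact: (continuous_bondp (measurable_rate_path r_bounded w) (hr w)).
apply: cvg_trans (cvgM cb cw); apply: near_eq_cvg; near=> t.
have t1 : t < 1 by near: t; exact: nbhs_left_lt.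
have t0 : 0 < t by near: t; exact: nbhs_left_gt.
rewrite portfolio_valueE//.
by rewrite /bd (bond_bondp r w (t := t))// (ltW t0) ltW.
Unshelve. all: by end_near.
Qed.
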